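(* Let $n\ge2$ and let $\tilde\omega\in\Omega^1(\tilde{\mathcal G},\tilde{\mathfrak g})$ be the conformal Cartan connection, with curvature function $\tilde\kappa$, induced from a normal projective Cartan connection $\omega\in\Omega^1(\mathcal G,\mathfrak g)$ in dimension $n$ via the Fefferman-type construction described in the context. Then, for any $u\in\mathcal G$, $\tilde\partial^*\tilde\kappa(u)$ can be viewed as an element of $$f\otimes\Lambda^2\bar F,$$ and $\tilde\partial^*\tilde\kappa_0(u)$ defines an element of $$f\otimes\Lambda^2f,$$ under the identifications in the context.
   Context: Algebraic data. Equip $\mathbb{R}^{n+1,n+1}=\mathbb{R}^{2n+2}$ with $h=\begin{pmatrix}0&I_{n+1}\\ I_{n+1}&0\end{pmatrix}$, let $\tilde G=\mathrm{Spin}(n+1,n+1)$, with real spin representation $\Delta=\Delta_+\oplus\Delta_-$. Fix pure spinors $s_F\in\Delta_-$ and $s_E\in\Delta_+$ ($n$ even) or $s_E\in\Delta_-$ ($n$ odd) with non-trivial pairing, whose kernels under Clifford multiplication are $E=\mathbb{R}^{n+1}\oplus0$ and $F=0\oplus\mathbb{R}^{n+1}\cong(\mathbb{R}^{n+1})^*$. Let $G=\{g\in\tilde G: g\cdot s_E=s_E,\ g\cdot s_F=s_F\}\cong\mathrm{SL}(n+1,\mathbb{R})$; on Lie algebras the inclusion is $A\mapsto\begin{pmatrix}A&0\\0&-A^t\end{pmatrix}$. Let $\tilde P\subset\tilde G$ be the stabiliser of the ray $\mathbb{R}_+\tilde v_+$, $\tilde v_+=(1,0,\dots,0,1)^t$,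 $Q=G\cap\tilde P$, and $P\subset G$ the stabiliser of the ray $\mathbb{R}_+v_+$, $v_+=(1,0,\dots,0)^t\in\mathbb{R}^{n+1}$. Then $Q\subset P$ and $\mathfrak g/\mathfrak q\cong\tilde{\mathfrak g}/\tilde{\mathfrak p}$; $\tilde{\mathfrak p}_+$ is the nilradical of $\tilde{\mathfrak p}$ and $\tilde{\mathfrak g}_0=\tilde{\mathfrak p}/\tilde{\mathfrak p}_+$. Construction. A projective structure on $M$ is a class of torsion-free affine connections with the same unparametrised geodesics; an oriented one is encoded in a normal parabolic geometry $(\mathcal G\to M,\omega)$ of type $(G,P)$ (curvature function annihilated by the Kostant codifferential). Put $\tilde M=\mathcal G/Q$, $\tilde{\mathcal G}=\mathcal G\times_Q\tilde P\to\tilde M$, and let $\tilde\omega$ be the unique Cartan connection of type $(\tilde G,\tilde P)$ on $\tilde{\mathcal G}$ restricting to $\omega$ on $\mathcal G\subset\tilde{\mathcal G}$; $\tilde\kappa$ is its curvature function. The Kostant codifferential for $(\tilde{\mathfrak g},\tilde{\mathfrak p})$ is $\tilde\partial^*\tilde\kappa(u)(X)=2\sum_i[\tilde\kappa(u)(X_i,X),\tilde Z_i]$, where $X_i\in\tilde{\mathfrak g}$ induce a basis of $\tilde{\mathfrak g}/\tilde{\mathfrak p}$ and $\tilde Z_i\in\tilde{\mathfrak p}_+\cong(\tilde{\mathfrak g}/\tilde{\mathfrak p})^*$ is the dual basis with respect to the Killing form. Restricted to $\mathcal G$, this is a function $\tilde\partial^*\tilde\kappa:\mathcal G\to(\tilde{\mathfrak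 g}/\tilde{\mathfrak p})^*\otimes\tilde{\mathfrak p}\cong(\mathfrak g/\mathfrak q)^*\otimes\tilde{\mathfrak p}$, and $\tilde\partial^*\tilde\kappa_0:\mathcal G\to(\mathfrak g/\mathfrak q)^*\otimes\tilde{\mathfrak p}/\tilde{\mathfrak p}_+$ is its composition with the projection $\tilde{\mathfrak p}\to\tilde{\mathfrak p}/\tilde{\mathfrak p}_+$. Subspaces and identifications. Let $L=\mathbb{R}\tilde v_+$ and $\bar F=F\cap L^\perp$ (an $n$-dimensional isotropic subspace), and let $\mathrm f\subset L^\perp/L$ be the ($n$-dimensional, isotropic) image of $\bar F$. One has $\mathfrak g/\mathfrak q\cong\tilde{\mathfrak g}/\tilde{\mathfrak p}\cong L^*\otimes(L^\perp/L)\cong\mathbb{R}^{n,n}$ via $X\mapsto(\tilde v_+)^*\otimes X\cdot\tilde v_+$, and $f=\mathfrak p/\mathfrak q\subset\mathfrak g/\mathfrak q$ corresponds to $L^*\otimes\mathrm f$; it is maximally isotropic for the induced (conformal class of) inner product of signature $(n,n)$. Using this inner product, $f$ is identified with the annihilator of $f$ in $(\mathfrak g/\mathfrak q)^*$; thus being an element of $f\otimes W$ (for $W\subset\tilde{\mathfrak p}$ or $W\subset\tilde{\mathfrak g}_0$) means being a linear map $\mathfrak g/\mathfrak q\to W$ vanishing on $f$. Using $h$ one identifies $\tilde{\mathfrak g}=\mathfrak{so}(n+1,n+1)=\Lambda^2\mathbb{R}^{n+1,n+1}$, so $\Lambda^2\bar F\subset\tilde{\mathfrak p}\subset\tilde{\mathfrak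 g}$ (elements of $\Lambda^2\bar F$ annihilate $\tilde v_+$). Similarly the semisimple part of $\tilde{\mathfrak g}_0$ is $\mathfrak{so}(L^\perp/L)=\Lambda^2(L^\perp/L)$, and $\Lambda^2f\subset\tilde{\mathfrak g}_0$ denotes the subspace $\Lambda^2\mathrm f\subset\Lambda^2(L^\perp/L)$. *)

(* Defs.v *)
From HB Require Import structures.
From mathcomp Require Export all_boot all_order all_algebra.
From mathcomp Require Export all_classical all_reals all_analysis.

Set Implicit Arguments.
Unset Strict Implicit.
Unset Printing Implicit Defensive.

Export Order.TTheory GRing.Theory Num.Theory numFieldNormedType.Exports.

Global Open Scope classical_set_scope.
Global Open Scope ring_scope.

Fixpoint Ck_on (R : realType) (V W : normedModType R) (k : nat)
    (U : set V) (f : V -> W) : Prop :=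
  if k is k'.+1 then
    (forall x, U x -> differentiable f x) /\
    (forall v, Ck_on k' U (fun x => 'd f x v))
  else forall x, U x -> {for x, continuous f}.

(* meant for open U *)
Definition smooth_on (R : realType) (V W : normedModType R)
    (U : set V) (f : V -> W) : Prop := forall k, Ck_on k U f.

(* Each point p carries a preferred chart (dom p, chart p, unchart p) around it;
   these charts form the atlas.  The tangent space at p is then the model space
   'rV[R]_d, read in the preferred chart at p. *)
Record manifold (R : realType) (d : nat) := Manifold {
  carrier :> topologicalType;
  dom : carrier -> set carrier;
  chart : carrier -> carrier -> 'rV[R]_d;
  unchart : carrier -> 'rV[R]_d -> carrier;
  manifold_hausdorff : hausdorff_space carrier;
  manifold_second_countable : @second_countable carrier;
  dom_center : forall p, dom p p;
  dom_open : forall p, open (dom p);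
  chart_open : forall p, open (chart p @` dom p);
  chartK : forall p x, dom p x -> unchart p (chart p x) = x;
  chart_continuous : forall p x, dom p x -> {for x, continuous (chart p)};
  unchart_continuous : forall p y, (chart p @` dom p) y ->
    {for y, continuous (unchart p)};
  transition_smooth : forall p q,
    smooth_on (chart p @` (dom p `&` dom q)) (chart q \o unchart p)
}.

Arguments dom {R d} _ _ _.
Arguments chart {R d} _ _ _.
Arguments unchart {R d} _ _ _.

(* maps from an open subset of R^k to a manifold *)
Definition smooth_plot (R : realType) (k e : nat) (N : manifold R e)
    (U : set 'rV[R]_k) (a : 'rV[R]_k -> N) : Prop :=
  (forall x, U x -> {for x, continuous a}) /\
  (forall q : N, smooth_on (U `&` a @^-1` dom N q) (chart N q \o a)).

Definition smooth_map_on (R : realType) (d e : nat) (M : manifold R d)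
    (N : manifold R e) (U : set M) (F : M -> N) : Prop :=
  forall p : M, smooth_plot (chart M p @` (U `&` dom M p)) (F \o unchart M p).

Definition smooth_fun_on (R : realType) (d : nat) (W : normedModType R)
    (M : manifold R d) (U : set M) (f : M -> W) : Prop :=
  forall p : M, smooth_on (chart M p @` (U `&` dom M p)) (f \o unchart M p).

Definition tangent_map (R : realType) (d e : nat) (M : manifold R d)
    (N : manifold R e) (F : M -> N) (p : M) : 'rV[R]_d -> 'rV[R]_e :=
  'd (chart N (F p) \o F \o unchart M p) (chart M p p).

(* velocity at time 0 of a curve *)
Definition velocity (R : realType) (d : nat) (M : manifold R d)
    (a : R -> M) : 'rV[R]_d :=
  derive1 (fun t => chart M (a 0) (a t)) 0.

(* A W-valued 1-form is a map M -> 'rV_d -> W, linear in the second argument;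
   form_in_chart w p is its expression in the fixed chart at p. *)
Definition form_in_chart (R : realType) (d : nat) (W : normedModType R)
    (M : manifold R d) (w : M -> 'rV[R]_d -> W) (p : M)
    (x v : 'rV[R]_d) : W :=
  let q := unchart M p x in w q ('d (chart M q \o unchart M p) x v).

Definition smooth_form (R : realType) (d : nat) (W : normedModType R)
    (M : manifold R d) (w : M -> 'rV[R]_d -> W) : Prop :=
  (forall p (a : R) v v', w p (a *: v + v') = a *: w p v + w p v') /\
  (forall p v, smooth_on (chart M p @` dom M p) (fun x => form_in_chart w p x v)).

(* exterior derivative, dw(X,Y) = X w(Y) - Y w(X) - w([X,Y]), evaluated on
   coordinate fields of the chart at p *)
Definition ext_deriv (R : realType) (d : nat) (W : normedModType R)
    (M : manifold R d) (w : M -> 'rV[R]_d -> W) (p : M)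
    (v v' : 'rV[R]_d) : W :=
  'D_v (fun x => form_in_chart w p x v') (chart M p p) -
  'D_v' (fun x => form_in_chart w p x v) (chart M p p).

(* The structure group is a closed matrix group H, given as a set of matrices;
   its smooth structure is the one of an embedded submanifold, so that smooth
   maps into H are smooth matrix-valued maps with values in H.  Smoothness of
   the action E x H -> E is tested on smooth maps from open subsets of R^k. *)
Definition principal_bundle (R : realType) (d e N : nat) (H : set 'M[R]_N)
    (E : manifold R e) (M : manifold R d) (pi : E -> M)
    (act : E -> 'M[R]_N -> E) : Prop :=
  [/\ smooth_map_on setT pi,
      (forall u, act u 1%:M = u) /\
      (forall u g h, H g -> H h -> act u (g *m h) = act (act u g) h),
      (forall k (U : set 'rV[R]_k) (a : 'rV[R]_k -> E) (b : 'rV[R]_k -> 'M[R]_N),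
        open U -> smooth_plot U a -> smooth_on U b -> (forall x, U x -> H (b x)) ->
        smooth_plot U (fun x => act (a x) (b x))),
      (forall u u', pi u = pi u' <-> exists h, H h /\ u' = act u h) /\
      (forall u g h, H g -> H h -> act u g = act u h -> g = h) &
      (forall x, exists (U : set M) (s : M -> E) (t : E -> 'M[R]_N),
        [/\ open U, U x, smooth_map_on U s /\ (forall y, U y -> pi (s y) = y),
            smooth_fun_on (pi @^-1` U) t &
            forall u, U (pi u) -> H (t u) /\ u = act (s (pi u)) (t u)])].

Definition lie (R : realType) (m : nat) (A B : 'M[R]_m) : 'M[R]_m :=
  A *m B - B *m A.

(* trace of ad X o ad Y on g *)
Definition killing (R : realType) (m : nat) (g : {vspace 'M[R]_m})
    (X Y : 'M[R]_m) : R :=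
  \sum_(i < \dim g) coord (vbasis g) i (lie X (lie Y (vbasis g)`_i)).

Definition is_subspace (R : realType) (m : nat) (I : set 'M[R]_m) : Prop :=
  I 0 /\ forall (a : R) A B, I A -> I B -> I (a *: A + B).

Definition is_ideal (R : realType) (m : nat) (p I : set 'M[R]_m) : Prop :=
  [/\ is_subspace I, I `<=` p & forall A B, p A -> I B -> I (lie A B)].

Definition is_nilpotent (R : realType) (m : nat) (I : set 'M[R]_m) : Prop :=
  exists k : nat, forall (s : seq 'M[R]_m) (B : 'M[R]_m), size s = k ->
    (forall A, A \in s -> I A) -> I B -> foldr (@lie R m) B s = 0.

(* the largest nilpotent ideal of p, as the union of all nilpotent ideals *)
Definition nilradical (R : realType) (m : nat) (p : set 'M[R]_m) : set 'M[R]_m :=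
  [set A | exists I : set 'M[R]_m, [/\ is_ideal p I, is_nilpotent I & I A]].

(* X induces a basis of g/p and Z in p_+ is the dual basis *)
Definition dual_frames (R : realType) (m k : nat) (g : {vspace 'M[R]_m})
    (p : set 'M[R]_m) (X Z : 'I_k -> 'M[R]_m) : Prop :=
  [/\ forall i, X i \in g,
      forall A, A \in g ->
        exists! a : 'rV[R]_k, p (A - \sum_i a 0 i *: X i),
      forall i, nilradical p (Z i) &
      forall i j, killing g (Z i) (X j) = (i == j)%:R].

(* Kostant codifferential of a 2-cochain, for |1|-graded g *)
Definition codifferential (R : realType) (m k : nat) (X Z : 'I_k -> 'M[R]_m)
    (kappa : 'M[R]_m -> 'M[R]_m -> 'M[R]_m) (A : 'M[R]_m) : 'M[R]_m :=
  2 *: \sum_i lie (kappa (X i) A) (Z i).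

Definition hmx (R : realType) (n : nat) : 'M[R]_(n.+1 + n.+1) :=
  block_mx 0 1%:M 1%:M 0.

Definition hform (R : realType) (n : nat) (v w : 'cV[R]_(n.+1 + n.+1)) : R :=
  (v^T *m hmx R n *m w) 0 0.

Definition spin_dim (n : nat) : nat := #|{: {set 'I_n.+1}}|.

(* Clifford multiplication by v = (x, xi) on Delta = Lambda^* R^{n+1}, in the
   basis e_T = e_{i_1} /\ ... /\ e_{i_k} for T = {i_1 < ... < i_k}: it is
   x /\ s + 2 iota_xi s, so that v.v.s = h(v, v) s.  Delta_+ and Delta_- are
   the forms of odd and of even degree. *)
Definition clifford (R : realType) (n : nat) (v : 'cV[R]_(n.+1 + n.+1)) :
    'M[R]_(spin_dim n) :=
  \matrix_(r, c)
    let S : {set 'I_n.+1} := enum_val r in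
    let T : {set 'I_n.+1} := enum_val c in
    \sum_(i < n.+1) (-1) ^+ #|[set k in T | (k < i)%N]| *
      (usubmx v i 0 *+ ((i \notin T) && (S == i |: T)) +
       2 * dsubmx v i 0 *+ ((i \in T) && (S == T :\ i))).

(* products of an even number of vectors of square 1 or -1 *)
Definition Spin (R : realType) (n : nat) : set 'M[R]_(spin_dim n) :=
  [set g | exists s : seq 'cV[R]_(n.+1 + n.+1),
    [/\ ~~ odd (size s), forall v, v \in s -> hform v v = 1 \/ hform v v = -1 &
        g = foldr (fun v a => clifford v *m a) 1%:M s]].

Arguments Spin R n _ : clear implicits.

(* A is the image of g under the covering Spin -> SO(n+1,n+1) *)
Definition covers (R : realType) (n : nat) (g : 'M[R]_(spin_dim n))
    (A : 'M[R]_(n.+1 + n.+1)) : Prop :=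
  forall v, g *m clifford v = clifford (A *m v) *m g.

(* the differential of the covering at the identity *)
Definition dcovers (R : realType) (n : nat) (X : 'M[R]_(spin_dim n))
    (A : 'M[R]_(n.+1 + n.+1)) : Prop :=
  forall v, X *m clifford v - clifford v *m X = clifford (A *m v).

(* s is annihilated exactly by E = R^{n+1} + 0, resp. by F = 0 + R^{n+1} *)
Definition spinor_E (R : realType) (n : nat) (s : 'cV[R]_(spin_dim n)) : Prop :=
  forall v, clifford v *m s = 0 <-> dsubmx v = 0.
Definition spinor_F (R : realType) (n : nat) (s : 'cV[R]_(spin_dim n)) : Prop :=
  forall v, clifford v *m s = 0 <-> usubmx v = 0.

Definition stab_spinors (R : realType) (n : nat) (sE sF : 'cV[R]_(spin_dim n)) :
    set 'M[R]_(spin_dim n) :=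
  [set g | [/\ Spin R n g, g *m sE = sE & g *m sF = sF]].

Definition stab_ray (R : realType) (n : nat) (H : set 'M[R]_(spin_dim n))
    (w : 'cV[R]_(n.+1 + n.+1)) : set 'M[R]_(spin_dim n) :=
  [set g | H g /\ exists A (c : R), [/\ covers g A, 0 < c & A *m w = c *: w]].

(* v_+ in E = R^{n+1} *)
Definition vplus (R : realType) (n : nat) : 'cV[R]_(n.+1 + n.+1) :=
  col_mx (delta_mx ord0 0) 0.
Definition vtilde (R : realType) (n : nat) : 'cV[R]_(n.+1 + n.+1) :=
  col_mx (delta_mx ord0 0) (delta_mx ord_max 0).

Definition groupP (R : realType) (n : nat) (sE sF : 'cV[R]_(spin_dim n)) :=
  stab_ray (stab_spinors sE sF) (vplus R n).
Definition groupPt (R : realType) (n : nat) := stab_ray (Spin R n) (vtilde R n).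
Arguments groupPt R n _ : clear implicits.

Definition groupQ (R : realType) (n : nat) (sE sF : 'cV[R]_(spin_dim n)) :=
  stab_spinors sE sF `&` groupPt R n.

Definition so_h (R : realType) (n : nat) : {vspace 'M[R]_(n.+1 + n.+1)} :=
  lker (linfun (fun A : 'M[R]_(n.+1 + n.+1) => A^T *m hmx R n + hmx R n *m A)).

(* sl(n+1) inside so(h) *)
Definition sl_emb (R : realType) (n : nat) (A : 'M[R]_n.+1) :
    'M[R]_(n.+1 + n.+1) := block_mx A 0 0 (- A^T).
Definition sl_h (R : realType) (n : nat) : {vspace 'M[R]_(n.+1 + n.+1)} :=
  (linfun (@sl_emb R n) @: lker (linfun (mxtrace : 'M[R]_n.+1 -> R^o)))%VS.

Lemma so_hP (R : realType) (n : nat) (A : 'M[R]_(n.+1 + n.+1)) :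
  A \in so_h R n <-> A^T *m hmx R n + hmx R n *m A = 0.
Proof.
pose f (B : 'M[R]_(n.+1 + n.+1)) := B^T *m hmx R n + hmx R n *m B.
have lf : linear f.
  move=> a B C; rewrite /f linearP /= mulmxDl mulmxDr -scalemxAl -scalemxAr.
  by rewrite scalerDr addrACA.
pose fl := HB.pack_for {linear 'M[R]_(n.+1 + n.+1) -> 'M[R]_(n.+1 + n.+1)} f
  (GRing.isLinear.Build _ _ _ _ f lf).
rewrite memv_ker (lfunE fl) /= -/(f A); split; first by move/eqP.
by move=> h0; apply/eqP.
Qed.

Lemma sl_hP (R : realType) (n : nat) (B : 'M[R]_(n.+1 + n.+1)) :
  B \in sl_h R n <-> exists A : 'M[R]_n.+1, \tr A = 0 /\ B = sl_emb A.
Proof.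
have le : linear (@sl_emb R n).
  move=> a A C; rewrite /sl_emb scale_block_mx add_block_mx !scaler0 !addr0.
  by rewrite linearP /= opprD scalerN.
pose el := HB.pack_for {linear 'M[R]_n.+1 -> 'M[R]_(n.+1 + n.+1)} (@sl_emb R n)
  (GRing.isLinear.Build _ _ _ _ (@sl_emb R n) le).
pose t : 'M[R]_n.+1 -> R^o := mxtrace.
have lt : linear t by move=> a A C; rewrite /t linearP.
pose tl := HB.pack_for {linear 'M[R]_n.+1 -> R^o} t
  (GRing.isLinear.Build _ _ _ _ t lt).
split.
  move/memv_imgP=> [A]; rewrite memv_ker (lfunE tl) => /eqP tA.
  by rewrite (lfunE el) => ->; exists A.
move=> [A [tA ->]]; apply/memv_imgP; exists A; last by rewrite (lfunE el).
by rewrite memv_ker (lfunE tl); apply/eqP.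
Qed.

(* Lie algebra of the stabiliser of the ray through w *)
Definition stab_line (R : realType) (m : nat) (g : {vspace 'M[R]_m})
    (w : 'cV[R]_m) : set 'M[R]_m :=
  [set A | A \in g /\ exists c : R, A *m w = c *: w].

Definition lieP (R : realType) (n : nat) := stab_line (sl_h R n) (vplus R n).
Definition liePt (R : realType) (n : nat) := stab_line (so_h R n) (vtilde R n).

Arguments lieP R n _ : clear implicits.
Arguments liePt R n _ : clear implicits.

(* Cartan geometry of type (g, H), H a subgroup of Spin(n+1,n+1); the
   fundamental vector fields are tested on smooth curves in H through 1. *)
Definition cartan_geometry (R : realType) (n d e : nat)
    (g : {vspace 'M[R]_(n.+1 + n.+1)}) (H : set 'M[R]_(spin_dim n))
    (E : manifold R e) (M : manifold R d) (pi : E -> M)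
    (act : E -> 'M[R]_(spin_dim n) -> E)
    (omega : E -> 'rV[R]_e -> 'M[R]_(n.+1 + n.+1)) : Prop :=
  [/\ principal_bundle H pi act,
      smooth_form omega,
      (forall u v, omega u v \in g) /\
      (forall u A, A \in g -> exists! v, omega u v = A),
      (forall u v h A, H h -> covers h A ->
        omega (act u h) (tangent_map (fun u' => act u' h) u v) =
        invmx A *m omega u v *m A) &
      (forall u (c : R^o -> 'M[R]_(spin_dim n)) A,
        smooth_on setT c -> (forall t, H (c t)) -> c 0 = 1%:M ->
        dcovers (derive1 c 0) A ->
        omega u (velocity (fun t : R => act u (c t))) = A)].

(* curvature function: kappa(u)(A, B) = K(omega_u^{-1} A, omega_u^{-1} B) for
   K = d omega + 1/2 [omega, omega] *)
Definition curvature (R : realType) (m e : nat) (E : manifold R e)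
    (omega : E -> 'rV[R]_e -> 'M[R]_m) (u : E) (A B : 'M[R]_m) : 'M[R]_m :=
  let inv C := xget 0 [set v | omega u v = C] in
  ext_deriv omega u (inv A) (inv B) + lie A B.

Definition normal_projective (R : realType) (n e : nat) (E : manifold R e)
    (omega : E -> 'rV[R]_e -> 'M[R]_(n.+1 + n.+1)) : Prop :=
  forall u (X Z : 'I_n -> 'M[R]_(n.+1 + n.+1)),
    dual_frames (sl_h R n) (lieP R n) X Z ->
    forall A, A \in sl_h R n -> codifferential X Z (curvature omega u) A = 0.

(* v /\ w as an element of so(h) *)
Definition wedge (R : realType) (n : nat) (v w : 'cV[R]_(n.+1 + n.+1)) :
    'M[R]_(n.+1 + n.+1) :=
  w *m v^T *m hmx R n - v *m w^T *m hmx R n.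

Definition Lperp (R : realType) (n : nat) : set 'cV[R]_(n.+1 + n.+1) :=
  [set x | hform (vtilde R n) x = 0].

Definition Fbar (R : realType) (n : nat) : set 'cV[R]_(n.+1 + n.+1) :=
  [set x | usubmx x = 0 /\ Lperp x].

Definition Lambda2_Fbar (R : realType) (n : nat) : set 'M[R]_(n.+1 + n.+1) :=
  [set A | exists k (v w : 'I_k -> 'cV[R]_(n.+1 + n.+1)),
    (forall i, Fbar (v i) /\ Fbar (w i)) /\ A = \sum_i wedge (v i) (w i)].

Arguments Lambda2_Fbar R n _ : clear implicits.

(* Preimage in p~ of Lambda^2 f, where p~/p~_+ = R + so(L^perp/L), A + p~_+
   being given by the scalar by which A acts on L and by the endomorphism that
   A induces on L^perp/L.  Elements of f in L^perp/L are represented by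
   elements of Fbar, and equality in L^perp/L is equality modulo L. *)
Definition Lambda2_f (R : realType) (n : nat) : set 'M[R]_(n.+1 + n.+1) :=
  [set A | [/\ liePt R n A, A *m vtilde R n = 0 &
    exists k (v w : 'I_k -> 'cV[R]_(n.+1 + n.+1)),
      (forall i, Fbar (v i) /\ Fbar (w i)) /\
      forall x, Lperp x -> exists c : R,
        A *m x = (\sum_i wedge (v i) (w i)) *m x + c *: vtilde R n]].

Arguments Lambda2_f R n _ : clear implicits.

(* phi : g~ -> p~ defines an element of f (x) (W / N): modulo N, it is linear
   and vanishes on p~, hence is a linear map on g~/p~ = g/q, it vanishes on
   f = p/q, and it has values in W *)
Definition f_tensor (R : realType) (n : nat) (N W : set 'M[R]_(n.+1 + n.+1))
    (phi : 'M[R]_(n.+1 + n.+1) -> 'M[R]_(n.+1 + n.+1)) : Prop :=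
  [/\ forall (a : R) A B, A \in so_h R n -> B \in so_h R n ->
        N (phi (a *: A + B) - (a *: phi A + phi B)),
      forall A, liePt R n A -> N (phi A),
      forall A, lieP R n A -> N (phi A) &
      forall A, A \in so_h R n -> W (phi A)].

(* Main.v *)
From HB Require Import structures.
Require Import Defs.
From mathcomp Require Import ring lra.

Set Implicit Arguments.
Unset Strict Implicit.
Unset Printing Implicit Defensive.

(** The curvature of omega~ along GG is determined by the curvature kappa of
    omega, and the codifferential is then a computation with (n+1) x (n+1)
    matrices.

    Reduction.  Since omega~ restricts to omega, naturality of the exterior
    derivative gives kappa~ = kappa on sl(n+1) ([curvature_restrict]).  A
    curvature function vanishes as soon as one argument lies in the Lie algebra
    of the structure group ([curvature_horizontal], [lieP_ind], [liePt_ind]).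
    For n >= 2 one has g~ = g + p~, more precisely g~ is spanned by the n
    matrices E_k0 of g, by p and by p~ ([so_split]).  Hence kappa~(X, A) is the
    combination of the kappa(E_k0, A') with coefficients h(eps^k, X v~), where
    A' in g represents A modulo p~.

    Normality.  Let M_k be the value kappa(E_k0, A'), a matrix of sl(n+1).
    Paired with the dual frame, projective normality implies that every M_k
    maps v_+ to a multiple lam_k v_+ (there is no torsion) and that
    sum_k eps^k M_k = sum_k lam_k eps^k (a Ricci-type trace condition)
    ([normality_entries]).

    Dual frames.  The nilradical of p~ consists of the v~ /\ z with z
    orthogonal to v~ ([nilradical_liePt]), and the Killing form pairs v~ /\ z
    with X to -4n h(z, X v~) ([killing_so_wedge]).  So for every pair of dual
    frames, sum_i h(eps^k, X_i v~) Z_i is proportional to v~ /\ eps^k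
    ([dual_frame_coef]).

    Conclusion.  Up to a constant, the codifferential of A is therefore
    sum_k [M_k, v~ /\ eps^k] = sum_k (M_k v~ /\ eps^k + v~ /\ M_k eps^k).
    By the trace condition the second terms add up to - sum_k lam_k v~ /\ eps^k,
    and M_k v~ - lam_k v~ lies in F by the absence of torsion: its two terms in
    v_+ cancel.  What is left is a sum of elements of Lambda^2 Fbar.  The
    statement modulo the nilradical follows, because elements of Lambda^2 Fbar
    annihilate v~ and act on L^perp / L as elements of Lambda^2 f. *)

(** * Symmetry of second derivatives and naturality of the exterior derivative *)

Section CkCalculus.
Variable R : realType.
Implicit Types U V W : normedModType R.

Lemma Ck_on_sub V W k (A B : set V) (f : V -> W) :
  B `<=` A -> Ck_on k A f -> Ck_on k B f.
Proof.
elim: k f => [|k IH] f BA /=; first by move=> fA x /BA/fA.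
by move=> [df dkf]; split=> [x /BA/df|v]; [|apply: IH].
Qed.

Lemma smooth_on_differentiable V W (A : set V) (f : V -> W) x :
  smooth_on A f -> A x -> differentiable f x.
Proof. by move=> /(_ 1) [df _]; apply: df. Qed.

(** The difference of two functions that agree near a point is of this kind,
    which makes differentiability a local property. *)
Lemma near0_diff V W (k : V -> W) x :
  (\forall y \near x, k y = 0) -> differentiable k x /\ 'd k x = 0 :> (V -> W).
Proof.
move=> k0; have kx : k x = 0 by exact: nbhs_singleton k0.
pose z : {linear V -> W} := \0.
have zc : continuous z by move=> ?; apply: cvg_cst.
have kz : k \o shift x = cst (k x) + z +o_ 0 id.
  apply/eqaddoP => e e0; have k0' : \forall h \near (0 : V), k (h + x) = 0.
    by move: k0; rewrite (near_shift 0 x) subr0.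
  near=> h; rewrite (_ : (_ - _) h = 0) ?normr0; first by rewrite mulr_ge0 // ltW.
  rewrite kx; change (k (h + x) - (0 + 0) = 0).
  by rewrite addr0 subr0; near: h; exact: k0'.
have dk : 'd k x = z :> (V -> W) by apply: diff_unique.
by split=> //; apply/diff_locallyP; rewrite dk.
Unshelve. all: by end_near. Qed.

Lemma near_eq_diff V W (f g : V -> W) x :
  {near x, f =1 g} -> differentiable f x ->
  differentiable g x /\ forall v, 'd g x v = 'd f x v.
Proof.
move=> fg df.
have [dk k0] : differentiable (g - f) x /\ 'd (g - f) x = 0 :> (V -> W).
  apply: near0_diff; near=> y; rewrite !fctE (_ : f y = g y) ?subrr //.
  by near: y.
have E : g = f + (g - f) by rewrite addrC subrK.
rewrite E; split; first exact: differentiableD.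
move=> v; have /(congr1 (@^~ v)) -> := diffD df dk.
have /(congr1 (@^~ v)) kv := k0.
by change ('d f x v + 'd (g - f) x v = 'd f x v); rewrite [X in _ + X]kv addr0.
Unshelve. all: by end_near. Qed.

Lemma diff_compE U V W (f : U -> V) (g : V -> W) x :
  differentiable f x -> differentiable g (f x) ->
  differentiable (fun y => g (f y)) x /\
  forall v, 'd (fun y => g (f y)) x v = 'd g (f x) ('d f x v).
Proof.
move=> df dg; split=> [|v]; first exact: (differentiable_comp df dg).
exact: (congr1 (@^~ v) (diff_comp df dg)).
Qed.

Lemma diff_is_derive V W (f : V -> W) x v :
  differentiable f x -> is_derive x v f ('d f x v).
Proof.
by move=> df; apply: DeriveDef; [exact: diff_derivable|exact: deriveE].
Qed.

Lemma is_derive_line V W (f : V -> W) (p v : V) (a : R) :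
  differentiable f (p + a *: v) ->
  is_derive a (1 : R) (fun t : R => f (p + t *: v)) ('d f (p + a *: v) v).
Proof.
move=> df; pose l := (cst p + ( *:%R^~ v) : R -> V).
have dl : is_diff a l ( *:%R^~ v : R -> V).
  by rewrite -[X in is_diff _ _ X]add0r; apply: is_diffD.
have dfl : differentiable (f \o l) a by apply: differentiable_comp => //.
apply: DeriveDef; first exact: diff_derivable.
rewrite deriveE // (_ : (fun t => _) = f \o l) // diff_comp //=.
by rewrite [X in 'd f _ X](_ : _ = v) // diff_val /= scale1r.
Qed.

End CkCalculus.

Section Schwarz.
Variables (R : realType) (V : normedModType R).

(** Applying the mean value theorem first in the direction v, then in the
    direction w, turns the second difference of f over the parallelogram
    spanned by s v and s w into s^2 times a mixed derivative at a nearby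
    point; continuity of that derivative gives the bound. *)
Lemma second_difference (f : V -> R) (U : set V) x v w :
  open U -> U x -> Ck_on 2 U f -> forall e : R, 0 < e -> exists2 d : R, 0 < d &
  forall s : R, 0 < s < d ->
  `|(f (x + s *: v + s *: w) - f (x + s *: v)) - (f (x + s *: w) - f x)
    - 'd (fun y => 'd f y v) x w * s ^+ 2| <= e * s ^+ 2.
Proof.
move=> oU Ux [df /(_ v) [dg /(_ w) ch]] e e0.
set g := fun y => 'd f y v in dg ch *; set h := fun y => 'd g y w in ch *.
have [r /= r0 rP] : exists2 r : R, 0 < r & forall y, `|y - x| < r ->
    U y /\ `|h y - h x| < e.
  have /nbhs_ballP[r /= r0 rU] : nbhs x (U `&` [set y | `|h y - h x| < e]).
    apply: filterI; first exact: open_nbhs_nbhs.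
    have /cvgrPdist_lt/(_ e e0) := ch x Ux; apply: filterS => y /=.
    by rewrite distrC.
  exists r => // y yx; apply: (rU y).
  by rewrite -ball_normE /= distrC.
have N0 : 0 < `|v| + `|w| + 1 by rewrite ltr_wpDl // addr_ge0.
(* the added 1 makes the radius meaningful for v = w = 0 *)
exists (r / (`|v| + `|w| + 1)); first exact: divr_gt0.
move=> s /andP[s0]; rewrite ltr_pdivlMr // => sr.
have small a b : 0 <= a <= s -> 0 <= b <= s ->
    U (x + a *: v + b *: w) /\ `|h (x + a *: v + b *: w) - h x| < e.
  move=> /andP[a0 as_] /andP[b0 bs]; apply: rP; rewrite addrAC [x + _ - x]addrAC subrr add0r.
  apply: le_lt_trans sr; rewrite (le_trans (ler_normD _ _)) // !normrZ.
  rewrite (ger0_norm a0) (ger0_norm b0) !mulrDr mulr1.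
  by have := ler_wpM2r (normr_ge0 v) as_; have := ler_wpM2r (normr_ge0 w) bs; lra.
pose F (a : R) := f (x + s *: w + a *: v) - f (x + a *: v).
pose F' (a : R) := g (x + a *: v + s *: w) - g (x + a *: v).
have dF a : 0 <= a <= s -> is_derive a 1 F (F' a).
  move=> a0s; apply: is_deriveB.
    rewrite [X in g X]addrAC; apply: is_derive_line; apply: df.
    by rewrite addrAC; apply: (small a s _ _).1; rewrite // lexx ltW.
  apply: is_derive_line; apply: df.
  by rewrite -[X in U X]addr0 -(scale0r w); apply: (small a 0 _ _).1; rewrite // lexx ltW.
have ss : 0 <= s <= s by rewrite lexx ltW.
have [|||c cs FE] := @MVT R F F' 0 s.
- exact: s0.
- by move=> a; rewrite in_itv /= => /andP[a0 as_]; apply: dF; rewrite !ltW.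
- apply: derivable_within_continuous => a; rewrite in_itv /= => a0s.
  by have [] := dF a a0s.
rewrite in_itv /= in cs; have c0s : 0 <= c <= s by case/andP: cs => *; rewrite !ltW.
pose G (b : R) := g (x + c *: v + b *: w).
have dG b : 0 <= b <= s -> is_derive b 1 G (h (x + c *: v + b *: w)).
  by move=> b0s; apply: is_derive_line; apply: dg; apply: (small c b _ _).1.
have [|||b bs GE] := @MVT R G (fun b => h (x + c *: v + b *: w)) 0 s.
- exact: s0.
- by move=> a; rewrite in_itv /= => /andP[a0 as_]; apply: dG; rewrite !ltW.
- apply: derivable_within_continuous => a; rewrite in_itv /= => a0s.
  by have [] := dG a a0s.
rewrite in_itv /= in bs; have b0s : 0 <= b <= s by case/andP: bs => *; rewrite !ltW.
have -> : f (x + s *: v + s *: w) - f (x + s *: v) - (f (x + s *: w) - f x) =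
    h (x + c *: v + b *: w) * s ^+ 2.
  transitivity (F s - F 0); first by rewrite /F scale0r !addr0 [x + s *: v + _]addrAC.
  rewrite FE (_ : F' c = G s - G 0); last by rewrite /F' /G scale0r addr0.
  by rewrite GE !subr0 expr2 mulrA.
rewrite -mulrBl normrM (@ger0_norm _ (s ^+ 2)) ?sqr_ge0 // ler_wpM2r ?sqr_ge0 //.
by rewrite ltW //; apply: (small c b _ _).2.
Qed.

(** The second difference is symmetric in v and w, so it is approximated by
    both mixed derivatives. *)
Lemma schwarz_scalar (f : V -> R) (U : set V) x v w :
  open U -> U x -> Ck_on 2 U f ->
  'd (fun y => 'd f y v) x w = 'd (fun y => 'd f y w) x v.
Proof.
move=> oU Ux f2; apply/eqP; rewrite -subr_eq0 -normr_eq0 eq_le normr_ge0 andbT.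
apply/ler_addgt0Pr => e e0; rewrite add0r.
have e2 : 0 < e / 2 by rewrite divr_gt0.
have [d1 d10 P1] := second_difference v w oU Ux f2 e2.
have [d2 d20 P2] := second_difference w v oU Ux f2 e2.
pose s := Num.min d1 d2 / 2.
have m0 : 0 < Num.min d1 d2 by rewrite lt_min d10.
have s0 : 0 < s by rewrite divr_gt0.
have /P1 {}P1 : 0 < s < d1.
  by rewrite s0 ltr_pdivrMr // (le_lt_trans (_ : _ <= d1)) ?ge_min ?lexx // ltr_pMr // ltr1n.
have /P2 {}P2 : 0 < s < d2.
  by rewrite s0 ltr_pdivrMr // (le_lt_trans (_ : _ <= d2)) ?ge_min ?lexx ?orbT // ltr_pMr // ltr1n.
move: P1 P2; set A := 'd _ _ w; set B := 'd _ _ v => P1 P2.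
have s2 : 0 < s ^+ 2 by rewrite exprn_gt0.
rewrite -(ler_pM2r s2) -[X in _ * X <= _](ger0_norm (ltW s2)) -normrM mulrBl.
set a := _ - _ - (_ - f x) in P1; set b := _ - _ - (_ - f x) in P2.
have ab : a = b by rewrite /a /b [x + s *: w + _]addrAC opprB opprB; ring.
have -> : A * s ^+ 2 - B * s ^+ 2 = (b - B * s ^+ 2) - (a - A * s ^+ 2) by rewrite ab; ring.
apply: (le_trans (ler_normB _ _)).
by rewrite (splitr e) mulrDl lerD.
Qed.

End Schwarz.

Section Naturality.
Variable R : realType.
Implicit Types (V W : normedModType R).

Lemma is_derive_scale V W (f : V -> R) (g : V -> W) (x v : V) df dg :
  is_derive x v f df -> is_derive x v g dg ->
  is_derive x v (fun y => f y *: g y) (f x *: dg + df *: g x).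
Proof.
move=> [df0 <-] [dg0 <-].
suff c : (fun h : R => h^-1 *: (f (h *: v + x) *: g (h *: v + x) - f x *: g x)) @
    0^' --> f x *: 'D_v g x + 'D_v f x *: g x.
  by apply: DeriveDef; [apply/cvg_ex; eexists; exact: c|apply: cvg_lim c].
rewrite (_ : (fun h => _) = (fun h : R =>
    f (h *: v + x) *: (h^-1 *: (g (h *: v + x) - g x)) +
    (h^-1 *: (f (h *: v + x) - f x)) *: g x)); last first.
  apply/funext => h.
  have -> : (h^-1 *: (f (h *: v + x) - f x)) *: g x =
    h^-1 *: ((f (h *: v + x) - f x) *: g x) by rewrite scalerA.
  rewrite scalerA mulrC -scalerA -scalerDr.
  by congr (_ *: _); rewrite scalerBr scalerBl addrA subrK.
apply: cvgD; last exact: cvgZr_tmp df0.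
apply: cvgZ; last exact: dg0.
suff : {for 0, continuous (fun h : R => f (h *: v + x))}.
  by move=> /continuous_withinNx; rewrite scale0r add0r.
exact/differentiable_continuous/derivable1_diffP/(derivable1P _ _ _).1.
Qed.

Lemma linear_rVE W d (L : 'rV[R]_d -> W) :
  (forall (a : R) u v, L (a *: u + v) = a *: L u + L v) ->
  forall u, L u = \sum_i u 0 i *: L (delta_mx 0 i).
Proof.
move=> lL u; pose Ll := HB.pack_for {linear 'rV[R]_d -> W} L
  (GRing.isLinear.Build _ _ _ _ L lL).
rewrite [in LHS](row_sum_delta u) (_ : L = Ll) // linear_sum.
by apply: eq_bigr => i _; rewrite linearZ.
Qed.

Lemma differentiable_entry V d (f : V -> 'rV[R]_d) x i : differentiable f x ->
  differentiable (fun y => f y 0 i) x /\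
  forall v, 'd (fun y => f y 0 i) x v = 'd f x v 0 i.
Proof.
move=> df; have dc := differentiable_coord (f x) 0 i.
pose c (u : 'rV[R]_d) : R := u 0 i.
have lc : linear c by move=> a u v; rewrite /c !mxE.
pose cl := HB.pack_for {linear 'rV[R]_d -> R} c (GRing.isLinear.Build _ _ _ _ c lc).
split; first exact: (differentiable_comp df dc).
move=> v; have /(congr1 (@^~ v)) -> := diff_comp df dc.
rewrite /= (_ : (fun _ => _) = cl) // diff_lin //.
exact: coord_continuous.
Qed.

(** Openness is needed because differentials depend on a neighbourhood. *)
Lemma Ck_on_eq V W k (A : set V) (f g : V -> W) : open A ->
  (forall x, A x -> f x = g x) -> Ck_on k A f -> Ck_on k A g.
Proof.
move=> oA; elim: k f g => [|k IH] f g fg.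
  move=> cf x Ax; rewrite /prop_for /continuous_at -(fg x Ax).
  apply: cvg_trans (cf x Ax); apply: near_eq_cvg.
  by apply: filterS (open_nbhs_nbhs (conj oA Ax)) => y /fg.
have fgx x : A x -> {near x, f =1 g}.
  by move=> Ax; apply: filterS (open_nbhs_nbhs (conj oA Ax)) => y /fg.
move=> [df dk]; split=> [x Ax|v].
  exact: (near_eq_diff (fgx x Ax) (df x Ax)).1.
apply: IH (dk v) => x Ax.
exact: (esym ((near_eq_diff (fgx x Ax) (df x Ax)).2 v)).
Qed.

Lemma Ck_on_entry V d k (A : set V) (f : V -> 'rV[R]_d) i : open A ->
  Ck_on k A f -> Ck_on k A (fun y => f y 0 i).
Proof.
move=> oA; elim: k f => [|k IH] f.
  move=> cf x Ax; have := @continuous_comp _ _ _ f (fun u : 'rV[R]_d => u 0 i) x (cf x Ax).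
  by apply; exact: coord_continuous.
move=> [df dk]; split=> [x Ax|v]; first exact: (differentiable_entry i (df x Ax)).1.
apply: Ck_on_eq oA _ (IH _ (dk v)) => x Ax.
by rewrite (differentiable_entry i (df x Ax)).2.
Qed.

Lemma schwarz V d (f : V -> 'rV[R]_d) (U : set V) x v w :
  open U -> U x -> Ck_on 2 U f ->
  'd (fun y => 'd f y v) x w = 'd (fun y => 'd f y w) x v.
Proof.
move=> oU Ux f2; have [df df1] := f2; apply/rowP => i.
have dfu u : differentiable (fun y => 'd f y u) x by have [+ _] := df1 u; apply.
rewrite -!(differentiable_entry i (dfu _)).2.
have E u : {near x, (fun y => 'd (fun z => f z 0 i) y u) =1 (fun y => 'd f y u 0 i)}.
  apply: filterS (open_nbhs_nbhs (conj oU Ux)) => y Uy.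
  by rewrite (differentiable_entry i (df y Uy)).2.
have D u : differentiable (fun y => 'd (fun z => f z 0 i) y u) x.
  by have [_ /(_ u) [+ _]] := Ck_on_entry i oU f2; apply.
have Ev := (near_eq_diff (E v) (D v)).2 w; have Ew := (near_eq_diff (E w) (D w)).2 v.
have S := schwarz_scalar v w oU Ux (Ck_on_entry i oU f2).
exact: (etrans Ev (etrans S (esym Ew))).
Qed.

Section Pullback.
Variables (k d : nat) (W : normedModType R).
Variable Om : 'rV[R]_d -> 'rV[R]_d -> W.
Hypothesis Om_lin : forall x (a : R) u v, Om x (a *: u + v) = a *: Om x u + Om x v.

(** Product rule for the form Om, linear in its second argument, evaluated
    along phi on the vector field psi. *)
Lemma is_derive_pairing (phi psi : 'rV[R]_k -> 'rV[R]_d) y v :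
  differentiable phi y -> differentiable psi y ->
  (forall u, differentiable (Om^~ u) (phi y)) ->
  is_derive y v (fun z => Om (phi z) (psi z))
    ('D_('d phi y v) (Om^~ (psi y)) (phi y) + Om (phi y) ('d psi y v)).
Proof.
move=> dphi dpsi dOm.
have D0 i : is_derive y v (fun z => psi z 0 i) ('d psi y v 0 i).
  have [d1 <-] := differentiable_entry i dpsi; exact: diff_is_derive.
have D1 i : is_derive y v (fun z => Om (phi z) (delta_mx 0 i))
    ('d (Om^~ (delta_mx 0 i)) (phi y) ('d phi y v)).
  have [dc <-] := diff_compE dphi (dOm (delta_mx 0 i)); exact: diff_is_derive.
have D2 : is_derive (phi y) ('d phi y v) (Om^~ (psi y))
    (\sum_i psi y 0 i *: 'd (Om^~ (delta_mx 0 i)) (phi y) ('d phi y v)).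
  rewrite (_ : Om^~ (psi y) = \sum_i (psi y 0 i *: Om^~ (delta_mx 0 i))).
    apply: is_derive_sum => i; apply: is_deriveZ.
    exact: diff_is_derive.
  apply/funext => x; rewrite fct_sumE; exact: (linear_rVE (Om_lin x)).
rewrite (@derive_val _ _ _ _ _ _ _ D2) (linear_rVE (Om_lin (phi y))) -big_split /=.
rewrite (_ : (fun z => _) = \sum_i (fun z => psi z 0 i *: Om (phi z) (delta_mx 0 i))).
  apply: is_derive_sum => i; exact: is_derive_scale.
by apply/funext => z; rewrite fct_sumE; exact: (linear_rVE (Om_lin (phi z))).
Qed.

(** Pullback commutes with the exterior derivative: in the product rule, the
    terms containing second derivatives of phi cancel by symmetry. *)
Lemma ext_deriv_pullback (phi : 'rV[R]_k -> 'rV[R]_d) (U : set 'rV[R]_k) y v w :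
  open U -> U y -> Ck_on 2 U phi ->
  (forall u, differentiable (Om^~ u) (phi y)) ->
  'D_v (fun z => Om (phi z) ('d phi z w)) y -
  'D_w (fun z => Om (phi z) ('d phi z v)) y =
  'D_('d phi y v) (Om^~ ('d phi y w)) (phi y) -
  'D_('d phi y w) (Om^~ ('d phi y v)) (phi y).
Proof.
move=> oU Uy phi2 dOm; have [dphi dphi1] := phi2.
have dphiu u : differentiable (fun z => 'd phi z u) y by have [+ _] := dphi1 u; apply.
have P a b := is_derive_pairing a (dphi y Uy) (dphiu b) dOm.
rewrite (@derive_val _ _ _ _ _ _ _ (P v w)) (@derive_val _ _ _ _ _ _ _ (P w v)).
have E (a b c e : W) : c = e -> a + c - (b + e) = a - b.
  by move=> ->; rewrite opprD addrACA subrr addr0.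
exact/E/(congr1 (Om (phi y)))/(schwarz w v oU Uy phi2).
Qed.

End Pullback.

End Naturality.

(** * Charts, plots and pulled-back forms *)

Section Charts.
Variable R : realType.

(** The map l is affine with linear part L; having a constant differential, it
    can be carried through the induction on k. *)
Lemma Ck_on_comp_affine (V V' W : normedModType R) (l L : V' -> V) k
    (A : set V) (f : V -> W) : open A ->
  (forall y, differentiable l y) -> (forall y v, 'd l y v = L v) ->
  Ck_on k A f -> Ck_on k (l @^-1` A) (f \o l).
Proof.
move=> oA dl lL; have oB : open (l @^-1` A).
  by apply: open_comp => // y _; apply: differentiable_continuous.
elim: k f => [|k IH] f.
  move=> cf y Ay; apply: continuous_comp; last exact: cf.
  exact: differentiable_continuous.
move=> [df dk]; split=> [y Ay|v].
  by apply: differentiable_comp => //; apply: df.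
apply: Ck_on_eq oB _ (IH _ (dk (L v))) => y Ay.
by have [_ ->] := diff_compE (dl y) (df _ Ay); rewrite /= lL.
Qed.

Section Plots.
Variables (k d : nat) (N : manifold R d).
Variables (U : set 'rV[R]_k) (s : 'rV[R]_k -> N).
Hypotheses (oU : open U) (sU : smooth_plot U s).

Lemma plot_near y (A : set N) : open A -> U y -> A (s y) -> \forall z \near y, A (s z).
Proof.
move=> oA Uy Ay; have [cs _] := sU.
by apply: (cs y Uy A); apply: open_nbhs_nbhs.
Qed.

Lemma plot_dom_open p : open (U `&` s @^-1` dom N p).
Proof.
rewrite openE => y [Uy py]; apply: filterI; first exact: open_nbhs_nbhs.
exact: plot_near (@dom_open _ _ N p) Uy py.
Qed.

Lemma plot_differentiable p y : U y -> dom N p (s y) ->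
  differentiable (chart N p \o s) y.
Proof. by move=> Uy py; apply: (smooth_on_differentiable (sU.2 p)). Qed.

End Plots.

Lemma unchart_plot d (N : manifold R d) p :
  smooth_plot (chart N p @` dom N p) (unchart N p).
Proof.
split=> [y|q]; first exact: unchart_continuous.
move=> k; apply: Ck_on_sub (transition_smooth (m := N) p q k).
move=> _ [[z pz <-]] /=; rewrite chartK // => qz.
by exists z.
Qed.

Lemma transition_differentiable d (N : manifold R d) p q z :
  dom N p z -> dom N q z -> differentiable (chart N q \o unchart N p) (chart N p z).
Proof.
by move=> pz qz; apply: (smooth_on_differentiable (transition_smooth (m := N) p q)); exists z.
Qed.

(** The chain rule for F after a plot s, with every differential read in the
    preferred chart at the point where it is taken. *)
Lemma tangent_map_plot d e k (M : manifold R d) (N : manifold R e) (F : M -> N)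
    (U : set 'rV[R]_k) (s : 'rV[R]_k -> M) y v :
  open U -> smooth_plot U s -> U y ->
  differentiable (chart N (F (s y)) \o F \o unchart M (s y)) (chart M (s y) (s y)) ->
  'd (chart N (F (s y)) \o F \o s) y v =
  tangent_map F (s y) ('d (chart M (s y) \o s) y v).
Proof.
move=> oU sU Uy dF; have ds := plot_differentiable sU Uy (@dom_center _ _ M (s y)).
have [dFs E] := diff_compE ds dF; apply: etrans _ (E v).
apply: (near_eq_diff _ dFs).2.
apply: filterS (plot_near sU (@dom_open _ _ M (s y)) Uy (@dom_center _ _ M _)) => z.
by move=> pz /=; rewrite chartK.
Qed.

Section Forms.
Variables (d : nat) (W : normedModType R) (N : manifold R d) (w : N -> 'rV[R]_d -> W).

(** The pullback of w along a plot, written without a choice of a fixed chart: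
    tangent vectors at a point of the manifold are read in the preferred chart
    of that very point. *)
Definition pull_form k (s : 'rV[R]_k -> N) (y v : 'rV[R]_k) : W :=
  w (s y) ('d (chart N (s y) \o s) y v).

(** Compares the chart-free pullback with the expression of w in one fixed
    chart, the one in which [ext_deriv] is computed. *)
Lemma form_in_chart_plot k (U : set 'rV[R]_k) (s : 'rV[R]_k -> N) p y v :
  smooth_plot U s -> U y -> dom N p (s y) ->
  form_in_chart w p (chart N p (s y)) ('d (chart N p \o s) y v) = pull_form s y v.
Proof.
move=> sU Uy py; rewrite /form_in_chart /pull_form /= chartK //; congr (w _ _).
have ds := plot_differentiable sU Uy py.
have dt := transition_differentiable py (@dom_center _ _ N (s y)).
have [dts E] := diff_compE ds dt; apply: etrans (esym (E v)) _.
apply: esym; apply: (near_eq_diff _ dts).2.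
apply: filterS (plot_near sU (@dom_open _ _ N p) Uy py) => z pz /=.
by rewrite chartK.
Qed.

Hypothesis w_smooth : smooth_form w.

Lemma form_in_chart_linear p x (a : R) u v :
  form_in_chart w p x (a *: u + v) = a *: form_in_chart w p x u + form_in_chart w p x v.
Proof. by rewrite /form_in_chart linearP w_smooth.1. Qed.

Lemma form_in_chart_differentiable p z v : dom N p z ->
  differentiable (fun x => form_in_chart w p x v) (chart N p z).
Proof.
by move=> pz; apply: (smooth_on_differentiable (w_smooth.2 p v)); exists z.
Qed.

(** Naturality of the exterior derivative for plots. Surfaces suffice for the
    horizontality of the curvature, and the inverse of a chart gives
    naturality for maps between manifolds. *)
Lemma ext_deriv_plot k (U : set 'rV[R]_k) (s : 'rV[R]_k -> N) y u v :
  open U -> smooth_plot U s -> U y ->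
  'D_u (pull_form s ^~ v) y - 'D_v (pull_form s ^~ u) y =
  ext_deriv w (s y) ('d (chart N (s y) \o s) y u) ('d (chart N (s y) \o s) y v).
Proof.
move=> oU sU Uy; set p := s y; have py : dom N p (s y) by apply: dom_center.
have oA : open (U `&` s @^-1` dom N p) by apply: plot_dom_open.
have Ay : (U `&` s @^-1` dom N p) y by split.
have E a : \forall z \near y, pull_form s z a =
    form_in_chart w p (chart N p (s z)) ('d (chart N p \o s) z a).
  apply: filterS (open_nbhs_nbhs (conj oA Ay)) => z [Uz pz].
  by rewrite (form_in_chart_plot a sU Uz pz).
rewrite (near_eq_derive _ (E v)) (near_eq_derive _ (E u)).
apply: (ext_deriv_pullback (Om := form_in_chart w p) (form_in_chart_linear p)
  u v oA Ay (sU.2 p 2)) => a.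
exact: form_in_chart_differentiable.
Qed.

End Forms.

Lemma ext_deriv_map d e (W : normedModType R) (M : manifold R d) (N : manifold R e)
    (F : M -> N) (w : M -> 'rV[R]_d -> W) (w' : N -> 'rV[R]_e -> W) :
  smooth_map_on setT F -> smooth_form w' ->
  (forall p v, w' (F p) (tangent_map F p v) = w p v) ->
  forall p u v, ext_deriv w' (F p) (tangent_map F p u) (tangent_map F p v) =
    ext_deriv w p u v.
Proof.
move=> sF sw' ww' p u v; set U := chart M p @` dom M p.
have oU : open U by apply: chart_open.
have Uu : U (chart M p p) by exists p => //; apply: dom_center.
have sFp q : smooth_plot (chart M q @` dom M q) (F \o unchart M q).
  by have := sF q; rewrite setTI.
have E a : \forall z \near chart M p p,
    form_in_chart w p z a = pull_form w' (F \o unchart M p) z a.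
  apply: filterS (open_nbhs_nbhs (conj oU Uu)) => z Uz.
  rewrite /pull_form /form_in_chart /= -ww'; congr (w' _ _).
  rewrite -(tangent_map_plot _ oU (unchart_plot p) Uz) //.
  have Uc : (chart M (unchart M p z) @` dom M (unchart M p z))
      (chart M (unchart M p z) (unchart M p z)) by eexists; [exact: dom_center|].
  apply: (plot_differentiable (sFp _) Uc) => /=.
  by rewrite chartK; [exact: dom_center|exact: dom_center].
have := ext_deriv_plot sw' u v oU (sFp p) Uu.
rewrite -(near_eq_derive _ (E v)) -(near_eq_derive _ (E u)) -/(ext_deriv w p u v) => ->.
by rewrite /tangent_map /= chartK //; exact: dom_center.
Qed.

End Charts.

(** * Curves of exponential type *)

Section Curves.
Variable R : realType.

(** A family of curves closed under differentiation which contains the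
    one-parameter groups 1 + t X for X of square zero and those of a
    diagonalisable X with eigenvalues in {-k, 0, k}; no other exponentials are
    needed. *)
Definition expaff (W : normedModType R) (k : R) (a b p m : W) (t : R) : W :=
  a + t *: b + expR (k * t) *: p + expR (- (k * t)) *: m.

Lemma expaff_is_derive (W : normedModType R) (k : R) (a b p m : W) (t : R) :
  is_derive t (1 : R) (expaff k a b p m) (expaff k b 0 (k *: p) (- k *: m) t).
Proof.
have dk : is_derive t (1 : R) (fun s : R => k * s) k.
  by rewrite -[X in is_derive _ _ _ X]mulr1; exact: (is_deriveZ (f := id)).
have dp : is_derive t (1 : R) (fun s : R => expR (k * s)) (expR (k * t) * k).
  exact: is_derive1_comp.
have dm : is_derive t (1 : R) (fun s : R => expR (- (k * s))) (expR (- (k * t)) * - k).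
  by apply: (@is_derive1_comp _ expR (fun s : R => - (k * s))); exact: is_deriveN.
have D1 := is_derive_scale (is_derive_id t 1) (is_derive_cst b t 1).
have D2 := is_derive_scale dp (is_derive_cst p t 1).
have D3 := is_derive_scale dm (is_derive_cst m t 1).
have := is_deriveD (is_deriveD (is_deriveD (is_derive_cst a t 1) D1) D2) D3.
rewrite /expaff !scaler0 !addr0 !add0r scale1r !scalerA => D.
exact: D.
Qed.

(** Induction on the order of differentiability: the derivative stays in the
    family. *)
Lemma expaff_smooth (V W : normedModType R) (l : V -> R) (k : R) (a b p m : W) (U : set V) :
  open U -> (forall y, differentiable l y) -> (forall y v, 'd l y v = l v) ->
  smooth_on U (fun z => expaff k a b p m (l z)).
Proof.
move=> oU dl ll j; elim: j a b p m => [|j IH] a b p m.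
  move=> y _; apply: (continuous_comp (differentiable_continuous (dl y))).
  apply: differentiable_continuous; apply/derivable1_diffP.
  by have [] := expaff_is_derive k a b p m (l y).
have dE t : differentiable (expaff k a b p m) t.
  by apply/derivable1_diffP; have [] := expaff_is_derive k a b p m t.
split=> [y _|v]; first exact: (differentiable_comp (dl y) (dE _)).
apply: Ck_on_eq oU _ (IH (l v *: b) 0 (l v *: (k *: p)) (l v *: (- k *: m))) => y _.
have [_ ->] := diff_compE (dl y) (dE (l y)).
have E1 : 'd (expaff k a b p m) (l y) (1 : R) = expaff k b 0 (k *: p) (- k *: m) (l y).
  by have [_ <-] := expaff_is_derive k a b p m (l y); rewrite deriveE.
have E2 : 'd (expaff k a b p m) (l y) (l v) = l v *: 'd (expaff k a b p m) (l y) (1 : R).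
  by rewrite -linearZ; congr ('d _ _ _); rewrite -[RHS]/(l v * 1) mulr1.
rewrite ll E2 E1.
have sC c (x : W) : c *: (l v *: x) = l v *: (c *: x) by rewrite !scalerA mulrC.
by rewrite /expaff !scalerDr !scaler0 !sC.
Qed.

Lemma is_derive_mx m n (P : R -> 'M[R]_(m, n)) (dP : 'M[R]_(m, n)) t :
  (forall i j, is_derive t (1 : R) (fun s => P s i j) (dP i j)) -> is_derive t (1 : R) P dP.
Proof.
move=> D; have Pt : derivable P t 1 by apply/derivable_mxP => i j; have [] := D i j.
apply: DeriveDef => //; rewrite derive_mx //; apply/matrixP => i j; rewrite mxE.
by have [] := D i j.
Qed.

Lemma is_derive_mx_entry m n (P : R -> 'M[R]_(m, n)) (dP : 'M[R]_(m, n)) t :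
  is_derive t (1 : R) P dP -> forall i j, is_derive t (1 : R) (fun s => P s i j) (dP i j).
Proof.
move=> [Pt <-] i j; rewrite derive_mx // mxE; apply: DeriveDef => //.
by have /derivable_mxP := Pt; apply.
Qed.

Lemma is_derive_mulmx m n p (P : R -> 'M[R]_(m, n)) (Q : R -> 'M[R]_(n, p)) dP dQ t :
  is_derive t (1 : R) P dP -> is_derive t (1 : R) Q dQ ->
  is_derive t (1 : R) (fun s => P s *m Q s) (dP *m Q t + P t *m dQ).
Proof.
move=> DP DQ; apply: is_derive_mx => i j.
rewrite (_ : (fun s => _) = \sum_k (fun s => P s i k * Q s k j)); last first.
  by apply/funext => s; rewrite fct_sumE mxE.
rewrite !mxE -big_split /=; apply: is_derive_sum => k.
have -> : dP i k * Q t k j + P t i k * dQ k j = P t i k *: dQ k j + Q t k j *: dP i k.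
  by rewrite addrC [dP i k * _]mulrC.
exact: (is_deriveM (is_derive_mx_entry DP i k) (is_derive_mx_entry DQ k j)).
Qed.

End Curves.

(** * Horizontality of the curvature *)

Section Horizontal.
Variable R : realType.

Lemma smooth_on_cst (V W : normedModType R) (U : set V) (a : W) :
  open U -> smooth_on U (fun=> a).
Proof.
move=> oU k; elim: k a => [|k IH] a; first by move=> x _; apply: cvg_cst.
split=> [x _|v]; first exact: differentiable_cst.
apply: Ck_on_eq oU _ (IH 0) => x _.
by rewrite (congr1 (@^~ v) (diff_cst a x)).
Qed.

Lemma affine_diff (V W : normedModType R) (l : V -> R) (x : W) b y v :
  differentiable l y ->
  differentiable (fun z => x + l z *: b) y /\
  'd (fun z => x + l z *: b) y v = 'd l y v *: b.
Proof.
move=> dl; have dZ := differentiableZl b dl; have dc := differentiable_cst x y.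
split; first exact: (differentiableD dc dZ).
have E1 : 'd (cst x) y v = 0 := congr1 (@^~ v) (diff_cst x y).
have E2 : 'd (fun z => l z *: b) y v = 'd l y v *: b := congr1 (@^~ v) (diffZl b dl).
apply: etrans (congr1 (@^~ v) (diffD dc dZ)) _.
exact: (etrans (congr2 +%R E1 E2) (add0r _)).
Qed.

(** A directional derivative depends on the values along a line only, whatever
    the function does elsewhere. *)
Lemma derive_along_line (V W : normedModType R) (f : V -> W) x v :
  'D_v f x = 'D_(1 : R) (fun h : R => f (h *: v + x)) 0.
Proof.
rewrite /derive; set g1 := fun h => h^-1 *: _; set g2 := fun h => h^-1 *: _.
suff -> : g1 = g2 by [].
by rewrite funeqE /g1 /g2 => h /=; rewrite addr0 scale0r add0r [_%:A]mulr1.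
Qed.

(** A is the velocity of a smooth curve c in H through 1, which covers a curve
    C in SO(n+1,n+1) with inverse Ci. The vanishing of the curvature in the
    direction A is deduced from such a curve; as the curvature is linear in A,
    curves for a spanning set are enough. *)
Definition generates n (H : set 'M[R]_(spin_dim n)) (A : 'M[R]_(n.+1 + n.+1)) : Prop :=
  exists (k : R) (c0 c1 c2 c3 : 'M[R]_(spin_dim n)) (C Ci : R -> 'M[R]_(n.+1 + n.+1)),
  let c := expaff k c0 c1 c2 c3 in
  [/\ forall t, [/\ H (c t), covers (c t) (C t) & C t *m Ci t = 1%:M],
      c 0 = 1%:M, C 0 = 1%:M, dcovers (derive1 c 0) A &
      is_derive (0 : R) (1 : R) C A /\ is_derive (0 : R) (1 : R) Ci (- A)].

Variables (n d e : nat) (g : {vspace 'M[R]_(n.+1 + n.+1)}) (H : set 'M[R]_(spin_dim n)).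
Variables (E : manifold R e) (M : manifold R d) (pi : E -> M).
Variables (act : E -> 'M[R]_(spin_dim n) -> E).
Variable omega : E -> 'rV[R]_e -> 'M[R]_(n.+1 + n.+1).
Hypothesis cartan : cartan_geometry g H pi act omega.

Definition coframe_inv u C := xget 0 [set v | omega u v = C].

Lemma coframe_invK u C : C \in g -> omega u (coframe_inv u C) = C.
Proof.
case: cartan => _ _ [_ og] _ _ Cg; have [v [ov _]] := og u C Cg.
exact: (@xgetPex _ 0 [set v | omega u v = C] (ex_intro _ v ov)).
Qed.

Lemma coframe_inj u v v' : omega u v = omega u v' -> v = v'.
Proof.
case: cartan => _ _ [og1 og] _ _ vv'; have [w [_ uw]] := og u _ (og1 u v).
by rewrite -(uw v) // -(uw v').
Qed.

Lemma coframe_invE u C v : C \in g -> omega u v = C -> coframe_inv u C = v.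
Proof. by move=> Cg ov; apply: (@coframe_inj u); rewrite coframe_invK. Qed.

(** The surface s(y0, y1) moves the point of the chart at u with coordinates
    x0 + y0 b by c(y1). Along the axis y0 = 0 equivariance makes the
    pulled-back form C^-1 B C on the first coordinate vector, with derivative
    - [A, B]; along the axis y1 = 0 the second coordinate vector is a
    fundamental field, on which the form is the constant A. The difference of
    the two derivatives is the exterior derivative on (A, B). *)
Lemma ext_deriv_horizontal u A B : A \in g -> B \in g -> generates H A ->
  ext_deriv omega u (coframe_inv u A) (coframe_inv u B) = - lie A B.
Proof.
move=> Ag Bg [k [c0 [c1 [c2 [c3 [C [Ci]]]]]]] /=.
set c := expaff k c0 c1 c2 c3 => -[cP c00 C00 cA [CA CiA]].
case: (cartan) => -[_ [act1 _] act_smooth _ _] sw [_ _] equiv fund.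
set b := coframe_inv u B; set x0 := chart E u u; set D := chart E u @` dom E u.
have oD : open D by apply: chart_open.
have Dx0 : D x0 by exists u => //; apply: dom_center.
pose e0 : 'rV[R]_2 := delta_mx 0 0; pose e1 : 'rV[R]_2 := delta_mx 0 1.
have e00 : e0 0 0 = 1 by rewrite mxE.
have e01 : e0 0 1 = 0 by rewrite mxE.
have e10 : e1 0 0 = 0 by rewrite mxE.
have e11 : e1 0 1 = 1 by rewrite mxE.
pose l i (y : 'rV[R]_2) : R := y 0 i.
have dl i y : differentiable (l i) y by apply: differentiable_coord.
have ll i y v : 'd (l i) y v = l i v.
  have [_ ->] := differentiable_entry i (ex_diff (is_diff_def := is_diff_id y)).
  by rewrite (congr1 (@^~ v) (diff_val (is_diff_def := is_diff_id y))).
pose aff (y : 'rV[R]_2) := x0 + l 0 y *: b.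
have daff y : differentiable aff y by exact: (affine_diff x0 b 0 (dl 0 y)).1.
have affE y v : 'd aff y v = l 0 v *: b.
  by have [_ dE] := affine_diff x0 b v (dl 0 y); rewrite -(ll 0 y) -dE.
pose U := aff @^-1` D.
have oU : open U by apply: open_comp => // y _; apply: differentiable_continuous.
pose gam (y : 'rV[R]_2) := unchart E u (aff y).
have sgam : smooth_plot U gam.
  have [cu su] := unchart_plot u; split=> [y Uy|q j].
    apply: (continuous_comp (differentiable_continuous (daff y))); exact: cu.
  apply: Ck_on_sub (Ck_on_comp_affine (plot_dom_open oD (unchart_plot u) (p := q)) daff affE (su q j)).
  by [].
pose s (y : 'rV[R]_2) := act (gam y) (c (l 1 y)).
have ss : smooth_plot U s.
  apply: act_smooth => //; first exact: expaff_smooth.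
  by move=> y _; have [] := cP (l 1 y).
have A1 t : pull_form omega s (t *: e1) e0 = Ci t *m B *m C t.
  set y := t *: e1.
  have y0 : l 0 y = 0 by rewrite /l mxE e10 mulr0.
  have y1 : l 1 y = t by rewrite /l mxE e11 mulr1.
  have affy : aff y = x0 by rewrite /aff y0 scale0r addr0.
  have Uy : U y by rewrite /U /= affy.
  have uxu : unchart E u x0 = u by apply/chartK/dom_center.
  have sy : s y = act u (c t) by rewrite /s /gam affy uxu y1.
  have [Hct cov CCi] := cP t.
  pose F := fun u' => act u' (c t).
  have sF : smooth_plot D (F \o unchart E u).
    apply: (act_smooth _ _ _ (fun=> c t) oD (unchart_plot u)) => //.
    exact: smooth_on_cst.
  have dF : differentiable (chart E (F u) \o (F \o unchart E u)) x0.
    by apply: (plot_differentiable sF) => //=; rewrite uxu; exact: dom_center.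
  have ds : differentiable (chart E (s y) \o s) y.
    by apply: (plot_differentiable ss) => //; exact: dom_center.
  have <- : invmx (C t) = Ci t.
    have [Cu _] := mulmx1_unit CCi.
    by rewrite -[Ci t]mul1mx -(mulVmx Cu) -mulmxA CCi mulmx1.
  rewrite -[in RHS](coframe_invK u Bg) -/b -(equiv u b _ _ Hct cov).
  rewrite /pull_form sy; congr (omega _ _).
  have [_ <-] : is_derive (0 : R) (1 : R)
      (fun h : R => chart E (act u (c t)) (s (y + h *: e0)))
      ('d (chart E (act u (c t)) \o s) y e0).
    have -> : 'd (chart E (act u (c t)) \o s) y e0 =
        'd (chart E (act u (c t)) \o s) (y + (0 : R) *: e0) e0.
      by rewrite scale0r addr0.
    by apply: is_derive_line; rewrite scale0r addr0 -sy.
  have [_ <-] : is_derive (0 : R) (1 : R)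
      (fun h : R => chart E (F u) (F (unchart E u (x0 + h *: b))))
      (tangent_map F u b).
    have -> : tangent_map F u b = 'd (chart E (F u) \o (F \o unchart E u)) (x0 + (0 : R) *: b) b.
      by rewrite scale0r addr0.
    by apply: (is_derive_line (f := chart E (F u) \o (F \o unchart E u))); rewrite scale0r addr0.
  apply: (congr1 (fun f : R -> 'rV[R]_e => 'D_(1 : R) f (0 : R))); apply/funext => h; rewrite /s /gam /aff /F.
  have -> : l 0 (y + h *: e0) = h by rewrite /l !mxE -/e0 ?e10 ?mulr0 ?add0r /= ?mulr1.
  by have -> : l 1 (y + h *: e0) = t by rewrite /l !mxE /= ?mulr0 ?addr0 ?mulr1.
have A2 t : U (t *: e0) -> pull_form omega s (t *: e0) e1 = A.
  set y := t *: e0 => Uy.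
  have y1 : l 1 y = 0 by rewrite /l mxE e01 mulr0.
  have sy : s y = act (gam y) (c 0) by rewrite /s y1.
  have ds : differentiable (chart E (s y) \o s) y.
    by apply: (plot_differentiable ss) => //; exact: dom_center.
  rewrite /pull_form -[RHS](fund (gam y) c A _ _ c00 cA); first last.
  - by move=> h; have [] := cP h.
  - apply: (expaff_smooth (l := id) k c0 c1 c2 c3 openT) => // z v.
    exact: (congr1 (@^~ v) (diff_val (is_diff_def := is_diff_id z))).
  have -> : gam y = s y by rewrite sy c00 act1.
  congr (omega _ _).
  have [_ <-] : is_derive (0 : R) (1 : R)
      (fun h : R => chart E (s y) (s (y + h *: e1)))
      ('d (chart E (s y) \o s) y e1).
    have -> : 'd (chart E (s y) \o s) y e1 =
        'd (chart E (s y) \o s) (y + (0 : R) *: e1) e1.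
      by rewrite scale0r addr0.
    by apply: (is_derive_line (f := chart E (s y) \o s)); rewrite scale0r addr0.
  rewrite /velocity derive1E; have sc : act (s y) (c 0) = s y by rewrite c00 act1.
  rewrite sc; apply: (congr1 (fun f : R -> 'rV[R]_e => 'D_(1 : R) f (0 : R))); apply/funext => h; congr (chart E _ _).
  rewrite sy c00 act1 /s; congr (act _ (c _)).
    rewrite /gam; congr (unchart E u (_ + _ *: _)).
    by rewrite /l !mxE /= mulr0 addr0.
  by rewrite /l !mxE /= mulr0 add0r mulr1.
have U0 : U 0 by rewrite /U /= /aff /l mxE scale0r addr0.
have s0 : s 0 = u.
  rewrite /s /gam /aff /l !mxE scale0r addr0 c00 act1; exact/chartK/dom_center.
have P0 : pull_form omega s 0 e0 = B.
  have Ci1 : Ci 0 = 1%:M by have [_ _] := cP 0; rewrite C00 mul1mx.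
  by have := A1 0; rewrite scale0r Ci1 C00 mul1mx mulmx1.
have P1 : pull_form omega s 0 e1 = A by have := A2 0; rewrite scale0r; apply.
have := ext_deriv_plot sw e1 e0 oU ss U0; rewrite s0.
have -> : 'd (chart E u \o s) 0 e0 = b.
  by apply: esym; apply: coframe_invE Bg _; rewrite -P0 /pull_form s0.
have -> : 'd (chart E u \o s) 0 e1 = coframe_inv u A.
  by apply: esym; apply: coframe_invE Ag _; rewrite -P1 /pull_form s0.
move=> <-; have -> : 'D_e0 ((pull_form omega s)^~ e1) 0 = 0.
  rewrite derive_along_line.
  have cont : {for (0 : R), continuous (fun h : R => h *: e0 : 'rV[R]_2)}.
    exact: scalel_continuous.
  have U0' : nbhs ((0 : R) *: e0) U by rewrite scale0r; exact: open_nbhs_nbhs.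
  rewrite -(derive_cst A (0 : R) (1 : R)); apply: near_eq_derive.
  have N : \forall h \near (0 : R), U (h *: e0) by exact: (cont U U0').
  by apply: filterS N => h Uh; rewrite addr0 A2.
rewrite subr0 derive_along_line.
have -> : (fun h : R => pull_form omega s (h *: e1 + 0) e0) = (fun h => Ci h *m B *m C h).
  by apply/funext => h; rewrite addr0 A1.
have [_ ->] := is_derive_mulmx (is_derive_mulmx CiA (is_derive_cst B (0 : R) (1 : R))) CA.
have Ci1 : Ci 0 = 1%:M by have [_ _] := cP 0; rewrite C00 mul1mx.
by rewrite C00 Ci1 !mulmx1 ?mul1mx addr0 /lie opprB mulNmx addrC.
Qed.

Lemma curvature_horizontal u A B : A \in g -> B \in g -> generates H A ->
  curvature omega u A B = 0.
Proof.
by move=> Ag Bg HA; rewrite /curvature ext_deriv_horizontal // addrC subrr.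
Qed.

End Horizontal.

(** * Algebra of the curvature function *)

Section CurvatureAlgebra.
Variables (R : realType) (n d e : nat) (g : {vspace 'M[R]_(n.+1 + n.+1)}).
Variable H : set 'M[R]_(spin_dim n).
Variables (E : manifold R e) (M : manifold R d) (pi : E -> M).
Variables (act : E -> 'M[R]_(spin_dim n) -> E).
Variable omega : E -> 'rV[R]_e -> 'M[R]_(n.+1 + n.+1).
Hypothesis cartan : cartan_geometry g H pi act omega.

Lemma ext_deriv_skew (W : normedModType R) (w : E -> 'rV[R]_e -> W) u v v' :
  ext_deriv w u v v' = - ext_deriv w u v' v.
Proof. by rewrite /ext_deriv opprB. Qed.

Lemma curvature_skew u A B : curvature omega u A B = - curvature omega u B A.
Proof.
rewrite /curvature /= ext_deriv_skew [RHS]opprD; congr (_ + _).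
by rewrite /lie opprB.
Qed.

Lemma ext_deriv_linear u v (a : R) v1 v2 :
  ext_deriv omega u v (a *: v1 + v2) =
  a *: ext_deriv omega u v v1 + ext_deriv omega u v v2.
Proof.
have [_ sw _ _ _] := cartan; have du := @dom_center _ _ E u.
have dw b := form_in_chart_differentiable sw b du.
rewrite /ext_deriv ![in 'D_(a *: v1 + v2) _ _](deriveE _ (dw v)) linearP /=.
rewrite -!(deriveE _ (dw v)).
have -> : (fun x => form_in_chart omega u x (a *: v1 + v2)) =
    a *: (fun x => form_in_chart omega u x v1) + (fun x => form_in_chart omega u x v2).
  by apply/funext => x; rewrite (form_in_chart_linear sw).
have D b : is_derive (chart E u u) v (fun x => form_in_chart omega u x b)
    ('D_v (fun x => form_in_chart omega u x b) (chart E u u)).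
  exact/derivableP/diff_derivable.
have [_ ->] := is_deriveD (is_deriveZ a (D v1)) (D v2).
have aux (p q r s : 'M[R]_(n.+1 + n.+1)) :
    (a *: p + q) - (a *: r + s) = a *: (p - r) + (q - s).
  by rewrite scalerBr opprD addrACA.
exact: aux.
Qed.

Lemma curvature_linear u A (a : R) B C : A \in g -> B \in g -> C \in g ->
  curvature omega u A (a *: B + C) = a *: curvature omega u A B + curvature omega u A C.
Proof.
move=> Ag Bg Cg; have [_ sw _ _ _] := cartan.
rewrite /curvature /= -![xget _ _]/(coframe_inv omega u _).
have -> : coframe_inv omega u (a *: B + C) =
    a *: coframe_inv omega u B + coframe_inv omega u C.
  apply: (coframe_invE cartan); first by rewrite memvD ?memvZ.
  by rewrite sw.1 !(coframe_invK cartan).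
have -> : lie A (a *: B + C) = a *: lie A B + lie A C.
  by rewrite /lie mulmxDr mulmxDl -scalemxAr -scalemxAl scalerBr opprD addrACA.
have aux (p q r s : 'M[R]_(n.+1 + n.+1)) :
    (a *: p + q) + (a *: r + s) = a *: (p + r) + (q + s).
  by rewrite scalerDr addrACA.
by rewrite ext_deriv_linear; exact: aux.
Qed.

Lemma curvature_linear_l u A (a : R) B C : A \in g -> B \in g -> C \in g ->
  curvature omega u (a *: B + C) A = a *: curvature omega u B A + curvature omega u C A.
Proof.
move=> Ag Bg Cg; rewrite curvature_skew curvature_linear //.
by rewrite opprD -scalerN -!curvature_skew.
Qed.

(** A subspace is the kernel of a linear map, which commutes with derivatives.
    *)
Lemma derive_in_vspace (V : normedModType R) (P : V -> 'M[R]_(n.+1 + n.+1)) x v :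
  derivable P x v -> (forall y, P y \in g) -> 'D_v P x \in g.
Proof.
move=> dP Pg; rewrite derive_along_line.
pose Q (h : R) := P (h *: v + x).
have dQ := derivableP ((derivable1P P x v).1 dP); rewrite -/Q in dQ.
pose f : 'End('M[R]_(n.+1 + n.+1)) := (\1 - projv g)%VF.
have fE X : (f X == 0) = (X \in g).
  rewrite !lfunE /= !lfunE /= subr_eq0; apply/eqP/idP => [->|]; first exact: memv_proj.
  by move/projv_id ->.
have fS X : f X = \sum_i \sum_k X i k *: f (delta_mx i k).
  rewrite [X in LHS]matrix_sum_delta linear_sum; apply: eq_bigr => i _.
  by rewrite linear_sum; apply: eq_bigr => k _; rewrite linearZ.
have D : is_derive (0 : R) (1 : R) (fun h => f (Q h)) (f ('D_(1 : R) Q 0)).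
  rewrite fS (_ : (fun h => _) =
    \sum_i \sum_k (fun h => Q h i k *: f (delta_mx i k))); last first.
    apply/funext => h; rewrite fct_sumE fS; apply: eq_bigr => i _.
    by rewrite fct_sumE.
  apply: is_derive_sum => i; apply: is_derive_sum => k.
  have := is_derive_scale (is_derive_mx_entry dQ i k)
    (is_derive_cst (f (delta_mx i k)) (0 : R) (1 : R)).
  by rewrite scaler0 add0r.
rewrite -fE; have [_ <-] := D.
rewrite (_ : (fun h => _) = cst 0); first by rewrite derive_cst.
by apply/funext => h; apply/eqP; rewrite fE; exact: Pg.
Qed.

Lemma curvature_in u A B : A \in g -> B \in g ->
  (forall X Y, X \in g -> Y \in g -> lie X Y \in g) -> curvature omega u A B \in g.
Proof.
move=> Ag Bg gg; have [_ sw [og _] _ _] := cartan.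
have dw b := form_in_chart_differentiable sw b (@dom_center _ _ E u).
have Din v b : 'D_v (fun x => form_in_chart omega u x b) (chart E u u) \in g.
  by apply: derive_in_vspace; [exact: diff_derivable|move=> x; exact: og].
by rewrite memvD ?gg // memvB.
Qed.

End CurvatureAlgebra.

Lemma curvatureE (R : realType) (n e : nat) (E : manifold R e)
    (omega : E -> 'rV[R]_e -> 'M[R]_(n.+1 + n.+1)) u A B :
  curvature omega u A B =
  ext_deriv omega u (coframe_inv omega u A) (coframe_inv omega u B) + lie A B.
Proof. by []. Qed.

(** The map j carries the frame of omega to the frame of omega', so this is
    naturality of the exterior derivative along j. *)
Lemma curvature_restrict (R : realType) (n d e d' e' : nat)
    (g g' : {vspace 'M[R]_(n.+1 + n.+1)}) (H H' : set 'M[R]_(spin_dim n))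
    (E : manifold R e) (M : manifold R d) (pi : E -> M) act omega
    (E' : manifold R e') (M' : manifold R d') (pi' : E' -> M') act' omega'
    (j : E -> E') :
  cartan_geometry g H pi act omega -> cartan_geometry g' H' pi' act' omega' ->
  smooth_map_on setT j ->
  (forall u v, omega' (j u) (tangent_map j u v) = omega u v) ->
  (g <= g')%VS -> forall u A B, A \in g -> B \in g ->
  curvature omega' (j u) A B = curvature omega u A B.
Proof.
move=> cg cg' sj jw gg' u A B Ag Bg; have [_ sw' _ _ _] := cg'.
have inv C : C \in g ->
    coframe_inv omega' (j u) C = tangent_map j u (coframe_inv omega u C).
  move=> Cg; apply: (coframe_invE cg'); first exact: (subvP gg').
  by rewrite jw (coframe_invK cg).
rewrite (curvatureE omega') (curvatureE omega) (inv A Ag) (inv B Bg).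
by rewrite (ext_deriv_map sj sw' jw).
Qed.

(** * The Clifford algebra *)

Section Clifford.
Variables (R : realType) (n : nat).
Implicit Types (v w x y : 'cV[R]_(n.+1 + n.+1)) (T S : {set 'I_n.+1}).

(** Every generator of the Clifford algebra sends the basis vector e_T to a
    multiple of e_(T symmetric difference {i}): exterior multiplication adds
    the index i, contraction removes it. *)
Definition flip (i : 'I_n.+1) T := if i \in T then T :\ i else i |: T.
Definition clifford_sign (i : 'I_n.+1) T : R := (-1) ^+ #|[set k in T | (k < i)%N]|.
Definition clifford_coef v (i : 'I_n.+1) T : R := if i \in T then 2 * dsubmx v i 0 else usubmx v i 0.

Lemma in_flip i j T : (j \in flip i T) = (j == i) (+) (j \in T).
Proof.
rewrite /flip; case: ifP => iT; rewrite !inE; case: eqP => [->|] //=; by rewrite iT.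
Qed.

Lemma flipK i T : flip i (flip i T) = T.
Proof. by apply/setP => j; rewrite !in_flip addbA addbb. Qed.

Lemma flipC i j T : flip i (flip j T) = flip j (flip i T).
Proof. by apply/setP => k; rewrite !in_flip addbCA. Qed.

Definition spin_basis T : 'cV[R]_(spin_dim n) := delta_mx (enum_rank T) 0.

Lemma cliffordE v T : clifford v *m spin_basis T = \sum_i (clifford_sign i T * clifford_coef v i T) *: spin_basis (flip i T).
Proof.
apply/colP => r; rewrite /spin_basis -colE !mxE summxE enum_rankK.
apply: eq_bigr => i _; rewrite !mxE /clifford_sign -mulrA; congr (_ * _).
have -> : (r == enum_rank (flip i T)) = (enum_val r == flip i T).
  by rewrite -(inj_eq enum_val_inj) enum_rankK.
rewrite eqxx andbT /clifford_coef /flip; case: ifP => iT /=.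
  by rewrite mulr0n add0r !mxE mulr_natr.
by rewrite mulr0n addr0 !mxE mulr_natr.
Qed.

Lemma clifford_sign_flip i j T : i != j ->
  clifford_sign i (flip j T) = (if (j < i)%N then -1 else 1) * clifford_sign i T.
Proof.
move=> ij; rewrite /clifford_sign.
pose A := [set k in T | (k < i)%N].
have [ji|ji] := boolP (j < i)%N; last first.
  rewrite mul1r; congr (_ ^+ #|pred_of_set _|); apply/setP => k; rewrite !inE in_flip.
  by case: eqP => [->|] //=; rewrite (negbTE ji) !andbF.
have [jT|jT] := boolP (j \in T).
  have -> : [set k in T | (k < i)%N] = j |: [set k in flip j T | (k < i)%N].
    apply/setP => k; rewrite !inE in_flip; case: eqP => [->|] //=; by rewrite jT ji.
  rewrite cardsU1 !inE in_flip eqxx jT ji /= exprS.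
  by rewrite !mulN1r opprK.
have -> : [set k in flip j T | (k < i)%N] = j |: [set k in T | (k < i)%N].
  by apply/setP => k; rewrite !inE in_flip; case: eqP => [->|] //=; rewrite (negbTE jT) ji.
by rewrite cardsU1 !inE (negbTE jT) /= exprS.
Qed.

Lemma clifford_coef_flip v i j T : i != j -> clifford_coef v i (flip j T) = clifford_coef v i T.
Proof. by move=> ij; rewrite /clifford_coef in_flip (negbTE ij). Qed.

Lemma hformE v w : hform v w = \sum_i (usubmx v i 0 * dsubmx w i 0 + dsubmx v i 0 * usubmx w i 0).
Proof.
rewrite /hform -{1}(vsubmxK v) -{1}(vsubmxK w) tr_col_mx /hmx.
rewrite mul_row_block !mulmx0 !mulmx1 add0r addr0 mul_row_col mxE addrC big_split /= !mxE.
by congr (_ + _); apply: eq_bigr => i _; rewrite !mxE.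
Qed.

(** Expanding the square over pairs (i, j) of flipped indices, the terms (i,
    j) and (j, i) with i <> j cancel by the sign rule, and the diagonal terms
    give h(v, v). *)
Lemma clifford_sqr v : clifford v *m clifford v = (hform v v)%:M.
Proof.
have ext (A B : 'M[R]_(spin_dim n)) : (forall T, A *m spin_basis T = B *m spin_basis T) -> A = B.
  move=> AB; apply/matrixP => r c; have /colP/(_ r) := AB (enum_val c).
  by rewrite /spin_basis enum_valK -!colE !mxE.
apply: ext => T; rewrite -mulmxA cliffordE mulmx_sumr mul_scalar_mx.
pose F i j := (clifford_sign i T * clifford_coef v i T * (clifford_sign j (flip i T) * clifford_coef v j (flip i T)))
   *: spin_basis (flip j (flip i T)).
transitivity (\sum_i \sum_j F i j).
  apply: eq_bigr => i _; rewrite -scalemxAr cliffordE scaler_sumr.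
  by apply: eq_bigr => j _; rewrite scalerA.
have FF i j : i != j -> F i j = - F j i.
  move=> ij; rewrite /F flipC -scaleNr; congr (_ *: _).
  have ji : j != i by rewrite eq_sym.
  rewrite (clifford_sign_flip _ ij) (clifford_sign_flip _ ji) (clifford_coef_flip _ _ ij) (clifford_coef_flip _ _ ji).
  have : (i < j)%N (+) (j < i)%N by case: ltngtP ij => // /val_inj ->; rewrite eqxx.
  by case: (i < j)%N; case: (j < i)%N => //= _; ring.
(* symmetrise over (i, j) to cancel the off-diagonal terms *)
have S2 : (\sum_i \sum_j F i j) *+ 2 = (\sum_i F i i) *+ 2.
  rewrite mulr2n {2}exchange_big /= -big_split -sumrMnl /=; apply: eq_bigr => i _.
  rewrite -big_split (bigD1 i) //= big1 ?addr0 ?mulr2n // => j ji.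
  by rewrite (FF _ _ ji) subrr.
have {S2} -> : \sum_i \sum_j F i j = \sum_i F i i.
  apply: (scalerI (a := (2 : R))); first by rewrite pnatr_eq0.
  by rewrite !scaler_nat.
rewrite hformE scaler_suml; apply: eq_bigr => i _; rewrite /F flipK; congr (_ *: _).
have -> : clifford_sign i (flip i T) = clifford_sign i T.
  rewrite /clifford_sign; congr (_ ^+ #|pred_of_set _|); apply/setP => k; rewrite !inE in_flip.
  by case: eqP => [->|] //=; rewrite ltnn !andbF.
have k2 : clifford_sign i T * clifford_sign i T = 1 by rewrite /clifford_sign -expr2 sqrr_sign.
rewrite mulrACA k2 mul1r /clifford_coef in_flip eqxx /=; case: (i \in T) => /=; ring.
Qed.

Lemma clifford_linear (a : R) v w : clifford (a *: v + w) = a *: clifford v + clifford w.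
Proof.
have aux (s x x' y y' : R) (p q : bool) :
    s * ((a * x + x') *+ p + 2 * (a * y + y') *+ q) =
    a * (s * (x *+ p + 2 * y *+ q)) + s * (x' *+ p + 2 * y' *+ q).
  by rewrite !mulrb; case: p; case: q; ring.
apply/matrixP => r c; rewrite !mxE mulr_sumr -big_split /=; apply: eq_bigr => i _.
rewrite !mxE; exact: aux.
Qed.

Lemma cliffordD v w : clifford (v + w) = clifford v + clifford w.
Proof. by rewrite -[v in LHS]scale1r clifford_linear scale1r. Qed.

Lemma clifford0 : clifford (0 : 'cV[R]_(n.+1 + n.+1)) = 0.
Proof. by apply: (addrI (clifford 0)); rewrite -cliffordD !addr0. Qed.

Lemma cliffordZ (a : R) v : clifford (a *: v) = a *: clifford v.
Proof. by rewrite -[a *: v]addr0 clifford_linear clifford0 addr0. Qed.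

Lemma cliffordB v w : clifford (v - w) = clifford v - clifford w.
Proof. by rewrite -scaleN1r cliffordD cliffordZ scaleN1r. Qed.

Lemma hformC v w : hform v w = hform w v.
Proof. by rewrite !hformE; apply: eq_bigr => i _; ring. Qed.

Lemma hform0 v : hform v 0 = 0.
Proof. by rewrite /hform mulmx0 mxE. Qed.

Lemma hformD v w x : hform v (w + x) = hform v w + hform v x.
Proof. by rewrite /hform mulmxDr mxE. Qed.

Lemma hformZ (a : R) v w : hform v (a *: w) = a * hform v w.
Proof. by rewrite /hform -scalemxAr mxE. Qed.

Lemma hformN v w : hform v (- w) = - hform v w.
Proof. by rewrite /hform mulmxN mxE. Qed.

Lemma hformDl v w x : hform (w + x) v = hform w v + hform x v.
Proof. by rewrite hformC hformD !(hformC v). Qed.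

Lemma hformZl (a : R) v w : hform (a *: w) v = a * hform w v.
Proof. by rewrite hformC hformZ (hformC v). Qed.

Lemma hformNl v w : hform (- w) v = - hform w v.
Proof. by rewrite hformC hformN (hformC v). Qed.

Lemma hformBl v w x : hform (w - x) v = hform w v - hform x v.
Proof. by rewrite hformDl hformNl. Qed.

Lemma hformB v w x : hform v (w - x) = hform v w - hform v x.
Proof. by rewrite hformD hformN. Qed.

Lemma hform_nondeg v : (forall w, hform v w = 0) -> v = 0.
Proof.
move=> v0; rewrite -(vsubmxK v); have E i : hform v (col_mx (delta_mx i 0) 0) = dsubmx v i 0.
  rewrite hformE (bigD1 i) //= big1 ?addr0 => [|j ji];
    rewrite !(col_mxKu, col_mxKd) !mxE ?eqxx ?mulr1 ?mulr0 ?add0r //.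
  by rewrite (negbTE ji) mulr0.
have F i : hform v (col_mx 0 (delta_mx i 0)) = usubmx v i 0.
  rewrite hformE (bigD1 i) //= big1 ?addr0 => [|j ji];
    rewrite !(col_mxKu, col_mxKd) !mxE ?eqxx ?mulr1 ?mulr0 ?addr0 //.
  by rewrite (negbTE ji) mulr0.
by rewrite -[RHS]vsubmxK; congr col_mx; apply/colP => i; [rewrite -F|rewrite -E];
  rewrite v0 !mxE.
Qed.

(** Polarisation of [clifford_sqr]. *)
Lemma clifford_anticomm v w :
  clifford v *m clifford w = (2 * hform v w)%:M - clifford w *m clifford v.
Proof.
have := clifford_sqr (v + w); rewrite cliffordD mulmxDl !mulmxDr !clifford_sqr.
rewrite hformDl !hformD (hformC w v) => E.
apply/eqP; rewrite -subr_eq0 opprB addrA subr_eq0; apply/eqP.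
apply: (addrI (hform v v)%:M); apply: (addIr (hform w w)%:M).
rewrite addrA -[_ + _ + _ + (hform w w)%:M]addrA E -!raddfD /=; congr (_%:M); ring.
Qed.

Lemma clifford_perp v w : hform v w = 0 ->
  clifford v *m clifford w = - (clifford w *m clifford v).
Proof. by move=> vw; rewrite clifford_anticomm vw mulr0 raddf0 add0r. Qed.

Lemma clifford_null v : hform v v = 0 -> clifford v *m clifford v = 0.
Proof. by move=> vv; rewrite clifford_sqr vv raddf0. Qed.

Lemma wedgeE v w x : wedge v w *m x = hform v x *: w - hform w x *: v.
Proof.
have aux (a b : 'cV[R]_(n.+1 + n.+1)) : a *m b^T *m hmx R n *m x = hform b x *: a.
  rewrite -[a *m _ *m _]mulmxA -[a *m _ *m _]mulmxA [b^T *m _ *m _]mx11_scalar.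
  by rewrite mul_mx_scalar.
by rewrite /wedge mulmxBl !aux.
Qed.

Lemma mulmx_cV_ext m p (A B : 'M[R]_(m, p)) : (forall x : 'cV[R]_p, A *m x = B *m x) -> A = B.
Proof.
move=> AB; apply/matrixP => i j; have /colP/(_ i) := AB (delta_mx j 0).
by rewrite -!colE !mxE.
Qed.

Lemma so_hform (A : 'M[R]_(n.+1 + n.+1)) :
  A \in so_h R n <-> forall v w, hform (A *m v) w = - hform v (A *m w).
Proof.
rewrite so_hP; have E v w : (v^T *m (A^T *m hmx R n + hmx R n *m A) *m w) 0 0 =
    hform (A *m v) w + hform v (A *m w).
  by rewrite /hform trmx_mul mulmxDr mulmxDl mxE !mulmxA.
split=> [h0 v w|h]; first by apply/eqP; rewrite -addr_eq0 -E h0 mulmx0 mul0mx mxE.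
apply: mulmx_cV_ext => w; apply: trmx_inj; apply: mulmx_cV_ext => v.
rewrite mul0mx trmx0 mul0mx; apply: trmx_inj; rewrite trmx_mul trmxK trmx0 mulmxA.
by rewrite [LHS]mx11_scalar E h addNr raddf0.
Qed.

Lemma wedge_so v w : wedge v w \in so_h R n.
Proof.
apply/so_hform => x y; rewrite !wedgeE hformBl hformB !hformZl !hformZ.
by rewrite (hformC x v) (hformC x w); ring.
Qed.

Lemma lie_wedge A v w : A \in so_h R n ->
  lie A (wedge v w) = wedge (A *m v) w + wedge v (A *m w).
Proof.
move=> /so_hform sA; apply: mulmx_cV_ext => x.
have E1 : lie A (wedge v w) *m x = A *m (wedge v w *m x) - wedge v w *m (A *m x).
  by rewrite /lie mulmxBl -[A *m _ *m x]mulmxA -[wedge v w *m _ *m x]mulmxA.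
have E2 : (wedge (A *m v) w + wedge v (A *m w)) *m x =
    wedge (A *m v) w *m x + wedge v (A *m w) *m x by rewrite mulmxDl.
rewrite E1 E2 !wedgeE mulmxBr -!scalemxAr !sA !scaleNr.
set a := hform v x *: _; set b := hform w x *: _.
set c := hform v _ *: w; set d := hform w _ *: v.
by apply/colP => i; rewrite !mxE; ring.
Qed.

End Clifford.

(** * Shears and boosts in the spin group *)

Section Generators.
Variables (R : realType) (n : nat).
Local Notation V := 'cV[R]_(n.+1 + n.+1).
Local Notation cl := (@clifford R n).
Implicit Types (x y v : V).

Lemma SpinM g h : Spin R n g -> Spin R n h -> Spin R n (g *m h).
Proof.
move=> [s [os us ->]] [t [ot ut ->]]; exists (s ++ t); split.
- by rewrite size_cat oddD (negbTE os) (negbTE ot).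
- by move=> v; rewrite mem_cat => /orP[/us|/ut].
- by rewrite foldr_cat; elim: s {os us} => [|v s IH] /=; rewrite ?mul1mx // -IH mulmxA.
Qed.

Lemma Spin_pair v w : hform v v = 1 \/ hform v v = -1 ->
  hform w w = 1 \/ hform w w = -1 -> Spin R n (cl v *m cl w).
Proof.
move=> hv hw; exists [:: v; w]; split=> //=; last by rewrite mulmx1.
by move=> u; rewrite !inE => /orP[/eqP ->|/eqP ->].
Qed.

Lemma coversM g h (A B : 'M[R]_(n.+1 + n.+1)) : covers g A -> covers h B -> covers (g *m h) (A *m B).
Proof. by move=> gA hB v; rewrite -mulmxA hB mulmxA gA -!mulmxA. Qed.

Lemma dcoversB X Y (A B : 'M[R]_(n.+1 + n.+1)) : dcovers X A -> dcovers Y B -> dcovers (X - Y) (A - B).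
Proof.
move=> XA YB v; rewrite mulmxBl mulmxBr [(A - B) *m v]mulmxBl cliffordB -XA -YB.
have aux (a b c d : 'M[R]_(spin_dim n)) : (a - b) - (c - d) = (a - c) - (b - d).
  by rewrite !opprD !opprK addrACA.
exact: aux.
Qed.

(** The Lie algebra of the spin group is spanned by products of two vectors,
    and x y acts on vectors as twice the infinitesimal rotation y /\ x. *)
Lemma dcovers_pair x y : dcovers (cl x *m cl y) (2 *: wedge y x).
Proof.
move=> v; rewrite -scalemxAl wedgeE cliffordZ cliffordB !cliffordZ.
have -> : cl x *m cl y *m cl v = (2 * hform y v) *: cl x - cl x *m cl v *m cl y.
  by rewrite -mulmxA clifford_anticomm mulmxBr mul_mx_scalar mulmxA.
have -> : cl v *m (cl x *m cl y) = (2 * hform x v) *: cl y - cl x *m cl v *m cl y.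
  by rewrite mulmxA (clifford_anticomm v x) (hformC v x) mulmxBl mul_scalar_mx.
by rewrite opprB addrA subrK scalerBr !scalerA.
Qed.

Lemma dcovers1 (X : 'M[R]_(spin_dim n)) (A : 'M[R]_(n.+1 + n.+1)) :
  dcovers X A -> dcovers (X - 1%:M) A.
Proof. by move=> XA v; rewrite mulmxBl mulmxBr mul1mx mulmx1 opprB addrA subrK XA. Qed.

(** The rank one endomorphism v |-> h(y, v) x. *)
Definition outer (x y : V) : 'M[R]_(n.+1 + n.+1) := x *m y^T *m hmx R n.

Lemma outerE x y v : outer x y *m v = hform y v *: x.
Proof.
rewrite /outer -[x *m _ *m _]mulmxA -[x *m _ *m _]mulmxA [y^T *m _ *m _]mx11_scalar.
by rewrite mul_mx_scalar.
Qed.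

(** (v + e t x) (e v) is a product of two vectors of square e, because x is
    null and orthogonal to v. *)
Lemma Spin_shear_unit x v (e t : R) : e * e = 1 -> hform x x = 0 -> hform x v = 0 ->
  hform v v = e -> Spin R n (1%:M + t *: (cl x *m cl v)).
Proof.
move=> e2 xx xv vv; have -> : 1%:M + t *: (cl x *m cl v) = cl (v + (e * t) *: x) *m cl (e *: v).
  rewrite cliffordD !cliffordZ mulmxDl -!scalemxAl -!scalemxAr clifford_sqr vv.
  by rewrite !scalerA mulrAC e2 mul1r scale_scalar_mx e2.
have eP : e = 1 \/ e = -1.
  have /eqP : (e - 1) * (e + 1) = 0 by rewrite -subr_sqr expr1n expr2 e2 subrr.
  by rewrite mulf_eq0 subr_eq0 addr_eq0 => /orP[/eqP|/eqP]; [left|right].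
apply: Spin_pair.
  rewrite hformDl !hformD !hformZl !hformZ xx vv (hformC v) xv.
  by rewrite !mulr0 !addr0.
by rewrite hformZl hformZ vv e2 mulr1.
Qed.

Section Null.
Variables (x y z : V).
Hypotheses (xx : hform x x = 0) (yy : hform y y = 0) (xy : hform x y = 0).
Hypotheses (zz : hform z z = 0) (zy : hform z y = 1) (zx : hform z x = 0).

(** The vector z, dual to y, allows one to split the null vector y as (y/2 +
    z) + (y/2 - z), a sum of vectors of squares 1 and -1 that are orthogonal
    to x; the two corresponding factors multiply to 1 + t x y. *)
Lemma Spin_shear t : Spin R n (1%:M + t *: (cl x *m cl y)).
Proof.
have yz : hform y z = 1 by rewrite hformC.
have xz : hform x z = 0 by rewrite hformC.
have [w1 [w2 [<- w11 w22 x1 x2]]] : exists w1 w2, [/\ w1 + w2 = y, hform w1 w1 = 1,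
    hform w2 w2 = -1, hform x w1 = 0 & hform x w2 = 0].
  exists (2^-1 *: y + z), (2^-1 *: y - z); split.
  - by rewrite addrACA subrr addr0 -scalerDl (_ : 2^-1 + 2^-1 = 1) ?scale1r //; field.
  - by rewrite hformDl !hformD !hformZl !hformZ yy zz yz zy; field.
  - by rewrite hformBl !hformB !hformZl !hformZ yy zz yz zy; field.
  - by rewrite hformD hformZ xy xz; ring.
  - by rewrite hformB hformZ xy xz; ring.
have -> : 1%:M + t *: (cl x *m cl (w1 + w2)) =
    (1%:M + t *: (cl x *m cl w1)) *m (1%:M + t *: (cl x *m cl w2)).
  have e0 : cl x *m cl w1 *m (cl x *m cl w2) = 0.
    rewrite (clifford_perp x1) mulNmx -mulmxA [cl x *m (_ *m _)]mulmxA.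
    by rewrite clifford_null // mul0mx mulmx0 oppr0.
  rewrite mulmxDl mul1mx mulmxDr mulmx1 -scalemxAl -scalemxAr e0 !scaler0 addr0.
  by rewrite cliffordD mulmxDr scalerDr addrA [RHS]addrAC.
by apply: SpinM; [apply: (@Spin_shear_unit x w1 1)|apply: (@Spin_shear_unit x w2 (-1))];
  rewrite ?mulrNN ?mulr1.
Qed.

Lemma wedge_sqr0 : wedge y x *m wedge y x = 0.
Proof.
apply: mulmx_cV_ext => v; rewrite -mulmxA !wedgeE hformB hformB !hformZ yy xx xy (hformC y x) xy.
by rewrite !mulr0 subrr !scale0r subrr mul0mx.
Qed.

Definition shear t : 'M[R]_(n.+1 + n.+1) := 1%:M + t *: (2 *: wedge y x).

Lemma shear_covers t : covers (1%:M + t *: (cl x *m cl y)) (shear t).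
Proof.
move=> v; rewrite /shear mulmxDl [(1%:M + _) *m v]mulmxDl !mul1mx -!scalemxAl.
have := dcovers_pair x y v; rewrite -scalemxAl; set u := 2 *: _ => E.
rewrite cliffordD [cl (t *: u)]cliffordZ mulmxDl !mulmxDr !mulmx1.
have -> : (t *: cl u) *m (t *: (cl x *m cl y)) = 0.
  rewrite -scalemxAl -scalemxAr /u wedgeE cliffordZ -scalemxAl cliffordB !cliffordZ mulmxBl.
  rewrite -!scalemxAl mulmxA clifford_null // mul0mx mulmxA (clifford_perp (v := y) (w := x)).
    by rewrite mulNmx -mulmxA clifford_null // mulmx0 oppr0 !scaler0 subrr !scaler0 //.
  by rewrite hformC.
by rewrite -E addr0 -scalemxAr scalerBr -[RHS]addrA [X in _ = _ + X]addrC subrK.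
Qed.

Lemma shearM t : shear t *m shear (- t) = 1%:M.
Proof.
rewrite /shear mulmxDl mul1mx mulmxDr mulmx1 -!scalemxAl -!scalemxAr wedge_sqr0.
by rewrite !scaler0 addr0 -addrA scaleNr addNr addr0.
Qed.

(** For null orthogonal x and y the product x y has square zero, hence t |-> 1
    + t x y is a one-parameter group. *)
Lemma generates_shear (H : set 'M[R]_(spin_dim n)) :
  (forall t, Spin R n (1%:M + t *: (cl x *m cl y)) -> H (1%:M + t *: (cl x *m cl y))) ->
  generates H (2 *: wedge y x).
Proof.
move=> HP; exists 0, 1%:M, (cl x *m cl y), 0, 0, shear, (fun t => shear (- t)) => /=.
have cE t : expaff 0 1%:M (cl x *m cl y) 0 0 t = 1%:M + t *: (cl x *m cl y).
  by rewrite /expaff !scaler0 !addr0.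
have CE (A : 'M[R]_(n.+1 + n.+1)) : is_derive (0 : R) (1 : R) (fun t : R => 1%:M + t *: A) A.
  have := expaff_is_derive 0 1%:M A 0 0 (0 : R).
  rewrite /expaff !scaler0 !addr0 (_ : (fun t => _) = (fun t : R => 1%:M + t *: A)) //.
  by apply/funext => t; rewrite !scaler0 !addr0.
split.
- move=> t; rewrite cE; split; [exact/HP/Spin_shear|exact: shear_covers|exact: shearM].
- by rewrite cE scale0r addr0.
- by rewrite /shear scale0r addr0.
- rewrite derive1E; have [_ ->] := expaff_is_derive 0 1%:M (cl x *m cl y) 0 0 (0 : R).
  by rewrite /expaff !scaler0 !addr0; exact: dcovers_pair.
- split; first exact: CE.
  rewrite (_ : (fun t => _) = (fun t : R => 1%:M + t *: (- (2 *: wedge y x)))); first exact: CE.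
  by apply/funext => t; rewrite /shear scaleNr scalerN.
Qed.

End Null.

Section Boost.
Variables (x y : V).
Hypotheses (xx : hform x x = 0) (yy : hform y y = 0) (xy : hform x y = 1).

(** For a null pair with h(x, y) = 1, the elements x y / 2 and y x / 2 are
    complementary idempotents of the Clifford algebra; the boost acts by p and
    m on their images. *)
Definition boost (p m : R) : 'M[R]_(spin_dim n) :=
  (p / 2) *: (cl x *m cl y) + (m / 2) *: (cl y *m cl x).
Definition stretch (p m : R) : 'M[R]_(n.+1 + n.+1) :=
  (1%:M - outer x y - outer y x) + p ^+ 2 *: outer x y + m ^+ 2 *: outer y x.

Let yx : hform y x = 1. Proof. by rewrite hformC. Qed.

(** The boost is the product of the unit vectors p x + (m/2) y and x + y/2. *)
Lemma boost_Spin p m : p * m = 1 -> Spin R n (boost p m).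
Proof.
move=> pm; have -> : boost p m = cl (p *: x + (m / 2) *: y) *m cl (x + 2^-1 *: y).
  rewrite !cliffordD !cliffordZ mulmxDl !mulmxDr -!scalemxAl -!scalemxAr.
  by rewrite !clifford_null // !scaler0 add0r addr0 scalerA /boost.
apply: Spin_pair; left; rewrite hformDl !hformD !hformZl !hformZ xx yy xy yx.
  by apply: etrans _ pm; field.
by field.
Qed.

Lemma stretchE p m v :
  stretch p m *m v = v + ((p ^+ 2 - 1) * hform y v) *: x + ((m ^+ 2 - 1) * hform x v) *: y.
Proof.
rewrite /stretch !mulmxDl mul1mx !mulNmx -!scalemxAl !outerE.
by apply/colP => i; rewrite !mxE; ring.
Qed.

(** On x, on y and on vectors orthogonal to both, conjugation by the boost is
    multiplication by p^2, m^2 and 1. *)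
Lemma boost_covers p m : p * m = 1 -> covers (boost p m) (stretch p m).
Proof.
move=> pm v; pose v0 := v - hform y v *: x - hform x v *: y.
have yv0 : hform y v0 = 0 by rewrite !hformB !hformZ yx yy; ring.
have xv0 : hform x v0 = 0 by rewrite !hformB !hformZ xx xy; ring.
have -> : stretch p m *m v =
    (p ^+ 2 * hform y v) *: x + (m ^+ 2 * hform x v) *: y + v0.
  by rewrite stretchE; apply/colP => i; rewrite !mxE; ring.
have {1}-> : v = hform y v *: x + hform x v *: y + v0.
  by apply/colP => i; rewrite !mxE; ring.
have XX : cl x *m cl x = 0 by rewrite clifford_null.
have YY : cl y *m cl y = 0 by rewrite clifford_null.
have XYX : cl x *m cl y *m cl x = 2 *: cl x.
  rewrite -mulmxA clifford_anticomm yx mulr1 mulmxBr mulmxA XX mul0mx subr0.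
  by rewrite mul_mx_scalar.
have YXY : cl y *m cl x *m cl y = 2 *: cl y.
  rewrite -mulmxA clifford_anticomm xy mulr1 mulmxBr mulmxA YY mul0mx subr0.
  by rewrite mul_mx_scalar.
have BX : boost p m *m cl x = p *: cl x.
  rewrite /boost mulmxDl -!scalemxAl XYX -mulmxA XX mulmx0 scaler0 addr0 scalerA.
  by congr (_ *: _); field.
have XB : cl x *m boost p m = m *: cl x.
  rewrite /boost mulmxDr -!scalemxAr !mulmxA XYX XX mul0mx scaler0 add0r scalerA.
  by congr (_ *: _); field.
have BY : boost p m *m cl y = m *: cl y.
  rewrite /boost mulmxDl -!scalemxAl YXY -mulmxA YY mulmx0 scaler0 add0r scalerA.
  by congr (_ *: _); field.
have YB : cl y *m boost p m = p *: cl y.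
  rewrite /boost mulmxDr -!scalemxAr !mulmxA YXY YY mul0mx scaler0 addr0 scalerA.
  by congr (_ *: _); field.
have VB : boost p m *m cl v0 = cl v0 *m boost p m.
  rewrite /boost mulmxDl mulmxDr -!scalemxAl -!scalemxAr.
  rewrite -!mulmxA (clifford_perp yv0) (clifford_perp xv0) !mulmxN !mulmxA.
  by rewrite (clifford_perp yv0) (clifford_perp xv0) !mulNmx !opprK.
move: (boost p m) (v0) BX XB BY YB VB => B u BX XB BY YB VB.
rewrite !cliffordD !cliffordZ !mulmxDl !mulmxDr -!scalemxAl -!scalemxAr.
rewrite BX BY XB YB VB !scalerA; congr (_ *: _ + _ *: _ + _).
  by rewrite -mulrA [_ * m]mulrC !mulrA expr2 -[p * p * m]mulrA pm; ring.
by rewrite -mulrA [_ * p]mulrC !mulrA expr2 -[m * m * p]mulrA [m * p]mulrC pm; ring.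
Qed.

Lemma stretchM p m : p * m = 1 -> stretch p m *m stretch m p = 1%:M.
Proof.
move=> pm; apply: mulmx_cV_ext => v; rewrite -mulmxA mul1mx !stretchE !hformD !hformZ.
rewrite xx yy xy yx; apply/colP => i; rewrite !mxE.
have e : p ^+ 2 * m ^+ 2 = 1 by rewrite -exprMn pm expr1n.
apply/eqP; rewrite -subr_eq0; apply/eqP.
transitivity ((p ^+ 2 * m ^+ 2 - 1) * (hform y v * x i 0 + hform x v * y i 0)); first ring.
by rewrite e subrr mul0r.
Qed.

Definition boost_curve (t : R) := boost (expR t) (expR (- t)).
Definition stretch_curve (t : R) := stretch (expR t) (expR (- t)).

Lemma expRpm (t : R) : expR t * expR (- t) = 1.
Proof. by rewrite -expRD subrr expR0. Qed.

Lemma boost_curveE :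
  boost_curve = expaff 1 0 0 (2^-1 *: (cl x *m cl y)) (2^-1 *: (cl y *m cl x)).
Proof.
apply/funext => t; rewrite /boost_curve /boost /expaff scaler0 !add0r mul1r.
by rewrite !scalerA.
Qed.

Lemma stretch_curveE :
  stretch_curve = expaff 2 (1%:M - outer x y - outer y x) 0 (outer x y) (outer y x).
Proof.
apply/funext => t; rewrite /stretch_curve /stretch /expaff scaler0 addr0.
have e1 : expR t * expR t = expR (2 * t) by rewrite -expRD; congr expR; ring.
have e2 : expR (- t) * expR (- t) = expR (- (2 * t)) by rewrite -expRD; congr expR; ring.
by rewrite !expr2 e1 e2.
Qed.

Lemma boost_curve0 : boost_curve 0 = 1%:M.
Proof.
rewrite /boost_curve oppr0 expR0 /boost -scalerDr clifford_anticomm xy mulr1 subrK.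
by rewrite mul1r scale_scalar_mx mulVf // pnatr_eq0.
Qed.

Lemma stretch_curve0 : stretch_curve 0 = 1%:M.
Proof.
by rewrite /stretch_curve oppr0 expR0 /stretch expr1n !scale1r addrAC !subrK.
Qed.

Lemma boost_curve_derive :
  is_derive (0 : R) (1 : R) boost_curve (cl x *m cl y - 1%:M).
Proof.
rewrite boost_curveE; have := expaff_is_derive 1 0 0 (2^-1 *: (cl x *m cl y)) (2^-1 *: (cl y *m cl x)) (0 : R).
rewrite {2}/expaff !scaler0 !mulr0 oppr0 expR0 !scale1r addr0 add0r.
have -> : cl y *m cl x = 2%:M - cl x *m cl y.
  by rewrite clifford_anticomm yx mulr1.
set X := cl x *m cl y; rewrite scaleNr scale1r scalerBr scale_scalar_mx mulVf ?pnatr_eq0 //.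
by rewrite opprB addrA -scalerDl (_ : 2^-1 + 2^-1 = 1) ?scale1r //; field.
Qed.

Lemma stretch_curve_derive :
  is_derive (0 : R) (1 : R) stretch_curve (2 *: wedge y x).
Proof.
rewrite stretch_curveE.
have := expaff_is_derive 2 (1%:M - outer x y - outer y x) 0 (outer x y) (outer y x) (0 : R).
rewrite {2}/expaff !scaler0 !mulr0 oppr0 expR0 !scale1r !add0r scaleNr -scalerBr.
exact.
Qed.

Lemma stretch_curve_deriveN :
  is_derive (0 : R) (1 : R) (fun t => stretch_curve (- t)) (- (2 *: wedge y x)).
Proof.
have -> : (fun t => stretch_curve (- t)) = expaff 2 (1%:M - outer x y - outer y x) 0 (outer y x) (outer x y).
  apply/funext => t; rewrite stretch_curveE /expaff !scaler0 !addr0 mulrN opprK.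
  by rewrite [RHS]addrAC.
have := expaff_is_derive 2 (1%:M - outer x y - outer y x) 0 (outer y x) (outer x y) (0 : R).
rewrite {2}/expaff !scaler0 !mulr0 oppr0 expR0 !scale1r !add0r scaleNr -scalerBr.
by rewrite -scalerN opprB.
Qed.

Lemma generates_boost (H : set 'M[R]_(spin_dim n)) :
  (forall t, Spin R n (boost_curve t) -> H (boost_curve t)) ->
  generates H (2 *: wedge y x).
Proof.
move=> HP; exists 1, 0, 0, (2^-1 *: (cl x *m cl y)), (2^-1 *: (cl y *m cl x)).
exists stretch_curve, (fun t => stretch_curve (- t)); rewrite -boost_curveE /=; split.
- move=> t; split; first exact/HP/boost_Spin/expRpm.
    exact/boost_covers/expRpm.
  by rewrite /stretch_curve opprK stretchM // expRpm.
- exact: boost_curve0.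
- exact: stretch_curve0.
- rewrite derive1E; have [_ ->] := boost_curve_derive.
  exact/dcovers1/dcovers_pair.
- by split; [exact: stretch_curve_derive|exact: stretch_curve_deriveN].
Qed.

End Boost.

End Generators.

(** * Generators of the stabiliser of the isotropic ray *)

Section Spanning.
Variables (R : realType) (n : nat).
Local Notation V := 'cV[R]_(n.+1 + n.+1).
Local Notation cl := (@clifford R n).
Implicit Types (x y v : V).

(** Two boosts in orthogonal hyperbolic planes, with inverse parameters. A
    single boost rescales the pure spinors s_E and s_F; in this combination
    the factors compensate each other, so that the product lies in SL(n+1). *)
Lemma generates_boost_pair (H : set 'M[R]_(spin_dim n)) x y x' y' :
  hform x x = 0 -> hform y y = 0 -> hform x y = 1 ->
  hform x' x' = 0 -> hform y' y' = 0 -> hform x' y' = 1 ->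
  (forall t, Spin R n (boost_curve x y t *m boost_curve x' y' (- t)) ->
     H (boost_curve x y t *m boost_curve x' y' (- t))) ->
  generates H (2 *: wedge y x - 2 *: wedge y' x').
Proof.
move=> xx yy xy xx' yy' xy' HP.
pose c (t : R) := boost_curve x y t *m boost_curve x' y' (- t).
pose C (t : R) := stretch_curve x y t *m stretch_curve x' y' (- t).
pose Ci (t : R) := stretch_curve x' y' t *m stretch_curve x y (- t).
pose X := 2^-1 *: (cl x *m cl y); pose Y := 2^-1 *: (cl y *m cl x).
pose X' := 2^-1 *: (cl x' *m cl y'); pose Y' := 2^-1 *: (cl y' *m cl x').
have cE : c = expaff 2 (X *m X' + Y *m Y') 0 (X *m Y') (Y *m X').
  have aux (p m : R) (P Q P' Q' : 'M[R]_(spin_dim n)) : p * m = 1 ->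
      (p *: P + m *: Q) *m (m *: P' + p *: Q') =
      (P *m P' + Q *m Q') + (p * p) *: (P *m Q') + (m * m) *: (Q *m P').
    move=> pm; rewrite mulmxDl !mulmxDr -!scalemxAl -!scalemxAr !scalerA [m * p]mulrC pm.
    by rewrite !scale1r (addrC (_ *: (Q *m P'))) addrACA addrA.
  apply/funext => t; have e1 : expR t * expR t = expR (2 * t).
    by rewrite -expRD; congr expR; ring.
  have e2 : expR (- t) * expR (- t) = expR (- (2 * t)).
    by rewrite -expRD; congr expR; ring.
  have b1 : boost_curve x y t = expR t *: X + expR (- t) *: Y.
    by rewrite boost_curveE /expaff scaler0 !add0r mul1r.
  have b2 : boost_curve x' y' (- t) = expR (- t) *: X' + expR t *: Y'.
    by rewrite boost_curveE /expaff scaler0 !add0r mul1r opprK.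
  by rewrite /c b1 b2 (aux _ _ _ _ _ _ (expRpm t)) /expaff scaler0 addr0 e1 e2.
have boostN : is_derive (0 : R) (1 : R) (fun t => boost_curve x' y' (- t)) (1%:M - cl x' *m cl y').
  have -> : (fun t : R => boost_curve x' y' (- t)) = boost_curve y' x'.
    apply/funext => t; rewrite !boost_curveE /expaff !scaler0 !add0r !mul1r opprK.
    by rewrite addrC.
  have := boost_curve_derive (x := y') (y := x'); rewrite (hformC y' x') xy'.
  rewrite clifford_anticomm (hformC y' x') xy' mulr1.
  have -> : 2%:M - cl x' *m cl y' - 1%:M = 1%:M - cl x' *m cl y' :> 'M[R]_(spin_dim n).
    by rewrite addrAC -raddfB /=; congr (_%:M - _); ring.
  exact.
have c0 : c 0 = 1%:M by rewrite /c oppr0 !boost_curve0 // mulmx1.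
have dc : is_derive (0 : R) (1 : R) c ((cl x *m cl y - 1%:M) - (cl x' *m cl y' - 1%:M)).
  have := is_derive_mulmx (boost_curve_derive xy) boostN.
  by rewrite oppr0 !boost_curve0 // mulmx1 mul1mx opprB.
exists 2, (X *m X' + Y *m Y'), 0, (X *m Y'), (Y *m X'), C, Ci; rewrite -cE /=; split.
- move=> t; have e := expRpm (- t); rewrite opprK in e; have e' := expRpm t; split.
  + apply: HP; apply: SpinM; first exact: boost_Spin.
    by apply: boost_Spin => //; rewrite opprK.
  + apply: coversM; first exact: boost_covers.
    by apply: boost_covers => //; rewrite opprK.
  + rewrite /C /Ci mulmxA -[_ *m _ *m stretch_curve x' y' t]mulmxA.
    rewrite [stretch_curve x' y' (- t) *m _](_ : _ = 1%:M) ?mulmx1.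
      by rewrite /stretch_curve opprK stretchM.
    by rewrite /stretch_curve opprK stretchM.
- exact: c0.
- by rewrite /C oppr0 !stretch_curve0 mulmx1.
- rewrite derive1E; have [_ ->] := dc.
  by apply: dcoversB; exact/dcovers1/dcovers_pair.
- split.
    have := is_derive_mulmx (stretch_curve_derive x y) (stretch_curve_deriveN x' y').
    by rewrite oppr0 !stretch_curve0 mulmx1 mul1mx.
  have := is_derive_mulmx (stretch_curve_derive x' y') (stretch_curve_deriveN x y).
  by rewrite oppr0 !stretch_curve0 mulmx1 mul1mx opprB.
Qed.

(** The basis e_i (first component false), eps^i (first component true) of E +
    F. *)
Definition null_basis (p : bool * 'I_n.+1) : V :=
  if p.1 then col_mx 0 (delta_mx p.2 0) else col_mx (delta_mx p.2 0) 0.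
Local Notation nul := null_basis.
Definition dual (p : bool * 'I_n.+1) := (~~ p.1, p.2).

Lemma dualK : involutive dual. Proof. by case=> b i; rewrite /dual /= negbK. Qed.

Lemma hform_nul v p : hform (nul p) v = (if p.1 then usubmx v p.2 0 else dsubmx v p.2 0).
Proof.
case: p => -[] i; rewrite /nul /= hformE (bigD1 i) //= big1 ?addr0; try by
  rewrite !(col_mxKu, col_mxKd) !mxE eqxx /=; ring.
- by move=> j ji; rewrite !(col_mxKu, col_mxKd) !mxE (negbTE ji) /=; ring.
- by move=> j ji; rewrite !(col_mxKu, col_mxKd) !mxE (negbTE ji) /=; ring.
Qed.

Lemma hform_nul2 p q : hform (nul p) (nul q) = (q == dual p)%:R.
Proof.
rewrite hform_nul; case: p => -[] i; case: q => -[] j;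
  rewrite /nul /dual /= !(col_mxKu, col_mxKd) !mxE ?xpair_eqE /= ?andbT //; by rewrite eq_sym.
Qed.

Lemma nul_ext v w : (forall p, hform (nul p) v = hform (nul p) w) -> v = w.
Proof.
move=> vw; rewrite -(vsubmxK v) -(vsubmxK w); congr col_mx; apply/colP => i.
  by have := vw (true, i); rewrite !hform_nul.
by have := vw (false, i); rewrite !hform_nul.
Qed.

Lemma hform_sum v I (r : seq I) (P : pred I) (F : I -> V) :
  hform v (\sum_(i <- r | P i) F i) = \sum_(i <- r | P i) hform v (F i).
Proof. by apply: (big_morph (hform v) (hformD v) (hform0 v)). Qed.

Lemma nul_sum v : v = \sum_p hform (nul (dual p)) v *: nul p.
Proof.
apply: nul_ext => q; rewrite hform_sum (bigD1 (dual q)) //= big1 => [|p pq].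
  by rewrite hformZ hform_nul2 eqxx dualK mulr1 addr0.
by rewrite hformZ hform_nul2 (negbTE pq) mulr0.
Qed.

Lemma wedgevv x : wedge x x = 0. Proof. by rewrite /wedge subrr. Qed.

Lemma wedge_linear (a : R) x y y' : wedge x (a *: y + y') = a *: wedge x y + wedge x y'.
Proof.
apply: mulmx_cV_ext => v; rewrite [RHS]mulmxDl -scalemxAl !wedgeE hformDl hformZl.
by apply/colP => i; rewrite !mxE; ring.
Qed.

Lemma wedge0 x : wedge x 0 = 0.
Proof. by rewrite -[X in wedge x X](scale0r 0) -[_ *: 0]addr0 wedge_linear scale0r !add0r /wedge trmx0 mulmx0 !mul0mx subrr. Qed.

Lemma wedge_sum x I (r : seq I) (a : I -> R) (F : I -> V) :
  wedge x (\sum_(i <- r) a i *: F i) = \sum_(i <- r) a i *: wedge x (F i).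
Proof.
by elim: r => [|i r IH]; rewrite ?big_nil ?wedge0 // !big_cons wedge_linear IH.
Qed.

(** A null basis whose first vector is v~ = e_0 + eps^n, obtained from the
    standard one by the isometry 1 + N with N = eps^0 /\ eps^n of square zero:
    it changes e_0 into e_0 + eps^n and e_n into e_n - eps^0. *)
Definition adapted (p : bool * 'I_n.+1) : V :=
  nul p + wedge (nul (true, ord0)) (nul (true, ord_max)) *m nul p.

Let N := wedge (nul (true, ord0)) (nul (true, ord_max)).

Lemma N_sqr0 v : N *m (N *m v) = 0.
Proof.
have e0 i j : hform (nul (true, i)) (nul (true, j)) = 0 by rewrite hform_nul2.
by rewrite /N !wedgeE !hformB !hformZ !e0 !mulr0 subrr !scale0r subrr.
Qed.

Lemma N_skew v w : hform (N *m v) w = - hform v (N *m w).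
Proof. by have /so_hform := wedge_so (nul (true, ord0)) (nul (true, ord_max)); apply. Qed.

Lemma hform_adapted p q : hform (adapted p) (adapted q) = (q == dual p)%:R.
Proof.
rewrite /adapted -/N hformDl !hformD hform_nul2 !N_skew N_sqr0 hform0.
by ring.
Qed.

Lemma adapted_sum v : v = \sum_p hform (adapted (dual p)) v *: adapted p.
Proof.
have [w wE] : exists w, v = w + N *m w.
  by exists (v - N *m v); rewrite mulmxBr N_sqr0 subr0 subrK.
have hE p : hform (adapted p) v = hform (nul p) w.
  by rewrite {1}wE /adapted -/N hformDl !hformD !N_skew N_sqr0 hform0; ring.
under eq_bigr do rewrite hE /adapted -/N scalerDr scalemxAr.
by rewrite big_split /= -mulmx_sumr -nul_sum -wE.
Qed.

(** A skew map A is half the sum of b^p /\ A b_p over a pair of dual bases; A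
    b_p is then expanded in the basis again. *)
Lemma so_adapted A : A \in so_h R n -> A = 2^-1 *: \sum_p \sum_q
  hform (adapted (dual q)) (A *m adapted p) *: wedge (adapted (dual p)) (adapted q).
Proof.
move=> /so_hform sA.
under eq_bigr do rewrite -wedge_sum -adapted_sum.
apply: mulmx_cV_ext => v; rewrite -scalemxAl mulmx_suml.
under eq_bigr do rewrite wedgeE sA.
rewrite sumrB; have -> : \sum_p hform (adapted (dual p)) v *: (A *m adapted p) = A *m v.
  by rewrite {2}(adapted_sum v) mulmx_sumr; apply: eq_bigr => p _; rewrite scalemxAr.
have -> : \sum_p - hform (adapted p) (A *m v) *: adapted (dual p) = - (A *m v).
  rewrite {2}(adapted_sum (A *m v)) -sumrN (reindex_inj (can_inj dualK)) /=.
  by apply: eq_bigr => p _; rewrite dualK scaleNr.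
by rewrite opprK scalerDr -scalerDl (_ : 2^-1 + 2^-1 = 1) ?scale1r //; field.
Qed.

Lemma adapted_vtilde : (0 < n)%N -> adapted (false, ord0) = vtilde R n.
Proof.
move=> n0; rewrite /adapted wedgeE.
have -> : hform (nul (true, ord0)) (nul (false, ord0)) = 1 by rewrite hform_nul2 eqxx.
have -> : hform (nul (true, ord_max)) (nul (false, ord0)) = 0.
  by rewrite hform_nul2 xpair_eqE /= -val_eqE /= eq_sym (gtn_eqF n0).
by rewrite scale1r scale0r subr0 /nul /vtilde /= add_col_mx addr0 add0r.
Qed.

(** In the expansion of A in the adapted basis, an element b_p /\ b_q is a
    shear if its factors are orthogonal and a boost if they are dual. The
    factor dual to v~ must be avoided, except against v~ itself; these
    coefficients vanish because A preserves the line of v~. *)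
Lemma liePt_ind (S : set 'M[R]_(n.+1 + n.+1)) : (0 < n)%N -> is_subspace S ->
  (forall A, A \in so_h R n -> generates (groupPt R n) A -> S A) ->
  forall A, liePt R n A -> S A.
Proof.
move=> n0 [S0 SD] SG A [sA [c Av]].
have SZ a B : S B -> S (a *: B) by move=> SB; rewrite -[a *: B]addr0; apply: SD.
have Ssum I (r : seq I) (F : I -> 'M[R]_(n.+1 + n.+1)) : (forall i, S (F i)) -> S (\sum_(i <- r) F i).
  move=> SF; elim: r => [|i r IH]; rewrite ?big_nil ?big_cons //.
  by rewrite -[F i]scale1r; apply: SD.
have S2 x y : S (2 *: wedge x y) -> S (wedge x y).
  by move/(SZ 2^-1); rewrite scalerA mulVf ?pnatr_eq0 // scale1r.
have so2 x y : 2 *: wedge x y \in so_h R n by rewrite memvZ ?wedge_so.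
have [vt vtE] : exists v, v = vtilde R n by eexists.
pose p0 := (false, @ord0 n); have vtp : adapted p0 = vt by rewrite adapted_vtilde.
have hvt q : hform (adapted q) vt = (q == dual p0)%:R.
  by rewrite -vtp hform_adapted -(can2_eq dualK dualK) eq_sym.
rewrite (so_adapted sA); apply: (SZ); apply: (Ssum) => p; apply: (Ssum) => q.
have [->|qp] := eqVneq q (dual p); first by rewrite wedgevv scaler0.
have null r : hform (adapted r) (adapted r) = 0.
  by rewrite hform_adapted; case: r => -[] i; rewrite /dual xpair_eqE.
have [->|qp1] := eqVneq q p.
  apply: (SZ); apply: (S2); apply: (SG) => //; apply: generates_boost => //.
    by rewrite hform_adapted eqxx.
  move=> t spin; split=> //.
  have pd1 : hform (adapted p) (adapted (dual p)) = 1 by rewrite hform_adapted eqxx.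
  exists (stretch_curve (adapted p) (adapted (dual p)) t).
  suff [a [a0 aE]] : exists a, 0 < a /\
      stretch_curve (adapted p) (adapted (dual p)) t *m vt = a *: vt.
    by exists a; rewrite -vtE; split=> //; apply: boost_covers => //; exact: expRpm.
  rewrite stretchE !hvt; have [->|pp] := eqVneq p p0.
    exists (expR t ^+ 2); split; first by rewrite exprn_gt0 // expR_gt0.
    rewrite eqxx (_ : (p0 == dual p0) = false) // vtp !mulr0 scale0r addr0 mulr1.
    by rewrite scalerBl scale1r addrC subrK.
  rewrite (can_eq dualK) (negbTE pp) mulr0 scale0r addr0.
  have [->|pp'] := eqVneq p (dual p0).
    exists (expR (- t) ^+ 2); split; first by rewrite exprn_gt0 // expR_gt0.
    by rewrite dualK vtp mulr1 scalerBl scale1r addrC subrK.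
  by exists 1; rewrite ltr01 mulr0 scale0r addr0 scale1r.
have [c0|c0] := eqVneq (hform (adapted (dual q)) (A *m adapted p)) 0.
  by rewrite c0 scale0r.
have pp0 : p != p0.
  apply: contra_neq c0 => pE; rewrite pE vtp vtE Av hformZ -vtE hvt.
  by rewrite (can_eq dualK) -pE (negbTE qp1) mulr0.
have qp0 : q != dual p0.
  apply: contra_neq c0 => qE; rewrite qE dualK vtp vtE.
  have /so_hform sA' := sA; apply: (@oppr_inj R); rewrite -sA' Av hformZl -vtE hformC hvt.
  by rewrite -qE eq_sym (negbTE qp1) mulr0 oppr0.
apply: (SZ); apply: (S2); apply: (SG) => //; apply: (@generates_shear _ _ _ _ (adapted p)) => //.
- by rewrite hform_adapted (can_eq dualK) eq_sym (negbTE qp1).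
- by rewrite hform_adapted eqxx.
- by rewrite hform_adapted (negbTE qp).
move=> t spin; split=> //; exists (shear (adapted q) (adapted (dual p)) t), 1; split=> //.
  apply: shear_covers => //.
  by rewrite hform_adapted (can_eq dualK) eq_sym (negbTE qp1).
rewrite -vtE /shear mulmxDl mul1mx -!scalemxAl wedgeE !hvt (can_eq dualK).
by rewrite (negbTE pp0) (negbTE qp0) !scale0r subrr !scaler0 addr0 scale1r.
Qed.

End Spanning.

(** * Generators of the projective parabolic *)

Section SpanningP.
Variables (R : realType) (n : nat).
Local Notation V := 'cV[R]_(n.+1 + n.+1).
Local Notation cl := (@clifford R n).
Local Notation nul := (@null_basis R n).

Lemma sl_emb_linear (a : R) (A B : 'M[R]_n.+1) :
  sl_emb (a *: A + B) = a *: sl_emb A + sl_emb B.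
Proof.
rewrite /sl_emb scale_block_mx add_block_mx !scaler0 !addr0.
by rewrite linearP /= opprD scalerN.
Qed.

Lemma tr_delta m (i j : 'I_m) : \tr (delta_mx i j : 'M[R]_m) = (i == j)%:R.
Proof.
rewrite /mxtrace (bigD1 i) //= big1 ?addr0 => [|k ki]; first by rewrite mxE eqxx.
by rewrite mxE (negbTE ki).
Qed.

Lemma wedge_nul i j : wedge (nul (true, j)) (nul (false, i)) = sl_emb (delta_mx i j).
Proof.
rewrite /wedge /sl_emb /nul /= !tr_col_mx !trmx0 /hmx -!mulmxA !mul_row_block.
rewrite !mulmx0 !mulmx1 !add0r !addr0 !mul_col_row !mul0mx !mulmx0 opp_block_mx add_block_mx.
by rewrite !oppr0 !addr0 !add0r !trmx_delta !mul_delta_mx.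
Qed.

Lemma sl_emb_mul (P : 'M[R]_n.+1) (u w : 'cV[R]_n.+1) :
  sl_emb P *m col_mx u w = col_mx (P *m u) (- (P^T *m w)).
Proof. by rewrite /sl_emb mul_block_col !mul0mx addr0 add0r mulNmx. Qed.

Lemma lieP_emb (P : 'M[R]_n.+1) : \tr P = 0 ->
  lieP R n (sl_emb P) <-> forall i, i != ord0 -> P i ord0 = 0.
Proof.
move=> tP; split=> [[_ [c]]|P0].
  rewrite /vplus sl_emb_mul scale_col_mx mulmx0 oppr0 scaler0 => /eq_col_mx[+ _] i i0.
  by move=> /colP/(_ i); rewrite -colE !mxE (negbTE i0) mulr0.
split; first by apply/sl_hP; exists P.
exists (P ord0 ord0); rewrite /vplus sl_emb_mul scale_col_mx mulmx0 oppr0 scaler0.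
congr col_mx; apply/colP => i; rewrite -colE !mxE andbT.
by case: eqP => [->|/eqP/P0 ->]; rewrite ?mulr1 ?mulr0.
Qed.

Variables (sE sF : 'cV[R]_(spin_dim n)).
Hypotheses (hE : spinor_E sE) (hF : spinor_F sF).

Let clE i : cl (nul (false, i)) *m sE = 0.
Proof. by apply/hE; rewrite /null_basis /= col_mxKd. Qed.

Let clF i : cl (nul (true, i)) *m sF = 0.
Proof. by apply/hF; rewrite /null_basis /= col_mxKu. Qed.

Let vpE : vplus R n = nul (false, ord0). Proof. by []. Qed.

Lemma generates_shear_sl i j : i != j -> j != ord0 ->
  generates (groupP sE sF) (2 *: sl_emb (delta_mx i j)).
Proof.
move=> ij j0; rewrite -wedge_nul.
have xy : hform (nul (false, i)) (nul (true, j)) = 0.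
  by rewrite hform_nul2 xpair_eqE /= eq_sym (negbTE ij).
apply: (@generates_shear _ _ _ _ (nul (false, j))).
1-6: by rewrite hform_nul2 ?xpair_eqE /= ?eqxx // eq_sym (negbTE ij).
move=> t spin; split.
  split=> //; rewrite mulmxDl mul1mx -scalemxAl -mulmxA.
    have -> : cl (nul (false, i)) *m (cl (nul (true, j)) *m sE) = 0.
      by rewrite mulmxA (clifford_perp xy) mulNmx -mulmxA (clE i) mulmx0 oppr0.
    by rewrite scaler0 addr0.
  by rewrite clF mulmx0 scaler0 addr0.
exists (shear (nul (false, i)) (nul (true, j)) t), 1; split=> //.
  by apply: shear_covers; rewrite // hform_nul2 ?xpair_eqE.
rewrite vpE /shear mulmxDl mul1mx -!scalemxAl wedgeE.
have -> : hform (nul (true, j)) (nul (false, ord0)) = 0.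
  by rewrite hform_nul2 xpair_eqE /= eq_sym (negbTE j0).
have -> : hform (nul (false, i)) (nul (false, ord0)) = 0 by rewrite hform_nul2.
by rewrite !scale0r subrr !scaler0 addr0 scale1r.
Qed.

(** Since x annihilates s_E, only the idempotent x y / 2 acts, as the
    identity. *)
Lemma boost_spinorE x y t : hform x y = 1 -> cl x *m sE = 0 ->
  boost_curve x y t *m sE = expR t *: sE.
Proof.
move=> xy x0; rewrite /boost_curve /boost mulmxDl -!scalemxAl -!mulmxA x0 mulmx0 scaler0 addr0.
rewrite mulmxA clifford_anticomm xy mulr1 mulmxBl mul_scalar_mx -mulmxA x0 mulmx0 subr0.
by rewrite scalerA; congr (_ *: _); field.
Qed.

Lemma boost_spinorF x y t : hform x y = 1 -> cl y *m sF = 0 ->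
  boost_curve x y t *m sF = expR (- t) *: sF.
Proof.
move=> xy y0; rewrite /boost_curve /boost mulmxDl -!scalemxAl -!mulmxA y0 mulmx0 scaler0 add0r.
rewrite mulmxA clifford_anticomm hformC xy mulr1 mulmxBl mul_scalar_mx -mulmxA y0 mulmx0 subr0.
by rewrite scalerA; congr (_ *: _); field.
Qed.

(** Together with the elementary matrices, the differences E_jj - E_00 account
    for the trace-free diagonal. *)
Lemma generates_boost_sl j : j != ord0 ->
  generates (groupP sE sF) (2 *: (sl_emb (delta_mx j j) - sl_emb (delta_mx ord0 ord0))).
Proof.
move=> j0; rewrite -!wedge_nul scalerBr.
have hp k : hform (nul (false, k)) (nul (true, k)) = 1 by rewrite hform_nul2 eqxx.
apply: generates_boost_pair => //; try by rewrite hform_nul2 xpair_eqE.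
move=> t spin; split.
  split=> //; rewrite -mulmxA.
    by rewrite boost_spinorE // -scalemxAr boost_spinorE // scalerA -expRD addNr expR0 scale1r.
  by rewrite boost_spinorF // -scalemxAr boost_spinorF // opprK scalerA -expRD subrr expR0 scale1r.
exists (stretch_curve (nul (false, j)) (nul (true, j)) t *m
        stretch_curve (nul (false, ord0)) (nul (true, ord0)) (- t)), (expR (- t) ^+ 2).
have z k : hform (nul (false, k)) (nul (false, ord0)) = 0 by rewrite hform_nul2.
split; last first.
- have e0 : stretch_curve (nul (false, ord0)) (nul (true, ord0)) (- t) *m nul (false, ord0) =
      expR (- t) ^+ 2 *: nul (false, ord0).
    rewrite stretchE hformC hp z mulr0 scale0r addr0 mulr1 scalerBl scale1r.
    by rewrite addrC subrK.
  rewrite vpE -mulmxA e0 -scalemxAr stretchE z.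
  have -> : hform (nul (true, j)) (nul (false, ord0)) = 0.
    by rewrite hform_nul2 xpair_eqE /= eq_sym (negbTE j0).
  by rewrite !mulr0 !scale0r !addr0.
- by rewrite exprn_gt0 // expR_gt0.
- have n0 b k : hform (nul (b, k)) (nul (b, k)) = 0.
    by rewrite hform_nul2 xpair_eqE /=; case: b.
  by apply: coversM; apply: boost_covers => //; rewrite ?opprK ?expRpm // mulrC expRpm.
Qed.

(** A trace-free matrix preserving the line of e_0 is a combination of the
    E_ij with j <> 0, i <> j, and of the E_jj - E_00. *)
Lemma lieP_ind (S : set 'M[R]_(n.+1 + n.+1)) : is_subspace S ->
  (forall A, A \in sl_h R n -> generates (groupP sE sF) A -> S A) ->
  forall A, lieP R n A -> S A.
Proof.
move=> [S0 SD] SG A pA; have [/sl_hP[P [tP AE]] _] := pA.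
move: pA; rewrite {A}AE => /(lieP_emb tP) P0.
have SZ a B : S B -> S (a *: B) by move=> SB; rewrite -[a *: B]addr0; apply: SD.
pose G i j : 'M[R]_n.+1 :=
  if i == j then delta_mx j j - delta_mx ord0 ord0 else delta_mx i j.
have PE : P = \sum_(j | j != ord0) \sum_i P i j *: G i j.
  have -> : \sum_(j | j != ord0) \sum_i P i j *: G i j =
      \sum_(j | j != ord0) (\sum_i P i j *: delta_mx i j - P j j *: delta_mx ord0 ord0).
    apply: eq_bigr => j _; rewrite (bigD1 j) //= [in RHS](bigD1 j) //= /G eqxx.
    rewrite scalerBr addrAC; congr (_ + _ - _); apply: eq_bigr => i ij.
    by rewrite (negbTE ij).
  rewrite sumrB -scaler_suml.
  have -> : \sum_(j | j != ord0) P j j = - P ord0 ord0.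
    by have := tP; rewrite /mxtrace (bigD1 ord0) //= addrC => /eqP; rewrite addr_eq0 => /eqP.
  rewrite scaleNr opprK {1}[P]matrix_sum_delta exchange_big (bigD1 ord0) //= addrC.
  congr (_ + _); rewrite (bigD1 ord0) //= big1 ?addr0 // => i i0.
  by rewrite P0 // scale0r.
have Semb (I : finType) (Q : pred I) (a : I -> R) (F : I -> 'M[R]_n.+1) :
    (forall i, Q i -> S (sl_emb (F i))) -> S (sl_emb (\sum_(i | Q i) a i *: F i)).
  move=> SF; apply: (big_ind (fun B => S (sl_emb B))).
  - by rewrite /sl_emb trmx0 oppr0 block_mx0.
  - by move=> B C SB SC; rewrite -[B]scale1r sl_emb_linear; apply: SD.
  - by move=> i Qi; rewrite -[_ *: _]addr0 sl_emb_linear; apply: SD; [exact: SF|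
      rewrite /sl_emb trmx0 oppr0 block_mx0].
have S2 (B : 'M[R]_n.+1) : \tr B = 0 -> generates (groupP sE sF) (2 *: sl_emb B) -> S (sl_emb B).
  move=> tB gB; rewrite -[sl_emb B]scale1r -[1](mulVf (x := 2 : R)) ?pnatr_eq0 //.
  rewrite -scalerA; apply: (SZ); apply: (SG) => //.
  by rewrite memvZ //; apply/sl_hP; exists B.
rewrite PE -[X in sl_emb X](_ : \sum_(j | j != ord0) 1 *: (\sum_i P i j *: G i j) = _); last first.
  by apply: eq_bigr => j _; rewrite scale1r.
apply: (Semb) => j j0; apply: (Semb) => i _; apply: S2; rewrite /G; case: eqP => [_|/eqP ij].
- by rewrite raddfB /= !tr_delta !eqxx subrr.
- by rewrite tr_delta (negbTE ij).
- rewrite -scaleN1r addrC sl_emb_linear scaleN1r addrC; exact: generates_boost_sl.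
- exact: generates_shear_sl.
Qed.

End SpanningP.

(** * Nilpotent ideals and traces *)

Section LieAlgebra.
Variables (R : realType) (m : nat).
Implicit Types (A B C X Y : 'M[R]_m).

Lemma lie_linear A (a : R) B C : lie A (a *: B + C) = a *: lie A B + lie A C.
Proof. by rewrite /lie mulmxDr mulmxDl -scalemxAr -scalemxAl scalerBr opprD addrACA. Qed.

Lemma lie_skew A B : lie A B = - lie B A. Proof. by rewrite /lie opprB. Qed.

Lemma lieD A B C : lie A (B + C) = lie A B + lie A C.
Proof. by rewrite -[B in LHS]scale1r lie_linear scale1r. Qed.

Lemma lie0 A : lie A 0 = 0. Proof. by rewrite /lie mulmx0 mul0mx subrr. Qed.

Lemma lieZ A (a : R) B : lie A (a *: B) = a *: lie A B.
Proof. by rewrite -[a *: B]addr0 lie_linear lie0 addr0. Qed.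

Lemma lieB A B C : lie A (B - C) = lie A B - lie A C.
Proof. by rewrite -scaleN1r lieD lieZ scaleN1r. Qed.

Lemma jacobi A B C : lie A (lie B C) = lie (lie A B) C + lie B (lie A C).
Proof.
rewrite /lie !mulmxBr !mulmxBl !mulmxA.
set a := A *m B *m C; set b := A *m C *m B; set c := B *m C *m A; set d := C *m B *m A.
set e := B *m A *m C; set f := C *m A *m B.
by apply/matrixP => i j; rewrite !mxE; ring.
Qed.

(** Sums of iterated brackets of k + 1 elements of I. Sums are included so
    that the terms are stable under brackets with the ambient algebra, by the
    Jacobi identity. *)
Inductive lower_central (I : set 'M[R]_m) : nat -> 'M[R]_m -> Prop :=
| Lc0 A : I A -> lower_central I 0 A
| LcS k A B : I A -> lower_central I k B -> lower_central I k.+1 (lie A B)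
| LcD k A B : lower_central I k A -> lower_central I k B -> lower_central I k (A + B).

Lemma lower_central_ideal p I k A B : is_ideal p I -> p A ->
  lower_central I k B -> lower_central I k (lie A B).
Proof.
move=> [_ _ idI] pA; elim=> {k B} [B IB|k B C IB lcC IH|k B C _ IHB _ IHC].
- by apply: Lc0; apply: idI.
- by rewrite jacobi; apply: LcD; apply: LcS => //; apply: idI.
- by rewrite lieD; apply: LcD.
Qed.

Lemma lower_central_nilpotent I : is_nilpotent I ->
  exists k, forall B, lower_central I k B -> B = 0.
Proof.
move=> [K nK]; exists K => B lB.
suff : forall k C, lower_central I k C -> forall s, (size s + k = K)%N ->
    (forall A, A \in s -> I A) -> foldr (@lie R m) C s = 0.
  by move/(_ K B lB [::] (add0n K)); apply.
move=> k C; elim=> {k C} [C IC s|k A C IA _ IH s sk sI|k C D _ IHC _ IHD s sk sI].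
- by rewrite addn0 => sK sI; apply: nK.
- have -> : foldr (@lie R m) (lie A C) s = foldr (@lie R m) C (rcons s A).
    by rewrite foldr_rcons.
  apply: IH; first by rewrite size_rcons addSnnS.
  by move=> X; rewrite mem_rcons inE => /orP[/eqP ->|/sI].
- have -> : foldr (@lie R m) (C + D) s = foldr (@lie R m) C s + foldr (@lie R m) D s.
    by elim: s {sk sI} => //= X s ->; rewrite lieD.
  by rewrite IHC // IHD // addr0.
Qed.

Lemma nilradical0 (p : set 'M[R]_m) : p 0 -> nilradical p 0.
Proof.
move=> p0; exists [set 0]; split=> //.
  split=> [|A /= ->//|A B _ /= ->]; last exact: lie0.
  by split=> // a A B /= -> ->; rewrite scaler0 addr0.
by exists 0%N => s B /size0nil -> _ /= ->.
Qed.

Lemma lin_comb (V W : lmodType R) (phi : V -> W) I (r : seq I) (a : I -> R) (F : I -> V) :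
  (forall a u v, phi (a *: u + v) = a *: phi u + phi v) ->
  phi (\sum_(i <- r) a i *: F i) = \sum_(i <- r) a i *: phi (F i).
Proof.
move=> lphi; have phi0 : phi 0 = 0.
  by apply: (addrI (phi 0)); rewrite addr0 -{1}[phi 0]scale1r -lphi scale1r !addr0.
by elim: r => [|i r IH]; rewrite ?big_nil // !big_cons lphi IH.
Qed.

(** The Killing form is a trace over a subspace g of matrices. If g is a
    retract of a full matrix algebra, the trace can be taken there, in the
    standard basis. *)
Lemma killing_trace k (g : {vspace 'M[R]_m}) (iota : 'M[R]_k -> 'M[R]_m)
    (rho : 'M[R]_m -> 'M[R]_k) X Y :
  (forall a M M', iota (a *: M + M') = a *: iota M + iota M') ->
  (forall a B B', rho (a *: B + B') = a *: rho B + rho B') ->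
  (forall B, B \in g -> iota (rho B) = B) ->
  (forall M, lie X (lie Y (iota M)) \in g) ->
  killing g X Y = \sum_i \sum_j rho (lie X (lie Y (iota (delta_mx i j)))) i j.
Proof.
move=> li lr ir fg.
pose f B := lie X (lie Y B).
have lf a B C : f (a *: B + C) = a *: f B + f C by rewrite /f !lie_linear.
have E (l : 'I_(\dim g)) : coord (vbasis g) l (f (vbasis g)`_l) =
    \sum_i \sum_j rho (vbasis g)`_l i j * coord (vbasis g) l (f (iota (delta_mx i j))).
  have bg : (vbasis g)`_l \in g by apply: vbasis_mem; rewrite mem_nth // size_tuple.
  pose phi M : R^o := coord (vbasis g) l (f (iota M)).
  have lphi a M M' : phi (a *: M + M') = a *: phi M + phi M'.
    by rewrite /phi li lf linearP.
  rewrite -{1}(ir _ bg) -/(phi _) [in LHS](matrix_sum_delta (rho _)) pair_big /=.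
  by rewrite (lin_comb _ _ _ lphi) pair_big.
rewrite /killing (eq_bigr _ (fun l _ => E l)) exchange_big; apply: eq_bigr => i _.
rewrite exchange_big; apply: eq_bigr => j _ /=.
pose psi B : R^o := rho B i j.
have lpsi a B C : psi (a *: B + C) = a *: psi B + psi C by rewrite /psi lr !mxE.
rewrite -/(psi _) [in RHS](coord_vbasis (fg _)) (lin_comb _ _ _ lpsi).
by apply: eq_bigr => l _; rewrite mulrC.
Qed.

Lemma trace_conj_delta (P Q : 'M[R]_m) :
  \sum_i \sum_j (P *m delta_mx i j *m Q) i j = \tr P * \tr Q.
Proof.
rewrite /mxtrace mulr_suml; apply: eq_bigr => i _; rewrite mulr_sumr; apply: eq_bigr => j _.
rewrite mxE (bigD1 j) //= big1 ?addr0 => [|l lj].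
  by rewrite mxE (bigD1 i) //= big1 ?addr0 => [|l li]; rewrite !mxE ?eqxx ?mulr1 // (negbTE li) mulr0.
by rewrite mxE big1 ?mul0r // => l' _; rewrite mxE (negbTE lj) andbF mulr0.
Qed.

End LieAlgebra.

(** * Killing forms *)

Section Killing.
Variables (R : realType) (n : nat).
Local Notation N := (n.+1 + n.+1)%N.
Local Notation V := 'cV[R]_(n.+1 + n.+1).
Local Notation h := (hmx R n).

Lemma lie_sum_delta m (X Y : 'M[R]_m) :
  \sum_i \sum_j lie X (lie Y (delta_mx i j)) i j =
  2 * m%:R * \tr (X *m Y) - 2 * \tr X * \tr Y.
Proof.
have E i j : lie X (lie Y (delta_mx i j)) i j =
    (X *m Y *m delta_mx i j *m 1%:M) i j + (1%:M *m delta_mx i j *m (Y *m X)) i j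
    - ((X *m delta_mx i j *m Y) i j + (Y *m delta_mx i j *m X) i j).
  rewrite /lie !mulmxBr !mulmxBl mulmx1 mul1mx !mulmxA.
  set a := X *m Y *m _; set b := X *m _ *m Y; set c := Y *m _ *m X; set d := _ *m Y *m X.
  by rewrite !mxE; ring.
under eq_bigr do (under eq_bigr do rewrite E; rewrite sumrB !big_split /=).
rewrite sumrB !big_split /= !trace_conj_delta mxtrace1 (mxtrace_mulC Y X); ring.
Qed.

Lemma lie_emb (P Q : 'M[R]_n.+1) : lie (sl_emb P) (sl_emb Q) = sl_emb (lie P Q).
Proof.
rewrite /lie /sl_emb !mulmx_block !(mulmx0, mul0mx) !addr0 !add0r opp_block_mx add_block_mx.
by rewrite !oppr0 !addr0 linearB /= !trmx_mul !mulmxN !mulNmx !opprK opprB.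
Qed.

Lemma tr_lie m (P Q : 'M[R]_m) : \tr (lie P Q) = 0.
Proof. by rewrite /lie raddfB /= mxtrace_mulC subrr. Qed.

Lemma killing_sl (P Q : 'M[R]_n.+1) : \tr P = 0 ->
  killing (sl_h R n) (sl_emb P) (sl_emb Q) = 2 * n.+1%:R * \tr (P *m Q).
Proof.
move=> tP; rewrite (@killing_trace _ _ n.+1 _ (@sl_emb R n) ulsubmx).
- under eq_bigr do under eq_bigr do rewrite !lie_emb /sl_emb block_mxKul.
  by rewrite lie_sum_delta tP mulr0 mul0r subr0.
- exact: sl_emb_linear.
- by move=> a B B'; apply/matrixP => i j; rewrite !mxE.
- by move=> B /sl_hP[P' [_ ->]]; rewrite /sl_emb block_mxKul.
- by move=> M; rewrite !lie_emb; apply/sl_hP; exists (lie P (lie Q M)); rewrite tr_lie.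
Qed.

Lemma hmx_sqr : h *m h = 1%:M.
Proof. by rewrite /hmx mulmx_block !mul0mx !mul1mx ?mulmx0 ?addr0 ?add0r -scalar_mx_block. Qed.

Lemma tr_hmx : h^T = h.
Proof. by rewrite /hmx tr_block_mx !trmx0 trmx1. Qed.

Lemma so_adj X : X \in so_h R n -> h *m X^T *m h = - X.
Proof.
move=> /so_hP sX; have : h *m (X^T *m h + h *m X) = 0 by rewrite sX mulmx0.
by rewrite mulmxDr !mulmxA hmx_sqr mul1mx => /eqP; rewrite addr_eq0 => /eqP.
Qed.

Lemma lie_so X Y : X \in so_h R n -> Y \in so_h R n -> lie X Y \in so_h R n.
Proof.
move=> /so_hform sX /so_hform sY; apply/so_hform => v w.
rewrite /lie !mulmxBl -!mulmxA hformBl hformB !sX !sY !(sX, sY).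
by rewrite !opprK; ring.
Qed.

Lemma tr_so X : X \in so_h R n -> \tr X = 0.
Proof.
move=> sX; have : \tr (h *m X^T *m h) = \tr X.
  by rewrite mxtrace_mulC mulmxA hmx_sqr mul1mx mxtrace_tr.
rewrite so_adj // raddfN /= => /eqP.
by rewrite eq_sym -addr_eq0 -mulr2n -mulr_natl mulf_eq0 pnatr_eq0 => /eqP.
Qed.

Definition skew_part (M : 'M[R]_N) := 2^-1 *: (M - h *m M^T *m h).

Lemma skew_part_so M : skew_part M \in so_h R n.
Proof.
have e0 : (h *m M^T *m h)^T = h *m M *m h by rewrite !trmx_mul trmxK tr_hmx mulmxA.
have e1 : h *m M *m h *m h = h *m M by rewrite -mulmxA hmx_sqr mulmx1.
have e2 : h *m (h *m M^T *m h) = M^T *m h by rewrite !mulmxA hmx_sqr mul1mx.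
apply/so_hP; rewrite /skew_part linearZ linearB /= e0 -scalemxAl -scalemxAr -scalerDr.
by rewrite mulmxBl mulmxBr e1 e2 addrA subrK subrr scaler0.
Qed.

Lemma trace_adj_delta (P Q : 'M[R]_N) :
  \sum_i \sum_j (P *m (h *m (delta_mx i j)^T *m h) *m Q) i j = \tr (P *m (h *m Q^T *m h)).
Proof.
have -> : \tr (P *m (h *m Q^T *m h)) = \tr (P *m h *m (h *m Q)^T).
  by rewrite trmx_mul tr_hmx !mulmxA.
rewrite /mxtrace; apply: eq_bigr => i _; rewrite [RHS]mxE; apply: eq_bigr => j _.
rewrite trmx_delta !mulmxA -[_ *m delta_mx _ _ *m h *m Q]mulmxA.
move: (P *m h) (h *m Q) => A B.
rewrite mxE (bigD1 i) //= big1 ?addr0 => [|l li].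
  by rewrite mxE (bigD1 j) //= big1 ?addr0 => [|l lj]; rewrite !mxE ?eqxx ?mulr1 // (negbTE lj) mulr0.
by rewrite mxE big1 ?mul0r // => l' _; rewrite mxE (negbTE li) andbF mulr0.
Qed.

(** With M |-> (M - h M^T h) / 2 as retraction onto so(h), the Killing form
    becomes half the difference of the trace of ad X ad Y on all matrices and
    of its trace composed with the adjunction M |-> h M^T h. *)
Lemma killing_so X Y : X \in so_h R n -> Y \in so_h R n ->
  killing (so_h R n) X Y = 2 * n%:R * \tr (X *m Y).
Proof.
move=> sX sY; rewrite (@killing_trace _ _ N _ skew_part id) //; first last.
- by move=> M; rewrite !lie_so // skew_part_so.
- by move=> B sB; rewrite /skew_part so_adj // opprK scalerDr -scalerDl (_ : 2^-1 + 2^-1 = 1) ?scale1r //; field.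
- move=> a M M'; rewrite /skew_part linearP /= mulmxDr mulmxDl -scalemxAr -scalemxAl.
  by apply/matrixP => i j; rewrite !mxE; ring.
have E i j : lie X (lie Y (skew_part (delta_mx i j))) i j =
    2^-1 * (lie X (lie Y (delta_mx i j)) i j -
     ((X *m Y *m (h *m (delta_mx i j)^T *m h) *m 1%:M) i j +
      (1%:M *m (h *m (delta_mx i j)^T *m h) *m (Y *m X)) i j
    - ((X *m (h *m (delta_mx i j)^T *m h) *m Y) i j + (Y *m (h *m (delta_mx i j)^T *m h) *m X) i j))).
  rewrite /skew_part !lieZ mxE; congr (_ * _).
  move: (h *m _ *m h) => D; rewrite (lieB Y) (lieB X) mulmx1 mul1mx mxE; congr (_ + _).
  rewrite mxE; congr (- _).
  rewrite /lie !mulmxBr !mulmxBl !mulmxA.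
  set a := X *m Y *m _; set b := X *m _ *m Y; set c := Y *m _ *m X; set d := _ *m Y *m X.
  by rewrite !mxE; ring.
under eq_bigr do (under eq_bigr do rewrite E; rewrite -mulr_sumr sumrB sumrB !big_split /=).
rewrite -mulr_sumr sumrB sumrB !big_split /= lie_sum_delta !trace_adj_delta.
have -> : h *m 1%:M^T *m h = 1%:M by rewrite trmx1 mulmx1 hmx_sqr.
have -> : h *m (Y *m X)^T *m h = X *m Y.
  rewrite trmx_mul -[X^T](mulmx1) -hmx_sqr !mulmxA so_adj // !mulNmx -!mulmxA [h *m (Y^T *m h)]mulmxA.
  by rewrite so_adj // mulmxN opprK.
rewrite !so_adj // !mulmxN mulmx1 mul1mx !raddfN /= (mxtrace_mulC Y X) (tr_so sX).
by rewrite natrD -!natr1; field.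
Qed.

Lemma killing_so_wedge v z X : X \in so_h R n ->
  killing (so_h R n) (wedge v z) X = - (4 * n%:R) * hform z (X *m v).
Proof.
move=> sX; rewrite killing_so ?wedge_so // /wedge mulmxBl raddfB /=.
have T a b : \tr (a *m b^T *m h *m X) = hform b (X *m a).
  rewrite -!mulmxA mxtrace_mulC /mxtrace big_ord1 /hform !mulmxA.
  by [].
by rewrite !T; have /so_hform := sX; move=> sX'; rewrite (hformC v) sX'; ring.
Qed.

End Killing.

(** * The nilradical of the conformal parabolic *)

Section Nilradicals.
Variables (R : realType) (n : nat).
Local Notation N := (n.+1 + n.+1)%N.
Local Notation V := 'cV[R]_(n.+1 + n.+1).
Local Notation h := (hmx R n).
Local Notation vt := (vtilde R n).
Local Notation b := (@adapted R n).

Lemma adapted_ext (v w : V) : (forall p, hform (b p) v = hform (b p) w) -> v = w.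
Proof. by move=> vw; rewrite (adapted_sum v) (adapted_sum w); apply: eq_bigr => p _; rewrite vw. Qed.

Lemma adapted_mx_ext (A B : 'M[R]_N) : (forall p, A *m b p = B *m b p) -> A = B.
Proof.
move=> AB; apply: mulmx_cV_ext => v; rewrite (adapted_sum v) !mulmx_sumr.
by apply: eq_bigr => p _; rewrite -!scalemxAr AB.
Qed.

Let p0 : bool * 'I_n.+1 := (false, ord0).
Let e : V := b (dual p0).

Lemma so_alt A (x : V) : A \in so_h R n -> hform x (A *m x) = 0.
Proof.
move=> /so_hform sA; have := sA x x; rewrite hformC => /eqP.
by rewrite -addr_eq0 -mulr2n -mulr_natl mulf_eq0 pnatr_eq0 => /eqP.
Qed.

Lemma hform_vtilde (n0 : (0 < n)%N) p : hform vt (b p) = (p == dual p0)%:R.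
Proof. by rewrite -(adapted_vtilde R n0) hform_adapted. Qed.

Lemma wedge_liePt (x y : V) : hform x vt = 0 -> hform y vt = 0 ->
  liePt R n (wedge x y).
Proof.
move=> x0 y0; split; first exact: wedge_so.
by exists 0; rewrite wedgeE x0 y0 !scale0r subrr.
Qed.

Lemma vtilde_null (n0 : (0 < n)%N) : hform vt vt = 0.
Proof. by rewrite -{2}(adapted_vtilde R n0) hform_vtilde. Qed.

(** If A lies in a nilpotent ideal, ad A ad B is nilpotent on that ideal for
    every B in p~. With B = x /\ y and u = c x + A x, where x is null, the
    element v~ /\ u of the ideal is an eigenvector of ad A ad B with
    eigenvalue - h(y, u), which must vanish. *)
Lemma nilradical_scalar (n0 : (0 < n)%N) A c x y : nilradical (liePt R n) A ->
  A *m vt = c *: vt -> hform x x = 0 -> hform x vt = 0 -> hform y vt = 0 ->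
  hform y (c *: x + A *m x) = 0.
Proof.
move=> [I [idI nI IA]] Av xx xv yv; set u := c *: x + A *m x.
have [[I0 ID] Ip idI'] := idI; have pA := Ip _ IA; have [sA _] := pA.
have xu : hform x u = 0 by rewrite hformD hformZ xx so_alt // mulr0 addr0.
set mu := hform y u.
have vv := vtilde_null n0.
have vE : lie A (wedge vt x) = wedge vt u.
  rewrite lie_wedge // Av /u wedge_linear; congr (_ + _).
  by apply: mulmx_cV_ext => w; rewrite -scalemxAl !wedgeE hformZl scalerBr !scalerA (mulrC c (hform x w)).
have Iu : I (wedge vt u).
  have px : liePt R n (wedge vt x) by apply: wedge_liePt.
  have := ID (-1) _ _ (idI' _ _ px IA) I0.
  by rewrite scaleN1r addr0 lie_skew opprK vE.
have pB : liePt R n (wedge x y) by apply: wedge_liePt.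
have BE : lie (wedge x y) (wedge vt u) = (- mu) *: wedge vt x.
  rewrite lie_wedge ?wedge_so // !wedgeE xv yv xu !scale0r subrr sub0r.
  have -> : wedge 0 u = 0 by rewrite /wedge trmx0 mulmx0 !mul0mx subrr.
  by rewrite add0r -scaleNr -[_ *: x]addr0 wedge_linear wedge0 addr0.
(* the eigenvector belongs to all terms of the lower central series, up to
   powers of the eigenvalue *)
have lcu k : lower_central I k ((- mu) ^+ k *: wedge vt u).
  elim: k => [|k IH]; first by rewrite expr0 scale1r; apply: Lc0.
  have := LcS IA (lower_central_ideal idI pB IH).
  by rewrite !lieZ BE lieZ vE scalerA -exprSr.
have [K nK] := lower_central_nilpotent nI.
have /eqP := nK _ (lcu K); rewrite scaler_eq0 expf_eq0 oppr_eq0 => /orP[/andP[_ /eqP]//|/eqP w0].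
have : wedge vt u *m e = 0 by rewrite w0 mul0mx.
rewrite wedgeE hform_vtilde // eqxx scale1r => /eqP; rewrite subr_eq0 => /eqP ue.
by rewrite /mu ue hformZ yv mulr0.
Qed.

(** By [nilradical_scalar] A acts on L^perp / L as the scalar - c; a scalar
    skew map is zero, so c = 0 and A = v~ /\ A e for the null vector e dual to
    v~. *)
Lemma nilradical_liePt (n0 : (0 < n)%N) A : nilradical (liePt R n) A ->
  exists2 z, hform z vt = 0 & A = wedge vt z.
Proof.
move=> nA; have [I [[_ Ip _] _ IA]] := nA; have [sA [c Av]] := Ip _ IA.
have hb p : p != dual p0 -> hform (b p) vt = 0.
  by move=> pp; rewrite hformC hform_vtilde // (negbTE pp).
have null p : hform (b p) (b p) = 0 by rewrite hform_adapted; case: p => -[] i; rewrite /dual xpair_eqE.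
have K p q : p != dual p0 -> q != dual p0 ->
    c * hform (b q) (b p) + hform (b q) (A *m b p) = 0.
  move=> pp qp; have := nilradical_scalar n0 nA Av (null p) (hb p pp) (hb q qp).
  by rewrite hformD hformZ.
have /so_hform sA' := sA.
(* b_n and its dual are both orthogonal to v~ since n > 0 *)
have c0 : c = 0.
  have m1 : (false, @ord_max n) != dual p0 by rewrite xpair_eqE.
  have m2 : (true, @ord_max n) != dual p0.
    by rewrite xpair_eqE /= -val_eqE /= (gtn_eqF n0).
  have := K _ _ m1 m2; have := K _ _ m2 m1; rewrite !hform_adapted !eqxx !mulr1.
  rewrite (hformC _ (A *m _)) sA'; lra.
exists (A *m e); first by rewrite sA' Av c0 scale0r hform0 oppr0.
apply: adapted_mx_ext => p; rewrite wedgeE hform_vtilde //.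
apply: adapted_ext => q; rewrite hformB !hformZ.
have ee : hform (A *m e) e = 0 by rewrite hformC so_alt.
have [->|pp] := eqVneq p (dual p0); first by rewrite ee mulr1n -/e; ring.
have [->|qp] := eqVneq q (dual p0).
  rewrite -/e (hformC e (A *m _)) sA' (hformC e vt) hform_vtilde // eqxx.
  by rewrite (hformC (b p)) mulr0n mulr1n; ring.
have := K p q pp qp; rewrite c0 mul0r add0r => ->.
by rewrite (hb q qp) mulr0n; ring.
Qed.

End Nilradicals.

(** * Projective normality *)

Section ProjectiveFrame.
Variables (R : realType) (n : nat).
Local Notation N := (n.+1 + n.+1)%N.

Lemma sl_emb0 : sl_emb (0 : 'M[R]_n.+1) = 0.
Proof. by rewrite /sl_emb trmx0 oppr0 block_mx0. Qed.

Lemma sl_emb_sum I (r : seq I) (a : I -> R) (F : I -> 'M[R]_n.+1) :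
  sl_emb (\sum_(i <- r) a i *: F i) = \sum_(i <- r) a i *: sl_emb (F i).
Proof. exact: (lin_comb _ _ _ (@sl_emb_linear R n)). Qed.

Lemma sl_embD (A B : 'M[R]_n.+1) : sl_emb (A + B) = sl_emb A + sl_emb B.
Proof. by rewrite -[A in LHS]scale1r sl_emb_linear scale1r. Qed.

Lemma sl_embZ a (A : 'M[R]_n.+1) : sl_emb (a *: A) = a *: sl_emb A.
Proof. by rewrite -[a *: A]addr0 sl_emb_linear sl_emb0 addr0. Qed.

Lemma sl_embB (A B : 'M[R]_n.+1) : sl_emb (A - B) = sl_emb A - sl_emb B.
Proof. by rewrite -scaleN1r sl_embD sl_embZ scaleN1r. Qed.

Lemma sl_emb_inj : injective (@sl_emb R n).
Proof. by move=> A B; rewrite /sl_emb => /eq_block_mx[]. Qed.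

(** The matrices E_k0 induce the standard basis of g / p. The factor in [slZ]
    normalises the dual basis for the Killing form of sl(n+1). *)
Definition slX (i : 'I_n) : 'M[R]_N := sl_emb (delta_mx (lift ord0 i) ord0).
Definition slZ (i : 'I_n) : 'M[R]_N :=
  sl_emb ((2 * n.+1%:R)^-1 *: delta_mx ord0 (lift ord0 i)).

Lemma lift0_neq (i : 'I_n) : (lift ord0 i == ord0) = false.
Proof. by rewrite eq_sym (negbTE (neq_lift _ _)). Qed.

Lemma slX_sl i : slX i \in sl_h R n.
Proof. by apply/sl_hP; eexists; split; last reflexivity; rewrite tr_delta lift0_neq. Qed.

(** The matrices with entries in the first row only, off the diagonal, form an
    abelian ideal of p. *)
Lemma nilradical_lieP (r : 'rV[R]_n.+1) : r 0 ord0 = 0 ->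
  nilradical (lieP R n) (sl_emb (delta_mx ord0 0 *m r)).
Proof.
have tr0 (s : 'rV[R]_n.+1) : s 0 ord0 = 0 -> \tr ((delta_mx ord0 0 : 'cV[R]_n.+1) *m s) = 0.
  by move=> s0; rewrite mxtrace_mulC /mxtrace big_ord1 -colE mxE.
move=> r0; exists [set B | exists s : 'rV[R]_n.+1, s 0 ord0 = 0 /\ B = sl_emb (delta_mx ord0 0 *m s)].
split; last by exists r.
  split.
  - split=> [|a _ _ [s [s0 ->]] [s' [s0' ->]]].
      by exists 0; rewrite mxE mulmx0 sl_emb0.
    exists (a *: s + s'); split; first by rewrite !mxE s0 s0' mulr0 addr0.
    by rewrite -sl_emb_linear mulmxDr -scalemxAr.
  - move=> _ [s [s0 ->]]; apply/(lieP_emb (tr0 s s0)) => i i0.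
    by rewrite mxE big_ord1 !mxE (negbTE i0) mul0r.
  - move=> A _ pA [s [s0 ->]]; have [/sl_hP[P [tP AE]] _] := pA.
    move: pA; rewrite AE => /(lieP_emb tP) P0.
    exists (P ord0 ord0 *: s - s *m P); split.
      rewrite !mxE s0 mulr0 big1 ?subr0 // => k _.
      by have [->|/P0 ->] := eqVneq k ord0; rewrite ?s0 ?mul0r ?mulr0.
    have Pd : P *m delta_mx ord0 0 = P ord0 ord0 *: delta_mx ord0 0 :> 'cV[R]_n.+1.
      apply/colP => i; rewrite -colE !mxE andbT.
      by have [->|/P0 ->] := eqVneq i ord0; rewrite ?mulr1 ?mulr0.
    rewrite lie_emb; apply: (congr1 (@sl_emb R n)).
    by rewrite /lie mulmxBr [P *m _]mulmxA Pd -scalemxAl -scalemxAr mulmxA.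
exists 1%N => -[|A []] // B _ sI [s [s0 ->]] /=.
have [s' [s0' ->]] := sI A (mem_head _ _).
have c0 (q q' : 'rV[R]_n.+1) : q 0 ord0 = 0 ->
    (delta_mx ord0 0 : 'cV[R]_n.+1) *m q *m (delta_mx ord0 0 *m q') = 0.
  move=> q0; rewrite -mulmxA [q *m _]mulmxA [q *m _]mx11_scalar -colE mxE q0.
  by rewrite raddf0 mul0mx mulmx0.
by rewrite lie_emb /lie !c0 // subrr sl_emb0.
Qed.

Lemma sl_dual_frames : dual_frames (sl_h R n) (lieP R n) slX slZ.
Proof.
split=> [|A /sl_hP[P [tP ->]]|i|i j]; first exact: slX_sl.
- have E (a : 'rV[R]_n) : sl_emb P - \sum_i a 0 i *: slX i =
      sl_emb (P - \sum_i a 0 i *: delta_mx (lift ord0 i) ord0).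
    by rewrite sl_embB sl_emb_sum.
  have trE (a : 'rV[R]_n) : \tr (P - \sum_i a 0 i *: delta_mx (lift ord0 i) ord0) = 0.
    rewrite raddfB /= tP [\tr (\sum_i _)]raddf_sum big1 ?subr0 // => k _.
    by rewrite /= mxtraceZ tr_delta lift0_neq mulr0.
  have entry (a : 'rV[R]_n) k : (P - \sum_i a 0 i *: delta_mx (lift ord0 i) ord0) (lift ord0 k) ord0 =
      P (lift ord0 k) ord0 - a 0 k.
    rewrite !mxE summxE (bigD1 k) //= big1 ?addr0 => [|l lk]; rewrite !mxE ?eqxx ?mulr1 //.
    by rewrite (inj_eq lift_inj) eq_sym (negbTE lk) mulr0.
  exists (\row_k P (lift ord0 k) ord0); split.
    rewrite E; apply/(lieP_emb (trE _)) => i i0.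
    case: (unliftP ord0 i) => [k ->|ii]; last by rewrite ii eqxx in i0.
    by rewrite entry mxE subrr.
  move=> a; rewrite E => /(lieP_emb (trE a)) P0; apply/rowP => k.
  have := P0 (lift ord0 k) (negbT (lift0_neq k)); rewrite entry mxE => /eqP.
  by rewrite subr_eq0 => /eqP.
- pose r : 'rV[R]_n.+1 := (2 * n.+1%:R)^-1 *: delta_mx 0 (lift ord0 i).
  have -> : slZ i = sl_emb (delta_mx ord0 0 *m r).
    by rewrite /slZ /r -scalemxAr mul_delta_mx.
  by apply: nilradical_lieP; rewrite !mxE eq_sym lift0_neq mulr0.
- rewrite /slZ killing_sl ?mxtraceZ ?tr_delta 1?eq_sym ?lift0_neq ?mulr0 //.
  rewrite -scalemxAl mxtraceZ mulrA mulfV ?mul1r; last by rewrite mulf_neq0 ?pnatr_eq0.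
  have [->|ij] := eqVneq i j; first by rewrite mul_delta_mx tr_delta eqxx.
  by rewrite mul_delta_mx_0 ?raddf0 // (inj_eq lift_inj).
Qed.

(** Entries in the columns s > 0 of the vanishing sum of the [M_i, E_0i]: rows
    r > 0 give the absence of torsion, row 0 gives the trace condition. *)
Lemma normality_entries (M : 'I_n -> 'M[R]_n.+1) :
  \sum_i lie (sl_emb (M i)) (slZ i) = 0 ->
  (forall r i, r != ord0 -> M i r ord0 = 0) /\
  (forall s, M s ord0 ord0 = \sum_i M i (lift ord0 i) (lift ord0 s)).
Proof.
have -> : \sum_i lie (sl_emb (M i)) (slZ i) =
    \sum_i (2 * n.+1%:R)^-1 *: sl_emb (lie (M i) (delta_mx ord0 (lift ord0 i))).
  by apply: eq_bigr => i _; rewrite /slZ lie_emb lieZ sl_embZ.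
rewrite -scaler_sumr => /eqP; rewrite scaler_eq0 invr_eq0 mulf_eq0 !pnatr_eq0 /=.
have -> : \sum_i sl_emb (lie (M i) (delta_mx ord0 (lift ord0 i))) =
    sl_emb (\sum_i 1 *: lie (M i) (delta_mx ord0 (lift ord0 i))).
  by rewrite sl_emb_sum; apply: eq_bigr => i _; rewrite scale1r.
rewrite -sl_emb0 => /eqP/sl_emb_inj/matrixP S0.
have entry i r s : (1 *: lie (M i) (delta_mx ord0 (lift ord0 i))) r (lift ord0 s) =
    M i r ord0 * (s == i)%:R - (r == ord0)%:R * M i (lift ord0 i) (lift ord0 s).
  rewrite scale1r /lie !mxE; congr (_ - _).
    rewrite (bigD1 ord0) //= big1 ?addr0 => [|k k0]; rewrite !mxE ?eqxx ?(inj_eq lift_inj) //.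
    by rewrite (negbTE k0) mulr0.
  rewrite (bigD1 (lift ord0 i)) //= big1 ?addr0 => [|k ki]; rewrite !mxE ?eqxx ?andbT //.
  by rewrite (negbTE ki) andbF mul0r.
split=> [r i r0|s].
  have := S0 r (lift ord0 i); rewrite summxE mxE (eq_bigr _ (fun k _ => entry k r i)).
  rewrite (bigD1 i) //= big1 => [|k ki]; rewrite ?eqxx (negbTE r0) mul0r subr0.
    by rewrite mulr1 addr0.
  by rewrite eq_sym (negbTE ki) mulr0.
have := S0 ord0 (lift ord0 s); rewrite summxE mxE (eq_bigr _ (fun k _ => entry k ord0 s)).
rewrite sumrB (bigD1 s) //= big1 => [|k ks]; last by rewrite eq_sym (negbTE ks) mulr0.
rewrite eqxx mulr1 addr0 => /eqP; rewrite subr_eq0 => /eqP ->.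
by apply: eq_bigr => i _; rewrite mul1r.
Qed.

End ProjectiveFrame.

(** * The codifferential of the induced curvature *)

Section Fefferman.
Variables (R : realType) (n : nat).
Hypothesis n2 : (2 <= n)%N.
Local Notation N := (n.+1 + n.+1)%N.
Local Notation V := 'cV[R]_(n.+1 + n.+1).
Local Notation vt := (vtilde R n).
Local Notation nul := (@null_basis R n).

Let n0 : (0 < n)%N. Proof. exact: ltnW. Qed.

Lemma sl_so : (sl_h R n <= so_h R n)%VS.
Proof.
apply/subvP => B /sl_hP[A [_ ->]]; apply/so_hP.
rewrite /sl_emb /hmx tr_block_mx !mulmx_block !(mulmx0, mul0mx, mulmx1, mul1mx) !add0r !addr0.
rewrite !trmx0 linearN /= trmxK ?(mul0mx, mulmx0) add_block_mx ?addr0 ?add0r.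
by rewrite addrN addNr block_mx0.
Qed.

Lemma lieP_sl A : lieP R n A -> A \in sl_h R n. Proof. by case. Qed.
Lemma liePt_so A : liePt R n A -> A \in so_h R n. Proof. by case. Qed.

(** Coordinates on g~ / p~ modulo f = p / q; their index runs over the basis
    E_k0 of g / p. *)
Definition frame_coef (k : 'I_n) (X : 'M[R]_N) : R := hform (nul (true, lift ord0 k)) (X *m vt).

Lemma hform_eps k v : hform (nul (true, lift ord0 k)) v = usubmx v (lift ord0 k) 0.
Proof. by rewrite hform_nul. Qed.

(** Once the E_k0 are split off, X v~ = mu e_0 + y with y in F and y(e_0) = 0,
    and a trace-free matrix P of p with the same value on v~ exists: take mu
    at (0, 0) and - y as last row, and correct the trace at (1, 1), which is a
    further place because n >= 2. *)
Lemma so_split X : X \in so_h R n -> exists P T, [/\ lieP R n P, liePt R n T &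
  X = \sum_k frame_coef k X *: slX R k + P + T].
Proof.
move=> sX; pose Y := X - \sum_k frame_coef k X *: slX R k.
have sS : \sum_k frame_coef k X *: slX R k \in so_h R n.
  by apply: memv_suml => k _; rewrite memvZ // (subvP sl_so) // slX_sl.
have sY : Y \in so_h R n by rewrite memvB.
have [x [y Yv]] : exists x y, Y *m vt = col_mx x y.
  by exists (usubmx (Y *m vt)), (dsubmx (Y *m vt)); rewrite vsubmxK.
have xE : x = usubmx (Y *m vt) by rewrite Yv col_mxKu.
have slXv k : usubmx (slX R k *m vt) = delta_mx (lift ord0 k) 0.
  by rewrite /slX /vtilde sl_emb_mul col_mxKu mul_delta_mx.
have cX k l : frame_coef k (slX R l) = (k == l)%:R.
  by rewrite /frame_coef hform_eps slXv mxE eqxx andbT (inj_eq lift_inj).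
have x0 k : x (lift ord0 k) 0 = 0.
  rewrite xE -hform_eps /Y mulmxBl mulmx_suml hformB hform_sum (bigD1 k) //=.
  rewrite big1 ?addr0 => [|l lk]; rewrite -scalemxAl hformZ -/(frame_coef k (slX R _)) cX.
    by rewrite eqxx mulr1 subrr.
  by rewrite eq_sym (negbTE lk) mulr0.
have xm : x ord_max 0 = 0.
  have /unlift_some[k -> _] : ord0 != ord_max :> 'I_n.+1 by rewrite -val_eqE /= neq_ltn n0.
  exact: x0.
have y0 : y ord0 0 = 0.
  have := so_alt (vt) sY; rewrite Yv hformE /vtilde !(col_mxKu, col_mxKd).
  rewrite big_split /= (bigD1 ord0) //= big1 ?addr0 => [|i i0]; last by rewrite mxE (negbTE i0) mul0r.
  rewrite (bigD1 ord_max) //= big1 ?addr0 => [|i i0]; last by rewrite mxE (negbTE i0) mul0r.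
  by rewrite xm mulr0 addr0 [delta_mx _ _ _ _]mxE !eqxx mul1r.
have one_n : (1 < n.+1)%N by rewrite ltnS.
pose i1 : 'I_n.+1 := Ordinal one_n.
have i1m : i1 != ord_max by rewrite -val_eqE /= neq_ltn n2.
have i10 : i1 != ord0 by rewrite -val_eqE.
pose mu := x ord0 0.
pose P : 'M[R]_n.+1 := mu *: delta_mx ord0 ord0 - delta_mx ord_max 0 *m y^T
  - (mu - y ord_max 0) *: delta_mx i1 i1.
have tP : \tr P = 0.
  rewrite /P !raddfB /= !mxtraceZ !tr_delta !eqxx mxtrace_mulC -colE.
  by rewrite /mxtrace big_ord1 !mxE !ord1 !mulr1n; ring.
have Pe0 : P *m delta_mx ord0 0 = x.
  apply/colP => i; rewrite -colE !mxE big_ord1 !mxE y0 mulr0 subr0.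
  rewrite [ord0 == i1]eq_sym (negbTE i10) andbF mulr0 subr0.
  case: (unliftP ord0 i) => [k ->|->]; first by rewrite x0 lift0_neq mulr0.
  by rewrite eqxx mulr1.
have Pen : - (P^T *m delta_mx ord_max 0) = y.
  apply/colP => i; rewrite -colE !mxE big_ord1 !mxE.
  rewrite [ord_max == i1]eq_sym (negbTE i1m) /= mulr0 subr0 eqxx mul1r.
  have -> : (ord_max == ord0 :> 'I_n.+1) = false by rewrite -val_eqE /= gtn_eqF.
  by rewrite mulr0 sub0r opprK.
have PY : sl_emb P *m vt = Y *m vt by rewrite Yv /vtilde sl_emb_mul Pe0 Pen.
have slP : sl_emb P \in sl_h R n by apply/sl_hP; exists P.
exists (sl_emb P), (Y - sl_emb P); split.
- apply/(lieP_emb tP) => i i0; have /colP/(_ i) := Pe0; rewrite -colE mxE => ->.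
  by case: (unliftP ord0 i) => [k ->|ii]; [exact: x0|rewrite ii eqxx in i0].
- split; first by rewrite memvB // (subvP sl_so).
  by exists 0; rewrite mulmxBl PY subrr scale0r.
- by rewrite -addrA [sl_emb P + _]addrC subrK /Y addrC subrK.
Qed.

Section DualFrame.
Variables X Z : 'I_(n + n) -> 'M[R]_N.
Hypothesis XZ : dual_frames (so_h R n) (liePt R n) X Z.

(** Both sides have the form v~ /\ z and the same pairing with all X_j under
    the Killing form, which is nondegenerate there. *)
Lemma dual_frame_coef k : \sum_i frame_coef k (X i) *: Z i =
  (- (4 * n%:R))^-1 *: wedge vt (nul (true, lift ord0 k)).
Proof.
case: XZ => Xso Xb Zn ZX; pose C : R := - (4 * n%:R).
have C0 : C != 0 by rewrite oppr_eq0 mulf_neq0 ?pnatr_eq0 // -lt0n.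
have zE i : exists z, hform z vt = 0 /\ Z i = wedge vt z.
  by have [z zv ->] := nilradical_liePt n0 (Zn i); exists z.
have [z zP] := choice zE; rewrite -/C.
pose w := \sum_i frame_coef k (X i) *: z i - C^-1 *: nul (true, lift ord0 k).
have wE : \sum_i frame_coef k (X i) *: Z i - C^-1 *: wedge vt (nul (true, lift ord0 k)) = wedge vt w.
  have -> : w = - C^-1 *: nul (true, lift ord0 k) + \sum_i frame_coef k (X i) *: z i.
    by rewrite scaleNr addrC.
  rewrite wedge_linear wedge_sum [RHS]addrC scaleNr.
  by congr (_ - _); apply: eq_bigr => i _; rewrite (zP i).2.
(* w is proportional to v~: it is orthogonal to B v~ for every B in so(h) *)
suff w0 : wedge vt w = 0 by apply/eqP; rewrite -subr_eq0 wE w0.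
have zX i j : hform (z i) (X j *m vt) = C^-1 * (i == j)%:R.
  rewrite -ZX (zP i).2 killing_so_wedge // -/C.
  by rewrite mulrA mulVf // mul1r.
have hw v : hform w v = \sum_i frame_coef k (X i) * hform (z i) v - C^-1 * hform (nul (true, lift ord0 k)) v.
  rewrite /w hformBl hformZl hformC hform_sum; congr (_ - _).
  by apply: eq_bigr => i _; rewrite hformZ hformC.
have wX j : hform w (X j *m vt) = 0.
  rewrite hw (bigD1 j) //= big1 => [|i ij]; rewrite zX.
    by rewrite eqxx addr0 mulr1 mulrC subrr.
  by rewrite (negbTE ij) !mulr0.
have wv : hform w vt = 0.
  rewrite hw big1 => [|i _]; last by rewrite (zP i).1 mulr0.
  by rewrite hform_eps /vtilde col_mxKu !mxE lift0_neq mulr0 subrr.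
have wB B : B \in so_h R n -> hform w (B *m vt) = 0.
  move=> /Xb[a [[_ [c Bc]] _]].
  have -> : B *m vt = c *: vt + \sum_i a 0 i *: (X i *m vt).
    rewrite -Bc mulmxBl mulmx_suml.
    under [X in _ - X]eq_bigr do rewrite -scalemxAl.
    by rewrite subrK.
  rewrite hformD hformZ wv mulr0 add0r hform_sum big1 // => i _.
  by rewrite hformZ wX mulr0.
pose e := @adapted R n (true, ord0).
have ev : hform e vt = 1 by rewrite hformC hform_vtilde // eqxx.
have wvt : w = hform w e *: vt.
  apply/eqP; rewrite -subr_eq0; apply/eqP/hform_nondeg => b.
  have := wB _ (wedge_so e b); rewrite wedgeE ev scale1r hformB hformZ => wb.
  by rewrite hformBl hformZl -[RHS]wb (hformC vt); ring.
by rewrite wvt -[_ *: vt]addr0 wedge_linear wedgevv scaler0 add0r wedge0.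
Qed.

Section Curvature.
(** The curvature function of the induced connection, known only through its
    algebraic properties: all that the codifferential depends on. *)
Variable kt : 'M[R]_N -> 'M[R]_N -> 'M[R]_N.
Hypothesis kt_lin : forall A (a : R) B C, A \in so_h R n -> B \in so_h R n -> C \in so_h R n ->
  kt A (a *: B + C) = a *: kt A B + kt A C.
Hypothesis kt_skew : forall A B, kt A B = - kt B A.
Hypothesis kt_pt : forall A B, liePt R n A -> B \in so_h R n -> kt A B = 0.
Hypothesis kt_p : forall A B, lieP R n A -> B \in sl_h R n -> kt A B = 0.
Hypothesis kt_sl : forall A B, A \in sl_h R n -> B \in sl_h R n -> kt A B \in sl_h R n.
Hypothesis kt_normal : forall A, A \in sl_h R n ->
  codifferential (slX R (n := n)) (slZ R (n := n)) kt A = 0.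

Let psi := codifferential X Z kt.

Lemma kt_lin_l A (a : R) B C : A \in so_h R n -> B \in so_h R n -> C \in so_h R n ->
  kt (a *: B + C) A = a *: kt B A + kt C A.
Proof.
by move=> sA sB sC; rewrite kt_skew kt_lin // opprD -scalerN -!kt_skew.
Qed.

Lemma ktD_l A B C : A \in so_h R n -> B \in so_h R n -> C \in so_h R n ->
  kt (B + C) A = kt B A + kt C A.
Proof. by move=> *; rewrite -[B in LHS]scale1r kt_lin_l // scale1r. Qed.

Lemma kt0_l A : A \in so_h R n -> kt 0 A = 0.
Proof.
move=> sA; have := kt_lin_l 1 sA (mem0v _) (mem0v _); rewrite !scale1r addr0 => E.
by apply: (addrI (kt 0 A)); rewrite -E addr0.
Qed.

Lemma kt_sum_l A I (r : seq I) (a : I -> R) F : A \in so_h R n -> (forall i, F i \in so_h R n) ->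
  kt (\sum_(i <- r) a i *: F i) A = \sum_(i <- r) a i *: kt (F i) A.
Proof.
move=> sA sF; elim: r => [|i r IH]; rewrite ?big_nil ?kt0_l // !big_cons kt_lin_l ?IH //.
by apply: memv_suml => k _; rewrite memvZ.
Qed.

(** Every class of g~ / p~ = g / q has a representative in g. *)
Lemma sl_representative A : A \in so_h R n -> exists2 A', A' \in sl_h R n &
  forall B, B \in so_h R n -> kt B A = kt B A'.
Proof.
move=> sA; have [P [T [pP pT AE]]] := so_split sA.
have sS : \sum_k frame_coef k A *: slX R k \in sl_h R n.
  by apply: memv_suml => k _; rewrite memvZ // slX_sl.
exists (\sum_k frame_coef k A *: slX R k + P); first by rewrite memvD // lieP_sl.
have sSP : \sum_k frame_coef k A *: slX R k + P \in so_h R n.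
  by rewrite (subvP sl_so) // memvD // lieP_sl.
move=> B sB; rewrite {1}AE kt_skew (ktD_l sB sSP (liePt_so pT)).
by rewrite (kt_pt pT sB) addr0 -kt_skew.
Qed.

Lemma kt_p_so A B : lieP R n A -> B \in so_h R n -> kt A B = 0.
Proof.
move=> pA sB; have [B' slB' ->] := sl_representative sB; first exact: kt_p.
by rewrite (subvP sl_so) // lieP_sl.
Qed.

(** kt A depends only on the class of its argument modulo p + p~. *)
Lemma kt_frame B A : B \in so_h R n -> A \in so_h R n ->
  kt B A = \sum_k frame_coef k B *: kt (slX R k) A.
Proof.
move=> sB sA; have [P [T [pP pT BE]]] := so_split sB.
have sX k : slX R k \in so_h R n by rewrite (subvP sl_so) // slX_sl.
have sS : \sum_k frame_coef k B *: slX R k \in so_h R n.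
  by apply: memv_suml => k _; rewrite memvZ.
have sP : P \in so_h R n by rewrite (subvP sl_so) // lieP_sl.
rewrite {1}BE (ktD_l sA (memvD sS sP) (liePt_so pT)) (ktD_l sA sS sP).
by rewrite (kt_pt pT sA) (kt_p_so pP sA) !addr0 kt_sum_l.
Qed.

Lemma codifferential_frame A : A \in so_h R n -> psi A =
  (2 * (- (4 * n%:R))^-1) *: \sum_k lie (kt (slX R k) A) (wedge vt (nul (true, lift ord0 k))).
Proof.
move=> sA; case: (XZ) => Xso _ _ _; rewrite /psi /codifferential -scalerA; congr (_ *: _).
rewrite scaler_sumr.
have E i : lie (kt (X i) A) (Z i) = \sum_k frame_coef k (X i) *: lie (kt (slX R k) A) (Z i).
  rewrite kt_frame // lie_skew.
  rewrite (lin_comb _ _ _ (fun a u v => lie_linear (Z i) a u v)) -sumrN.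
  by apply: eq_bigr => k _; rewrite -scalerN -lie_skew.
rewrite (eq_bigr _ (fun i _ => E i)) exchange_big; apply: eq_bigr => k _ /=.
rewrite -lieZ -dual_frame_coef.
by rewrite (lin_comb _ _ _ (fun a u v => lie_linear _ a u v)).
Qed.

(** The terms in e_0 of M_k v~ /\ eps^k and of v~ /\ M_k eps^k cancel: summed
    over k, the latter are - lam_k v~ /\ eps^k by the trace condition, and M_k
    v~ - lam_k v~ is an element of Fbar. *)
Lemma codifferential_Lambda2_Fbar A : A \in so_h R n -> Lambda2_Fbar R n (psi A).
Proof.
move=> sA; rewrite codifferential_frame //; have [A' slA' kA] := sl_representative sA.
have sX k : slX R k \in so_h R n by rewrite (subvP sl_so) // slX_sl.
have ME k : exists M, kt (slX R k) A = sl_emb M.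
  have /sl_hP[M [_ ME]] := kt_sl (slX_sl R k) slA'.
  by exists M; rewrite kA.
have [M kM] := choice ME.
have : \sum_i lie (sl_emb (M i)) (slZ R i) = 0.
  have := kt_normal slA'; rewrite /codifferential => /eqP.
  rewrite scaler_eq0 pnatr_eq0 /= => /eqP; apply: etrans.
  by apply: eq_bigr => i _; rewrite -kM kA.
move=> /normality_entries[M0 Mtr].
pose lam k := M k ord0 ord0.
pose vk k := kt (slX R k) A *m vt - lam k *: vt.
have sK k : kt (slX R k) A \in so_h R n.
  by rewrite kA // (subvP sl_so) // kt_sl // slX_sl.
(* no torsion: the component in E of M_k v~ is lam_k e_0 *)
have Kv k : kt (slX R k) A *m vt = col_mx (lam k *: delta_mx ord0 0) (- ((M k)^T *m delta_mx ord_max 0)).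
  rewrite kM /vtilde sl_emb_mul; congr col_mx; apply/colP => r.
  rewrite -colE !mxE andbT; case: eqP => [->|/eqP r0]; first by rewrite mulr1.
  by rewrite mulr0 M0.
(* the trace condition *)
have S : \sum_k wedge vt (kt (slX R k) A *m nul (true, lift ord0 k)) =
    - \sum_k lam k *: wedge vt (nul (true, lift ord0 k)).
  have E : \sum_k (kt (slX R k) A *m nul (true, lift ord0 k)) =
      \sum_k (- lam k) *: nul (true, lift ord0 k).
    have up k : usubmx (kt (slX R k) A *m nul (true, lift ord0 k)) = 0.
      by rewrite kM /null_basis /= sl_emb_mul mulmx0 col_mxKu.
    have dn k r : dsubmx (kt (slX R k) A *m nul (true, lift ord0 k)) r 0 = - M k (lift ord0 k) r.
      by rewrite kM /null_basis /= sl_emb_mul col_mxKd -colE !mxE.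
    rewrite -[LHS]vsubmxK -[RHS]vsubmxK; congr col_mx.
      rewrite !linear_sum /= big1 ?big1 // => k _; rewrite ?up //.
      by rewrite linearZ /= /null_basis /= col_mxKu scaler0.
    apply/colP => r; rewrite !linear_sum /= !summxE (eq_bigr _ (fun k _ => dn k r)) sumrN.
    have nd k : dsubmx ((- lam k) *: nul (true, lift ord0 k)) r 0 = - (lam k * (r == lift ord0 k)%:R).
      by rewrite linearZ /= /null_basis /= col_mxKd !mxE andbT mulNr.
    rewrite (eq_bigr _ (fun k _ => nd k)) sumrN; congr (- _).
    case: (unliftP ord0 r) => [t ->|->].
      transitivity (lam t); first by rewrite /lam Mtr.
      rewrite (bigD1 t) //= big1 ?addr0 => [|k kt0]; first by rewrite eqxx mulr1.
      by rewrite (inj_eq lift_inj) eq_sym (negbTE kt0) mulr0.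
    rewrite !big1 // => k _; last by rewrite M0 // lift0_neq.
    by rewrite eq_sym lift0_neq mulr0.
  have -> : \sum_k wedge vt (kt (slX R k) A *m nul (true, lift ord0 k)) =
      wedge vt (\sum_k 1 *: (kt (slX R k) A *m nul (true, lift ord0 k))).
    by rewrite wedge_sum; apply: eq_bigr => k _; rewrite scale1r.
  under [X in wedge vt X]eq_bigr do rewrite scale1r.
  by rewrite E wedge_sum -sumrN; apply: eq_bigr => k _; rewrite scaleNr.
have wedgeBl (a b c : V) (t : R) : wedge (a - t *: b) c = wedge a c - t *: wedge b c.
  apply: mulmx_cV_ext => v; rewrite [RHS]mulmxBl -scalemxAl !wedgeE hformBl hformZl.
  by apply/colP => i; rewrite !mxE; ring.
have wedgeZl (a c : V) (t : R) : wedge (t *: a) c = t *: wedge a c.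
  by apply: mulmx_cV_ext => v; rewrite -scalemxAl !wedgeE hformZl; apply/colP => i; rewrite !mxE; ring.
exists n, (fun k => (2 * (- (4 * n%:R))^-1) *: vk k), (fun k => nul (true, lift ord0 k)).
split.
  move=> k; split; split.
  - have vu : usubmx (vk k) = 0.
      by rewrite /vk Kv /vtilde scale_col_mx opp_col_mx add_col_mx col_mxKu subrr.
    by rewrite [usubmx _]linearZ /= vu scaler0.
  - by rewrite /Lperp /= hformZ hformB hformZ so_alt // vtilde_null // mulr0 subrr mulr0.
  - by rewrite /null_basis /= col_mxKu.
  - by rewrite /Lperp /= hformC hform_eps /vtilde col_mxKu mxE lift0_neq.
under [RHS]eq_bigr do rewrite wedgeZl.
rewrite -scaler_sumr; congr (_ *: _).
under eq_bigr do rewrite lie_wedge //.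
rewrite big_split /= S.
under [RHS]eq_bigr do rewrite wedgeBl.
by rewrite [RHS]sumrB.
Qed.

Lemma codifferential_f_tensor (NN : set 'M[R]_N) W : NN 0 -> (forall A, Lambda2_Fbar R n A -> W A) ->
  f_tensor NN W psi.
Proof.
move=> NN0 FW; case: (XZ) => Xso _ _ _; split.
- move=> a A B sA sB; suff -> : psi (a *: A + B) = a *: psi A + psi B by rewrite subrr.
  rewrite /psi /codifferential scalerA mulrC -scalerA -scalerDr; congr (_ *: _).
  rewrite scaler_sumr -big_split /=; apply: eq_bigr => i _.
  by rewrite kt_lin // lie_skew lie_linear opprD -scalerN -!lie_skew.
- move=> A pA; rewrite /psi /codifferential big1 ?scaler0 // => i _.
  by rewrite kt_skew kt_pt // oppr0 lie_skew lie0 oppr0.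
- move=> A pA; rewrite /psi /codifferential big1 ?scaler0 // => i _.
  by rewrite kt_skew kt_p_so // oppr0 lie_skew lie0 oppr0.
- by move=> A sA; apply/FW/codifferential_Lambda2_Fbar.
Qed.

End Curvature.
End DualFrame.

(** Fbar is orthogonal to v~, so its bivectors annihilate v~. *)
Lemma Lambda2_Fbar_f A : Lambda2_Fbar R n A -> Lambda2_f R n A.
Proof.
move=> [k [v [w [vw ->]]]].
have Av : (\sum_i wedge (v i) (w i)) *m vt = 0.
  rewrite mulmx_suml big1 // => i _; have [[_ vL] [_ wL]] := vw i.
  by rewrite wedgeE hformC vL hformC wL !scale0r subrr.
split=> //.
  split; first by apply: memv_suml => i _; apply: wedge_so.
  by exists 0; rewrite Av scale0r.
by exists k, v, w; split=> // x _; exists 0; rewrite scale0r addr0.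
Qed.

End Fefferman.

Theorem proposition4p9 (R : realType) (n : nat) (hn : (2 <= n)%N)
    (sE sF : 'cV[R]_(spin_dim n)) (hsE : spinor_E sE) (hsF : spinor_F sF)
    (* the normal projective Cartan geometry (GG -> M, omega) of type (G, P) *)
    (dGG : nat) (M : manifold R n) (GG : manifold R dGG) (pi : GG -> M)
    (act : GG -> 'M[R]_(spin_dim n) -> GG)
    (omega : GG -> 'rV[R]_dGG -> 'M[R]_(n.+1 + n.+1))
    (homega : cartan_geometry (sl_h R n) (groupP sE sF) pi act omega)
    (hnormal : normal_projective omega)
    (* M~ = GG / Q *)
    (Mt : manifold R (n + n)) (pit : GG -> Mt)
    (hMt : principal_bundle (groupQ sE sF) pit act)
    (* GG~ = GG x_Q P~ -> M~, with the inclusion j of GG *)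
    (dGGt : nat) (GGt : manifold R dGGt) (pitt : GGt -> Mt)
    (actt : GGt -> 'M[R]_(spin_dim n) -> GGt) (j : GG -> GGt)
    (hj : smooth_map_on setT j)
    (hj_pi : forall u, pitt (j u) = pit u)
    (hj_act : forall u q, groupQ sE sF q -> j (act u q) = actt (j u) q)
    (* omega~, restricting to omega on GG *)
    (omegat : GGt -> 'rV[R]_dGGt -> 'M[R]_(n.+1 + n.+1))
    (homegat : cartan_geometry (so_h R n) (groupPt R n) pitt actt omegat)
    (hrestr : forall u v, omegat (j u) (tangent_map j u v) = omega u v) :
  forall (u : GG) (X Z : 'I_(n + n) -> 'M[R]_(n.+1 + n.+1)),
    dual_frames (so_h R n) (liePt R n) X Z ->
    f_tensor [set 0] (Lambda2_Fbar R n)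
      (codifferential X Z (curvature omegat (j u))) /\
    f_tensor (nilradical (liePt R n)) (Lambda2_f R n)
      (codifferential X Z (curvature omegat (j u))).
Proof.
move=> u X Z XZ; set kt := curvature omegat (j u).
have restr A B : A \in sl_h R n -> B \in sl_h R n -> kt A B = curvature omega u A B.
  by move=> slA slB; apply: (curvature_restrict homega homegat hj hrestr (sl_so R n)).
have slM A B : A \in sl_h R n -> B \in sl_h R n -> lie A B \in sl_h R n.
  move=> /sl_hP[P [_ ->]] /sl_hP[Q [_ ->]]; apply/sl_hP; exists (lie P Q).
  by rewrite tr_lie lie_emb.
have horizontal (g : {vspace 'M[R]_(n.+1 + n.+1)}) k : 
    (forall A (a : R) B C, A \in g -> B \in g -> C \in g -> k (a *: B + C) A = a *: k B A + k C A) ->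
    is_subspace [set A | A \in g /\ forall B, B \in g -> k A B = 0 :> 'M[R]_(n.+1 + n.+1)].
  move=> kl; split.
    split=> [|B gB]; first exact: mem0v.
    have := kl B 1 0 0 gB (mem0v _) (mem0v _); rewrite !scale1r addr0 => E.
    by apply: (addrI (k 0 B)); rewrite -E addr0.
  move=> a A B [gA kA] [gB kB]; split=> [|C gC]; first by rewrite memvD ?memvZ.
  by rewrite kl // kA // kB // scaler0 addr0.
have pt A B : liePt R n A -> B \in so_h R n -> kt A B = 0.
  move=> pA; have [_ +] := liePt_ind (ltnW hn) (horizontal _ _ (curvature_linear_l homegat (j u)))
    (fun A gA HA => conj gA (fun B gB => curvature_horizontal homegat (j u) gA gB HA)) pA.
  exact.
have p A B : lieP R n A -> B \in sl_h R n -> kt A B = 0.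
  move=> pA slB; rewrite (restr _ _ (lieP_sl pA) slB).
  have [_ +] := lieP_ind hsE hsF (horizontal _ _ (curvature_linear_l homega u))
    (fun A gA HA => conj gA (fun B gB => curvature_horizontal homega u gA gB HA)) pA.
  exact.
have T := codifferential_f_tensor hn XZ (curvature_linear homegat (j u))
  (curvature_skew omegat (j u)) pt p.
have slk A B : A \in sl_h R n -> B \in sl_h R n -> kt A B \in sl_h R n.
  by move=> slA slB; rewrite restr //; apply: (curvature_in homega).
have nk A : A \in sl_h R n -> codifferential (slX R (n := n)) (slZ R (n := n)) kt A = 0.
  move=> slA; apply: etrans (hnormal u _ _ (sl_dual_frames R n) A slA).
  apply: (congr1 ( *:%R 2)); apply: eq_bigr => i _.
  exact: (congr1 (fun B => lie B (slZ R i)) (restr _ _ (slX_sl R i) slA)).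
split; apply: T => //; last exact: Lambda2_Fbar_f.
apply: nilradical0; split; first exact: mem0v.
by exists 0; rewrite mul0mx scale0r.
Qed.
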